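(* (Weak law of large numbers.) Let $X$ be the $(P_t,\psi)$-superprocess described in the context. Assume: (1) the measure $\int_E\gamma(x,\mathrm{d}y)\,m(\mathrm{d}x)$ (a measure in $\mathrm{d}y$) belongs to the Kato class $\mathbf{K}(\xi)$; (2) the functions $x\mapsto a(x)$ and $x\mapsto\gamma(x,1)$ belong to $L^2(E,m)$; (3) there exist a constant $\lambda_1<0$ and strictly positive functions $h,\widehat h\in\mathcal{F}$, with $h$ bounded and continuous, $\|h\|_{L^2(E,m)}=1$ and $(h,\widehat h)=1$, such that $\mathcal{Q}(h,v)=\lambda_1(h,v)$ and $\mathcal{Q}(v,\widehat h)=\lambda_1(v,\widehat h)$ for all $v\in\mathcal{F}$; (4) the operators $f\mapsto\psi(\cdot,f)$ and $f\mapsto\gamma(\cdot,f)-a(\cdot)f(\cdot)$ preserve $\mathcal{C}^\xi_b(E)$; (5) $p\in(1,2]$ is such that $\sup_{x\in E}h(x)^{-1}\int_{\mathcal{M}(E)^0}\nu(h)^pH(x,\mathrm{d}\nu)<+\infty$; (6) $\lim_{t\to+\infty}\sup_{x\in E}\operatorname{ess\,sup}_{y\in E}|\widetilde p(t,x,y)-1|=0$, where $\widetilde p(t,x,y)=\frac{e^{\lambda_1t}}{h(x)\widehat h(y)}\mathfrak{p}(t,x,y)$. Then for any $\mu\in\mathcal{M}(E)$ and any $f\in\mathcal{B}^+(E)$ with $f/h$ bounded, $$\lim_{t\to+\infty}e^{\lambda_1t}\langle f,X_t\rangle=(f,\widehat h)\,W^h_\infty(X)\qquad\text{in }L^p(\mathrm{P}_\mu),$$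 where $W^h_\infty(X)$ is the ($\mathrm{P}_\mu$-a.s.) limit as $t\to\infty$ of the nonnegative $\mathrm{P}_\mu$-martingale $W^h_t(X)=e^{\lambda_1t}\langle h,X_t\rangle$.
   Context: Setting. $E$ is a locally compact separable metric space with Borel $\sigma$-algebra $\mathcal{B}(E)$, $m$ is a $\sigma$-finite measure on $E$ with full support, and $E_\partial=E\cup\{\partial\}$ is the one-point compactification; functions on $E$ are extended by $f(\partial)=0$. $\mathcal{M}(E)$ is the space of finite Borel measures on $E$ with the weak topology, $\mathcal{M}(E)^0=\mathcal{M}(E)\setminus\{0\}$. Write $\langle f,\mu\rangle=\mu(f)=\int f\,\mathrm{d}\mu$, $(f,g)=\int_E fg\,\mathrm{d}m$. $\mathcal{B}_b(E)$, $\mathcal{B}^+(E)$, $\mathcal{B}_b^+(E)$ denote bounded, nonnegative, and bounded nonnegative Borel functions. A function $f(x,t)$ is locally bounded if $\sup_{t\le T}\sup_x|f(x,t)|<\infty$ for every $T\in(0,\infty)$. Essential suprema are with respect to $m$. Spatial motion. $\xi=(\xi_t,\Pi_x)$ is an $m$-symmetric Hunt process on $E$, with transition semigroup $P_tf(x)=\Pi_x[f(\xi_t)]$, associated with a regular symmetric Dirichlet form $(\mathcal{E},\mathcal{F})$ on $L^2(E,m)$; $\xi$ has a transition density $p(t,x,y)$ with respect to $m$, symmetric in $(x,y)$ for each $t>0$. A measurable function $f$ is finely continuous with respect to $\xi$ if $t\mapsto f(\xi_t)$ is a.s. right continuous on $[0,\infty)$; $\mathcal{C}^\xi_b(E)$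 is the set of bounded measurable finely continuous functions (for $\psi$, which is defined on nonnegative functions, ''preserves'' refers to nonnegative $f\in\mathcal{C}^\xi_b(E)$). Superprocess. The branching mechanism is, for $x\in E$, $f\in\mathcal{B}_b^+(E)$, $$\psi(x,f)=a(x)f(x)+b(x)f(x)^2-\eta(x,f)+\int_{\mathcal{M}(E)^0}\big(e^{-\nu(f)}-1+\nu(\{x\})f(x)\big)H(x,\mathrm{d}\nu),$$ where $a\in\mathcal{B}_b(E)$, $b\in\mathcal{B}_b^+(E)$, $\eta(x,\mathrm{d}y)$ is a bounded kernel on $E$ (with $\eta(x,f)=\int f(y)\eta(x,\mathrm{d}y)$), and $H(x,\mathrm{d}\nu)$ is a $\sigma$-finite kernel from $E$ to $\mathcal{M}(E)^0$ with $\sup_{x}\int(\nu(1)\wedge\nu(1)^2+\nu_x(1))H(x,\mathrm{d}\nu)<\infty$; here $\nu_x$ is the restriction of $\nu$ to $E\setminus\{x\}$. Put $\gamma(x,\mathrm{d}y)=\eta(x,\mathrm{d}y)+\int_{\mathcal{M}(E)^0}\nu_x(\mathrm{d}y)H(x,\mathrm{d}\nu)$ (a bounded kernel) and $\gamma(x,f)=\int f(y)\gamma(x,\mathrm{d}y)$. The $(P_t,\psi)$-superprocess $X=(X_t)_{t\ge0}$ is the $\mathcal{M}(E)$-valued Markov process, with law $\mathrm{P}_\mu$ when started from $\mu\in\mathcal{M}(E)$ (the symbol $\mathrm{P}_\mu$ also denotes expectation), satisfying $\mathrm{P}_\mu(e^{-\langle f,X_t\rangle})=e^{-\langle V_tf,\mu\rangle}$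 for $f\in\mathcal{B}_b^+(E)$, where $V_tf$ is the unique nonnegative locally bounded solution of $V_tf(x)=P_tf(x)-\Pi_x[\int_0^t\psi(\xi_s,V_{t-s}f)\,\mathrm{d}s]$. $X$ is realized as the coordinate process on the space of right continuous paths from $[0,\infty)$ to $\mathcal{M}(E)$ having $0$ as a trap, and $(\mathcal{F}_t)$ is the filtration generated by the coordinate process, completed with the $\mathrm{P}_\mu$-negligible sets for every $\mu$. Under (1)-(3), $(W^h_t(X))$ is a nonnegative $\mathrm{P}_\mu$-martingale with respect to $(\mathcal{F}_t)$ for every $\mu$. Mean semigroup. For $f\in\mathcal{B}_b(E)$, $\mathrm{P}_\mu(\langle f,X_t\rangle)=\langle\mathfrak{P}_tf,\mu\rangle$, where $\mathfrak{P}_tf$ is the unique locally bounded solution of $\mathfrak{P}_tf(x)=P_tf(x)-\Pi_x[\int_0^ta(\xi_s)\mathfrak{P}_{t-s}f(\xi_s)\,\mathrm{d}s]+\Pi_x[\int_0^t\gamma(\xi_s,\mathfrak{P}_{t-s}f)\,\mathrm{d}s]$. $(\mathfrak{P}_t)$ is a semigroup and has a transition density $\mathfrak{p}(t,x,y)$ with respect to $m$. Kato class. A nonnegative measure $\mu$ on $E$ is a smooth measure of $\xi$ if there is a positive continuous additive functional $A^\mu$ of $\xi$ with $\int f\,\mathrm{d}\mu=\lim_{t\to0}\frac1t\int_E\Pi_x[\int_0^tf(\xi_s)\,\mathrm{d}A^\mu_s]m(\mathrm{d}x)$ for all $f\in\mathcal{B}^+(E)$; it belongs to $\mathbf{K}(\xi)$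 if moreover $\lim_{t\downarrow0}\sup_{x\in E}\int_0^t\int_Ep(s,x,y)\mu(\mathrm{d}y)\,\mathrm{d}s=0$. Bilinear form. For $u,v\in\mathcal{F}$, $\mathcal{Q}(u,v)=\mathcal{E}(u,v)+\int_Ea(x)u(x)v(x)m(\mathrm{d}x)-\int_E\int_Eu(y)v(x)\gamma(x,\mathrm{d}y)m(\mathrm{d}x)$. *)

(* Defs.v *)
From HB Require Import structures.
From mathcomp Require Import all_boot all_order all_algebra.
From mathcomp Require Import all_classical all_reals all_analysis.
From mathcomp Require Import measurable_realfun ess_sup_inf.

Set Implicit Arguments.
Unset Strict Implicit.
Unset Printing Implicit Defensive.
Import Order.TTheory GRing.Theory Num.Theory.
Import numFieldNormedType.Exports.
Local Open Scope classical_set_scope.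
Local Open Scope ring_scope.

(* Measurable types are pointed in MathComp-Analysis, hence the nonempty
   metric spaces below. *)
#[short(type="pmetricType")]
HB.structure Definition PointedMetric (K : numDomainType) :=
  { M of Metric K M & isPointed M }.

(* [T] with its Borel sigma-algebra; [borel T] and [T] are convertible, and
   topological notions are always taken on [T]. *)
Notation borel T := (g_sigma_algebraType (@open T)).

Definition separable_space (T : topologicalType) :=
  exists D : set T, countable D /\ dense D.

(* The sigma-algebra generated by the [X r] with [r] in [I]. *)
Definition sigma_of (R : realType) (O : Type) d (T : measurableType d)
    (I : set R) (X : R -> O -> T) : set (set O) :=
  <<s [set A | exists r B, [/\ I r, measurable B & A = X r @^-1` B]] >>.

Section functions.
Context (R : realType) (E : pmetricType R).
Implicit Types (f : E -> R) (v : R -> E -> R).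

Definition Borel_fun f := measurable_fun [set: borel E] (f : borel E -> R).
Definition Bb : set (E -> R) := [set f | Borel_fun f /\ bounded_fun f].
Definition Bplus : set (E -> R) := [set f | Borel_fun f /\ forall x, 0 <= f x].
Definition Bbplus : set (E -> R) := Bb `&` Bplus.

Definition locally_bounded v := forall T, 0 < T ->
  exists C, forall t x, 0 <= t <= T -> `|v t x| <= C.
Definition jointly_Borel v :=
  measurable_fun [set z : R * borel E | 0 <= z.1] (fun z => v z.1 z.2).

(* Extension to the one-point compactification by f(cemetery) = 0. *)
Definition ext0 f (y : one_point_compactification E) : R :=
  if y is Some x then f x else 0.

Definition Cc : set (E -> R) :=
  [set f | continuous f /\ compact (closure [set x | f x != 0])].

Definition Cb := {f : E -> R | continuous f /\ bounded_fun f}.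
End functions.

(* A MathComp measure is a function on all sets, constrained on measurable ones
   only: measures are therefore never compared with [=] below, but through
   their values on measurable sets. *)
Section finite_measures.
Context (R : realType) (E : pmetricType R).

Definition fmeas := {finite_measure set (borel E) -> \bar R}.

Definition pairing (nu : fmeas) : {ptws Cb E -> R} :=
  fun f => \int[nu]_x sval f x.

HB.instance Definition _ := gen_eqMixin fmeas.
HB.instance Definition _ := gen_choiceMixin fmeas.
HB.instance Definition _ := isPointed.Build fmeas mzero.
HB.instance Definition _ := Topological.copy fmeas (initial_topology pairing).

Definition fmeas0 : set fmeas := [set nu | nu setT != 0%E].
End finite_measures.

Section hunt.
Context (R : realType) (E : pmetricType R) (dO : measure_display)
  (O : measurableType dO).
Local Notation Ed := (one_point_compactification E).

Section filtrations.
Variables (X : R -> O -> borel Ed).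

Definition natfilt t := sigma_of [set r | 0 <= r <= t] X.
Definition natfilt_oo := sigma_of [set r | 0 <= r] X.
Definition natfilt_right t : set (set O) :=
  [set A | forall s, t < s -> natfilt s A].

Definition stopping_time (tau : O -> \bar R) :=
  (forall w, 0 <= tau w)%E /\
  forall t, 0 <= t -> natfilt_right t [set w | (tau w <= t%:E)%E].

Definition natfilt_right_at (tau : O -> \bar R) : set (set O) :=
  [set A | natfilt_oo A /\ forall t, 0 <= t ->
    natfilt_right t (A `&` [set w | (tau w <= t%:E)%E])].
End filtrations.

(* Only the times [t >= 0] matter; the state [None] is the cemetery.  The strong
   Markov property and quasi-left continuity are stated for the right-continuous
   natural filtration and all [Pi x]. *)
Record hunt_process := HuntProcess {
  xi : R -> O -> borel Ed ;
  Pi : borel Ed -> probability O R ;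
  xi_translate : R -> O -> O ;
  xi_measurable : forall t, 0 <= t -> measurable_fun setT (xi t) ;
  Pi_measurable : forall t B, 0 <= t -> measurable B ->
    measurable_fun setT (fun x => Pi x (xi t @^-1` B)) ;
  xi_normal : forall x, Pi x (xi 0 @^-1` [set x]) = 1%E ;
  xi_cemetery : forall s t w, 0 <= s <= t -> xi s w = None -> xi t w = None ;
  xi_right_continuous : forall t w, 0 <= t ->
    (xi s w : Ed) @[s --> t^'+] --> (xi t w : Ed) ;
  xi_left_limits : forall t w, 0 < t ->
    exists l : Ed, (xi s w : Ed) @[s --> t^'-] --> l ;
  xi_translateE : forall s t w, 0 <= s -> 0 <= t ->
    xi s (xi_translate t w) = xi (s + t) w ;
  xi_strong_markov : forall x tau A s B, stopping_time xi tau ->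
    natfilt_right_at xi tau A -> 0 <= s -> measurable B ->
    let A' := A `&` [set w | (tau w < +oo)%E] in
    Pi x (A' `&` [set w | B (xi (fine (tau w) + s) w)]) =
    (\int[Pi x]_(w in A') Pi (xi (fine (tau w)) w) (xi s @^-1` B))%E ;
  xi_quasi_left_continuous : forall x (tau_ : nat -> O -> \bar R) tau,
    (forall n, stopping_time xi (tau_ n)) ->
    (forall n w, tau_ n w <= tau_ n.+1 w)%E ->
    (forall w, tau_ n w @[n --> \oo] --> tau w) ->
    \forall w \ae Pi x, (tau w < +oo)%E ->
      (xi (fine (tau_ n w)) w : Ed) @[n --> \oo] -->
      (xi (fine (tau w)) w : Ed)
}.

Variable X : hunt_process.
Implicit Types (f u : E -> R) (t : R) (x : E).

Definition semigroup_ereal t f x : \bar R :=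
  (\int[Pi X (Some x)]_w (ext0 f (xi X t w))%:E)%E.
Definition semigroup t f x : R := \int[Pi X (Some x)]_w ext0 f (xi X t w).

Definition occupation t (g : R -> E -> R) x : R :=
  \int[Pi X (Some x)]_w
    \int[lebesgue_measure]_(s in `[0, t]) ext0 (g s) (xi X s w).

Definition finely_continuous f := forall x, \forall w \ae Pi X (Some x),
  forall t, 0 <= t -> ext0 f (xi X s w) @[s --> t^'+] --> ext0 f (xi X t w).

Definition Cxib : set (E -> R) := [set f | Bb f /\ finely_continuous f].

(* [A] belongs to the completion of the sigma-algebra [F] by the null sets of
   the law with initial distribution [nu], for every [nu]. *)
Definition completion (F : set (set O)) : set (set O) :=
  [set A | forall nu : probability (borel Ed) R, exists B N,
    [/\ F B, natfilt_oo (xi X) N, (\int[nu]_x Pi X x N = 0)%E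
      & A `+` B `<=` N]].
End hunt.

Section densities.
Context (R : realType) (E : pmetricType R)
  (m : {measure set (borel E) -> \bar R}).

Definition transition_density (S : R -> (E -> R) -> E -> R)
    (q : R -> E -> E -> R) :=
  [/\ measurable_fun [set z : R * (borel E * borel E) | 0 < z.1]
        (fun z => q z.1 z.2.1 z.2.2),
      forall t x y, 0 < t -> 0 <= q t x y
    & forall t f x, 0 < t -> Bb f -> S t f x = \int[m]_y (q t x y * f y)].

Definition symmetric_process d (O : measurableType d)
    (X : hunt_process E O) :=
  forall t f g, 0 <= t -> Bplus f -> Bplus g ->
    (\int[m]_x (semigroup_ereal X t f x * (g x)%:E) =
     \int[m]_x ((f x)%:E * semigroup_ereal X t g x))%E.

Definition ip (f g : E -> R) : R := \int[m]_x (f x * g x).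
End densities.

(* Classes of L^2(E, m) are handled through their Borel representatives: the
   domain [F] is saturated for [m]-a.e. equality. *)
Section dirichlet.
Context (R : realType) (E : pmetricType R)
  (m : {measure set (borel E) -> \bar R}).
Variables (F : set (E -> R)) (Q : (E -> R) -> (E -> R) -> R).
Implicit Types (u v w : E -> R).

Definition L2 u := (u : borel E -> R) \in Lfun m 2%:E.

Definition form1 u : R := Q u u + ip m u u.

Record dirichlet_form : Prop := DirichletForm {
  df_L2 : forall u, F u -> L2 u ;
  df_dense : forall u e, L2 u -> 0 < e ->
    exists2 v, F v & ip m (u \- v) (u \- v) < e ;
  df_ae : forall u v, F u -> Borel_fun v ->
    (u : borel E -> R) = v %[ae m] ->
    F v /\ forall w, F w -> Q u w = Q v w ;
  df_0 : F (cst 0) ;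
  df_lin : forall (c : R) u v, F u -> F v -> F (fun x => c * u x + v x) ;
  df_bilin : forall (c : R) u v w, F u -> F v -> F w ->
    Q (fun x => c * u x + v x) w = c * Q u w + Q v w ;
  df_sym : forall u v, F u -> F v -> Q u v = Q v u ;
  df_ge0 : forall u, F u -> 0 <= Q u u ;
  df_closed : forall u_ : nat -> E -> R, (forall n, F (u_ n)) ->
    (forall e, 0 < e -> exists N, forall n k, (N <= n)%N -> (N <= k)%N ->
       form1 (u_ n \- u_ k) < e) ->
    exists2 u, F u & form1 (u_ n \- u) @[n --> \oo] --> (0 : R) ;
  df_markov : forall u, F u ->
    let u' := fun x => Num.min (Num.max (u x) 0) 1 in
    F u' /\ Q u' u' <= Q u u
}.

Record regular_form : Prop := RegularForm {
  reg_form : forall u e, F u -> 0 < e ->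
    exists2 g, (F `&` @Cc _ E) g & form1 (u \- g) < e ;
  reg_uniform : forall f e, Cc f -> 0 < e ->
    exists2 g, (F `&` @Cc _ E) g & forall x, `|f x - g x| < e
}.

(* (Q, F) is the Dirichlet form of the symmetric semigroup (P_t) on L^2(E, m):
   F is where (u - P_t u, u) / t stays bounded, Q is the limit as t -> 0+. *)
Definition associated_form d (O : measurableType d) (X : hunt_process E O) :=
  let approx t u v := t^-1 * ip m (fun x => u x - semigroup X t u x) v in
  (forall u, L2 u ->
    F u <-> exists C, forall t, 0 < t -> approx t u u <= C) /\
  (forall u v, F u -> F v -> approx t u v @[t --> 0^'+] --> Q u v).

Definition capacity_open (U : set E) : \bar R :=
  ereal_inf [set (form1 u)%:E | u in
    [set u | F u /\ \forall x \ae m, U x -> 1 <= u x]].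

Definition quasi_continuous u := forall e : R, 0 < e ->
  exists G : set E, [/\ open G, (capacity_open G < e%:E)%E
                      & {within ~` G, continuous u}].
End dirichlet.

Section kato.
Context (R : realType) (E : pmetricType R) (dO : measure_display)
  (O : measurableType dO) (X : hunt_process E O)
  (m : {measure set (borel E) -> \bar R}).

(* N is contained in a Borel set B that P_m-a.e. path never hits at positive
   times. *)
Definition exceptional (N : set E) := exists B : set (borel E),
  [/\ measurable B, N `<=` B &
      \forall x \ae m, \forall w \ae Pi X (Some x),
        forall t, 0 < t -> ~ (Some @` B) (xi X t w)].

(* Additive functional in the sense of Fukushima, Oshima and Takeda: [Lambda]
   is a defining set and [N] an exceptional set; values in [0, +oo], finite
   before the lifetime. *)
Record pcaf (A : R -> O -> \bar R) (Lambda : set O) (N : set E) : Prop := Pcaf {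
  pcaf_adapted : forall t B, 0 <= t -> measurable B ->
    completion X (natfilt (xi X) t) (A t @^-1` B) ;
  pcaf_Lambda : completion X (natfilt_oo (xi X)) Lambda ;
  pcaf_N : exceptional N ;
  pcaf_as : forall x, ~ N x -> \forall w \ae Pi X (Some x), Lambda w ;
  pcaf_shift : forall t w, 0 < t -> Lambda w -> Lambda (xi_translate X t w) ;
  pcaf_0 : forall w, Lambda w -> A 0 w = 0%E ;
  pcaf_ge0 : forall t w, Lambda w -> 0 <= t -> (0 <= A t w)%E ;
  pcaf_continuous : forall w, Lambda w ->
    {within `[0, +oo[, continuous (A ^~ w)} ;
  pcaf_finite : forall t w, Lambda w -> 0 <= t ->
    xi X t w <> None -> (A t w < +oo)%E ;
  pcaf_cemetery : forall s t w, Lambda w -> 0 <= s <= t ->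
    xi X s w = None -> A t w = A s w ;
  pcaf_additive : forall s t w, Lambda w -> 0 <= s -> 0 <= t ->
    A (t + s) w = (A s w + A t (xi_translate X s w))%E
}.

(* [dA w] is the Stieltjes measure of the path [A ^~ w] (which may reach +oo
   at the lifetime only, where the integrand vanishes). *)
Definition smooth_measure (mu : {measure set (borel E) -> \bar R}) :=
  exists A Lambda N, pcaf A Lambda N /\
  exists dA : O -> {measure set R -> \bar R},
    (forall w a b, Lambda w -> 0 <= a <= b -> (A b w < +oo)%E ->
       dA w [set` `]a, b]] = (A b w - A a w)%E) /\
    (forall f, Bplus f ->
       (t^-1%:E * \int[m]_x \int[Pi X (Some x)]_w
          \int[dA w]_(s in `]0%R, t]) (ext0 f (xi X s w))%:E)%E @[t --> 0^'+]
       --> (\int[mu]_x (f x)%:E)%E).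

Definition kato_class (p : R -> E -> E -> R)
    (mu : {measure set (borel E) -> \bar R}) :=
  smooth_measure mu /\
  ereal_sup [set (\int[lebesgue_measure]_(s in `]0%R, t])
                   \int[mu]_y (p s x y)%:E)%E | x in [set: E]]
    @[t --> 0^'+] --> 0%E.
End kato.

Section branching.
Context (R : realType) (E : pmetricType R).

Record branching := Branching {
  br_a : E -> R ;
  br_b : E -> R ;
  br_eta : R.-fker (borel E) ~> (borel E) ;
  br_H : R.-sigmafker (borel E) ~> (borel (fmeas E)) ;
  br_gamma : R.-fker (borel E) ~> (borel E) ;
  br_aP : Bb br_a ;
  br_bP : Bbplus br_b ;
  br_HP : (ereal_sup [set \int[br_H x]_(nu in @fmeas0 _ E)
      (Order.min (nu setT) (nu setT ^+ 2) + nu (~` [set x]))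
      | x in [set: E]] < +oo)%E ;
  br_gammaP : forall (x : borel E) B, measurable B ->
    (br_gamma x B =
     br_eta x B + \int[br_H x]_(nu in @fmeas0 _ E) nu (B `\ x))%E
}.

Variable k : branching.

Definition psi (f : E -> R) (x : E) : R :=
  br_a k x * f x + br_b k x * f x ^+ 2 - \int[br_eta k x]_y f y +
  \int[br_H k x]_(nu in @fmeas0 _ E)
    (expR (- \int[nu]_y f y) - 1 + fine (nu [set x]) * f x).

Definition gamma_int (f : E -> R) (x : E) : R := \int[br_gamma k x]_y f y.

Section mean_measure.
Variable m : {measure set (borel E) -> \bar R}.

Definition gamma_m (B : set (borel E)) : \bar R := (\int[m]_x br_gamma k x B)%E.

Let gamma_m0 : gamma_m set0 = 0%E.
Proof. by rewrite /gamma_m integral0_eq. Qed.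

Let gamma_m_ge0 B : (0 <= gamma_m B)%E.
Proof. exact: integral_ge0. Qed.

Let gamma_m_sigma_additive : semi_sigma_additive gamma_m.
Proof.
move=> B mB tB mUB; rewrite [X in _ --> X](_ : _ =
    (\int[m]_x \sum_(0 <= n <oo) br_gamma k x (B n))%E); last first.
  by apply: eq_integral => x _; rewrite measure_semi_bigcup.
rewrite integral_nneseries//; last by move=> n; exact: measurable_kernel.
by apply: is_cvg_ereal_nneg_natsum => n _; exact: integral_ge0.
Qed.

HB.instance Definition _ := isMeasure.Build _ _ _ gamma_m
  gamma_m0 gamma_m_ge0 gamma_m_sigma_additive.
End mean_measure.

Context (dO : measure_display) (O : measurableType dO) (X : hunt_process E O).

Definition psi_solution (f : E -> R) (v : R -> E -> R) :=
  [/\ jointly_Borel v, locally_bounded v,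
      forall t x, 0 <= t -> 0 <= v t x
    & forall t x, 0 <= t ->
        v t x = semigroup X t f x - occupation X t (fun s => psi (v (t - s))) x].

Definition mean_solution (f : E -> R) (v : R -> E -> R) :=
  [/\ jointly_Borel v, locally_bounded v
    & forall t x, 0 <= t ->
        v t x = semigroup X t f x
          - occupation X t (fun s y => br_a k y * v (t - s) y) x
          + occupation X t (fun s => gamma_int (v (t - s))) x].

Definition unique_solution (sol : (R -> E -> R) -> Prop) (v : R -> E -> R) :=
  sol v /\ forall v', sol v' -> forall t x, 0 <= t -> v' t x = v t x.

Definition cumulant_semigroup (V : R -> (E -> R) -> E -> R) :=
  forall f, Bbplus f -> unique_solution (psi_solution f) (fun t => V t f).

Definition mean_semigroup (M : R -> (E -> R) -> E -> R) :=
  forall f, Bb f -> unique_solution (mean_solution f) (fun t => M t f).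
End branching.

Section superprocess.
Context (R : realType) (E : pmetricType R).

(* Only the times [t >= 0] matter. *)
Record rpath := RPath {
  path_fun : R -> fmeas E ;
  path_right_continuous : forall t, 0 <= t ->
    path_fun s @[s --> t^'+] --> path_fun t ;
  path_trap : forall s t, 0 <= s <= t ->
    path_fun s setT = 0%E -> path_fun t setT = 0%E
}.

Definition zero_path : rpath.
Proof.
exists (fun=> point) => //.
by move=> t _; exact: cvg_cst.
Defined.

HB.instance Definition _ := gen_eqMixin rpath.
HB.instance Definition _ := gen_choiceMixin rpath.
HB.instance Definition _ := isPointed.Build rpath zero_path.

Definition coordinate (t : R) (w : rpath) : borel (fmeas E) := path_fun w t.

Definition path_space := g_sigma_algebraType
  [set A | exists r B, [/\ 0 <= r, measurable B & A = coordinate r @^-1` B]].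
HB.instance Definition _ := Measurable.on path_space.

Definition mass (f : E -> R) (t : R) (w : path_space) : R :=
  \int[path_fun w t]_x f x.

Record superprocess (V : R -> (E -> R) -> E -> R)
    (P : borel (fmeas E) -> probability path_space R) : Prop := Superprocess {
  sp_measurable : forall A, measurable A ->
    measurable_fun setT (fun mu => P mu A) ;
  sp_initial : forall mu : fmeas E, \forall w \ae P mu,
    forall B, measurable B -> path_fun w 0 B = mu B ;
  sp_markov : forall mu s t A B, 0 <= s -> 0 <= t ->
    sigma_of [set r | 0 <= r <= s] coordinate A -> measurable B ->
    P mu (A `&` coordinate (s + t) @^-1` B) =
    (\int[P mu]_(w in A) P (coordinate s w) (coordinate t @^-1` B))%E ;
  sp_laplace : forall (mu : fmeas E) t f, 0 <= t -> Bbplus f ->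
    \int[P mu]_w expR (- mass f t w) = expR (- \int[mu]_x V t f x)
}.

Definition Wh (lambda1 : R) (h : E -> R) (t : R) (w : path_space) : R :=
  expR (lambda1 * t) * mass h t w.

Definition Wh_infty (lambda1 : R) (h : E -> R) (w : path_space) : R :=
  lim (Wh lambda1 h t w @[t --> +oo]).
End superprocess.

Definition Lp_cvg (R : realType) d (T : measurableType d)
    (P : {measure set T -> \bar R}) (p : R) (Y : R -> T -> R) (Z : T -> R) :=
  [/\ forall t, 0 <= t -> Y t \in Lfun P p%:E,
      Z \in Lfun P p%:E
    & 'N[P]_(p%:E)[EFin \o (Y t \- Z)%R]%E @[t --> +oo] --> 0%E].

(* As gamma(x, dy) may charge [m]-null sets, this depends on the representative
   of [u], which is meant to be quasi-continuous. *)
Definition mean_form (R : realType) (E : pmetricType R)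
    (m : {measure set (borel E) -> \bar R}) (k : branching E)
    (Q : (E -> R) -> (E -> R) -> R) (u v : E -> R) : R :=
  Q u v + \int[m]_x (br_a k x * u x * v x)
  - \int[m]_x \int[br_gamma k x]_y (u y * v x).

(* Main.v *)
(* Write [M_t] for the mean semigroup and [V_t] for the cumulant semigroup, so
   that [E_nu <f, X_t> = <M_t f, nu>].  The ergodicity assumption on the density
   gives [e^{lambda1 t} M_t f -> (f, hh) h] uniformly relative to [h], and hence
   [M_t h = e^{-lambda1 t} h].

   Let [phi z = e^{-z} - 1 + z].  The centered mass [Z = <f, X_t> - <M_t f, nu>]
   satisfies [E_nu phi (th Z) = e^{<M_t (th f) - V_t (th f), nu>} - 1], and the
   gap [M_t - V_t] is driven by the nonlinear part of the branching mechanism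
   only.  A suitable combination [sum_j w_j phi (2^{-j} z)] is comparable to
   [|z|^r]; applying it to the jumps, where the moment assumption enters, and to
   [Z], with a scale [th] adapted to [<h, nu>], yields
   [E_nu |Z|^r <= C (1 + <h, nu>)] locally uniformly in time.

   By the Markov property, the [L^r] norm of
   [e^{lambda1 (t + s)} (<f, X_{t+s}> - <M_s f, X_t>)] decays exponentially in
   [t].  For [f = h] and [s = 1] this makes the martingale [W^h] converge in
   [L^r], and almost surely in continuous time thanks to Doob's inequality on
   dyadic times, right continuity of the paths and Borel-Cantelli.  In general
   one first chooses [s] so that [e^{lambda1 s} M_s f] is close to [(f, hh) h],
   which replaces [e^{lambda1 (t + s)} <M_s f, X_t>] by [(f, hh) W^h_t], and then
   lets [t] go to infinity. *)
From HB Require Import structures.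
Require Import Defs.
From mathcomp Require Import all_boot all_order all_algebra.
From mathcomp Require Import all_classical all_reals all_analysis.
From mathcomp Require Import measurable_realfun ess_sup_inf.
From mathcomp Require Import ring lra.
Set Implicit Arguments.
Unset Strict Implicit.
Unset Printing Implicit Defensive.
Import Order.TTheory GRing.Theory Num.Theory.
Import numFieldNormedType.Exports.
Local Open Scope classical_set_scope.
Local Open Scope ring_scope.

(** * Dyadic substitutes for power functions *)

Section phi.
Context {R : realType}.
Implicit Types u z x : R.

(** Only the Laplace functional of [X] is given, and for [r < 2] variances may be infinite, so
    moments are read off from exponential functionals. [phi] is the natural test function: on a
    centered variable its expectation involves nothing but the Laplace transform and the mean, it is
    nonnegative on the whole line, and on the half-line it lies below both z and z^2, hence below
    z^r. The obstacle is that the final estimate must be linear in [<h, nu>], whereas [a] and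
    [gamma] are controlled in sup norm, with no comparison to [h]. Gronwall's inequality for the gap
    M_t - V_t would give a bounded error instead of a multiple of [h]. Two facts repair this. For
    short times P_s h is at most a multiple of [h], so the source of one short step is proportional
    to [h]. And the sup norm enters only an error quadratic in the step length, which vanishes as
    the steps are refined, while [h] is carried along exactly as an eigenfunction. The scales enter
    through finite sums with constants independent of their number, so that monotone convergence
    removes the truncation. *)

Definition phi z : R := expR (- z) - 1 + z.

Lemma phi_ge0 z : 0 <= phi z.
Proof. by rewrite /phi; have := expR_ge1Dx (- z); lra. Qed.

Lemma phi0 : phi 0 = 0.
Proof. by rewrite /phi oppr0 expR0 subrr add0r. Qed.

Lemma phi_ub z : 0 <= z -> phi z <= Num.min z (z ^+ 2).
Proof.
move=> z0; rewrite /phi le_min; apply/andP; split.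
  have : expR (- z) <= 1 by rewrite expR_le1 oppr_le0.
  lra.
(* From [expR (- z) <= 1 / (1 + z)] follows [phi z <= z ^+ 2 / (1 + z)]. *)
have z1 : 0 < 1 + z by lra.
have : expR (- z) * (1 + z) <= 1.
  rewrite -[leRHS](expRxMexpNx_1 z) mulrC; apply: ler_wpM2r; first exact: expR_ge0.
  exact: expR_ge1Dx.
have := expR_ge0 (- z); nra.
Qed.

Lemma phi_le z : 0 <= z -> phi z <= z.
Proof. by move=> /phi_ub; rewrite le_min => /andP[]. Qed.

Lemma phi_le_sqr z : 0 <= z -> phi z <= z ^+ 2.
Proof. by move=> /phi_ub; rewrite le_min => /andP[]. Qed.

(** Halving the exponent makes a square: [phi u] is [expR (- u / 2) ^+ 2 - 1 + u], and
    [expR (- u / 2) >= 1 - u / 2] may be squared because [u <= 2] keeps the right side nonnegative.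
    Negative [u] are allowed, as the centered mass takes both signs. *)
Lemma phi_lb u : u <= 2 -> u ^+ 2 / 4 <= phi u.
Proof.
move=> u2; have h := expR_ge1Dx (- u / 2).
have -> : phi u = expR (- u / 2) ^+ 2 - 1 + u.
  by rewrite /phi -expRM_natl; congr (expR _ - _ + _); lra.
have : (1 - u / 2) ^+ 2 <= expR (- u / 2) ^+ 2.
  by rewrite ler_sqr ?nnegrE ?expR_ge0//; lra.
lra.
Qed.

(* The increment of [phi] from [x] to [x + d] is
   [d - expR (- x) * (1 - expR (- d))], and [1 - expR (- d) <= d]. *)
Lemma ler_phi x z : 0 <= x <= z -> phi x <= phi z.
Proof.
move=> /andP[x0 xz]; rewrite /phi.
have -> : expR (- z) = expR (- x) * expR (- (z - x)).
  by rewrite -expRD; congr expR; lra.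
have h1 : expR (- x) <= 1 by rewrite expR_le1; lra.
have h2 := expR_ge0 (- x).
have h3 := expR_ge1Dx (- (z - x)).
have h4 : expR (- (z - x)) <= 1 by rewrite expR_le1; lra.
nra.
Qed.

Lemma measurable_phi : measurable_fun setT phi.
Proof.
apply: measurable_funD => //; apply: measurable_funB => //.
by apply: measurableT_comp => //; exact: oppr_measurable.
Qed.
End phi.
Arguments measurable_phi {R}.

Section dyadic_weights.
Context {R : realType}.

Lemma geometric_sum_gt1 (a : R) n : 1 < a ->
  \sum_(j < n) a ^+ j <= a ^+ n / (a - 1).
Proof.
move=> a1; rewrite ler_pdivlMr ?subr_gt0//.
have := subrX1 a n; rewrite mulrC => <-.
by rewrite lerBlDr lerDl.
Qed.

Lemma geometric_sum_lt1 (b : R) m n : 0 < b < 1 ->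
  \sum_(m <= j < n) b ^+ j <= b ^+ m / (1 - b).
Proof.
move=> /andP[b0 b1]; have [nm|mn] := leqP n m.
  by rewrite big_geq// divr_ge0 ?exprn_ge0// ?ltW// subr_gt0.
rewrite ler_pdivlMr ?subr_gt0// mulrC.
have -> : (1 - b) * (\sum_(m <= j < n) b ^+ j) = b ^+ m - b ^+ n.
  elim: n mn => // n IH; rewrite ltnS leq_eqVlt => /predU1P[->|mn].
    by rewrite big_nat1 exprS; ring.
  by rewrite big_nat_recr ?(ltnW mn)//= mulrDr IH// exprS; ring.
by rewrite lerBlDr lerDl exprn_ge0// ltW.
Qed.

Definition dyad (j : nat) : R := (2 ^+ j)^-1.

Lemma dyad_gt0 j : 0 < dyad j.
Proof. by rewrite invr_gt0 exprn_gt0. Qed.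

Lemma dyad_le1 j : dyad j <= 1.
Proof. by rewrite invf_le1 ?exprn_gt0// exprn_ege1// ler1n. Qed.

Lemma dyadic_floor (y : R) : 1 <= y -> exists j : nat, 2 ^+ j <= y < 2 ^+ j.+1.
Proof.
move=> y1.
have ex : exists n : nat, y < 2 ^+ n.
  exists (Num.truncn y).+1; apply: (lt_le_trans (truncnS_gt y)).
  by rewrite -natrX ler_nat ltnW// ltn_expl.
case: (ex_minnP ex) => -[|j] h hm; first by rewrite expr0 ltNge y1 in h.
exists j; rewrite h andbT leNgt; apply/negP => /hm.
by rewrite ltnn.
Qed.

Lemma dyadic_bound (y : R) : exists N : nat, `|y| <= 2 ^+ N.
Proof.
have [y1|/ltW y1] := leP 1 `|y|.
  by have [j /andP[_ /ltW]] := dyadic_floor y1; exists j.+1.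
by exists 0%N; rewrite expr0.
Qed.

Lemma powR_dyad (p : R) j : (2 ^+ j) `^ p = (2 `^ p) ^+ j.
Proof.
by rewrite -(powR_mulrn j (ler0n _ 2)) -powRrM mulrC powRrM powR_mulrn ?powR_ge0.
Qed.

(* A discrete stand-in for [z `^ p = c * \int (phi (t * z)) * t `^ (-1 - p) dt]
   when [p < 2]; for [p = 2] that integral diverges and a single scale is used. *)
Lemma dyadic_weights (p : R) : 1 < p <= 2 ->
  exists C : R, 0 < C /\ forall N : nat, exists w : nat -> R,
  [/\ forall j, w j = 0 \/ 1 <= w j,
      forall z, 0 <= z ->
        \sum_(0 <= j < N.+1) w j * phi (dyad j * z) <= C * z `^ p
    & forall y, `|y| <= 2 ^+ N ->
        `|y| `^ p <= C * (1 + \sum_(0 <= j < N.+1) w j * phi (dyad j * y))].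
Proof.
move=> /andP[p1]; rewrite le_eqVlt => /predU1P[->|p2].
  (* For [p = 2] all the weight sits at the smallest factor [dyad N]. On [|y| <= 2 ^+ N] the
     argument is at most 1, where [phi] is at least a quarter of the square, and [4 ^+ N] undoes the
     scaling. *)
  exists 4; split=> // N; exists (fun j => if j == N then 4 ^+ N else 0); split.
  - by move=> j; case: ifP => _; [right|left] => //; rewrite exprn_ege1// ler1n.
  - move=> z z0; rewrite big_nat_recr//= eqxx big1_seq ?add0r; last first.
      move=> j /andP[_]; rewrite mem_index_iota => /andP[_ jN].
      by rewrite ltn_eqF ?mul0r.
    rewrite powR_mulrn//.
    have d0 := dyad_gt0 N.
    have : phi (dyad N * z) <= (dyad N * z) ^+ 2.
      by rewrite phi_le_sqr// mulr_ge0// ltW.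
    have e4 : (4 ^+ N) * (dyad N * z) ^+ 2 = z ^+ 2.
      rewrite exprMn mulrA /dyad exprVn -exprM mulnC exprM.
      have -> : (2 : R) ^+ 2 = 4 by rewrite expr2; lra.
      by rewrite divff ?mul1r// expf_neq0.
    have p4 : 0 < (4 : R) ^+ N by rewrite exprn_gt0.
    have z2 : 0 <= z ^+ 2 by rewrite sqr_ge0.
    by move=> /(ler_wpM2l (ltW p4)); rewrite e4; lra.
  - move=> y yN; rewrite big_nat_recr//= eqxx big1_seq ?add0r; last first.
      move=> j /andP[_]; rewrite mem_index_iota => /andP[_ jN].
      by rewrite ltn_eqF ?mul0r.
    rewrite powR_mulrn// real_normK ?num_real//.
    have d0 := dyad_gt0 N.
    have e4 : (4 ^+ N) * (dyad N * y) ^+ 2 = y ^+ 2.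
      rewrite exprMn mulrA /dyad exprVn -exprM mulnC exprM.
      have -> : (2 : R) ^+ 2 = 4 by rewrite expr2; lra.
      by rewrite divff ?mul1r// expf_neq0.
    have p4 : 0 < (4 : R) ^+ N by rewrite exprn_gt0.
    have : (dyad N * y) ^+ 2 / 4 <= phi (dyad N * y).
      apply: phi_lb; apply: (le_trans (ler_norm _)).
      rewrite normrM gtr0_norm// mulrC /dyad ler_pdivrMr ?exprn_gt0//.
      by apply: (le_trans yN); rewrite ler_peMl ?exprn_ge0// ler1n.
    by move=> /(ler_wpM2l (ltW p4)); rewrite mulrA e4; lra.
set W := (2 : R) `^ p.
have pow2_gt1 (e : R) : 0 < e -> 1 < (2 : R) `^ e.
  by move=> e0; rewrite -[ltLHS](congr1 (fun g => g e) (powR1 R)) gt0_ltr_powR ?nnegrE ?ler0n// ltr1n.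
have W0 : 0 < W by rewrite powR_gt0.
have W2 : 2 < W.
  have -> : W = 2 * 2 `^ (p - 1) by rewrite mulr_powRB1//; lra.
  by rewrite -[ltLHS]mulr1 ltr_pM2l// pow2_gt1//; lra.
have W4 : W < 4.
  have -> : (4 : R) = W * 2 `^ (2 - p).
    rewrite /W -powRD ?pnatr_eq0 ?implybT//.
    have -> : p + (2 - p) = 2%:R by lra.
    by rewrite powR_mulrn ?ler0n// expr2; lra.
  by rewrite -[ltLHS]mulr1 ltr_pM2l// pow2_gt1//; lra.
(* With weights [W ^+ j], the bound [phi u <= u] gives terms of ratio [a] and [phi u <= u ^+ 2]
   terms of ratio [b]; [1 < p < 2] is exactly [b < 1 < a], so each geometric sum is dominated by one
   end. *)
pose a := W / 2; pose b := W / 4.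
have a1 : 1 < a by rewrite /a; lra.
have b01 : 0 < b < 1 by rewrite /b; lra.
have wa j : W ^+ j * dyad j = a ^+ j by rewrite /a exprMn /dyad exprVn.
have wb j : W ^+ j * dyad j ^+ 2 = b ^+ j.
  rewrite /b exprMn /dyad !exprVn -exprM mulnC exprM.
  by congr (_ * (_ ^+ _)^-1); rewrite expr2; lra.
have Wj (j : nat) : 1 <= W ^+ j by rewrite exprn_ege1//; lra.
pose C1 := W / (a - 1) + W / (1 - b) + (1 - b)^-1.
have i1 : 0 < W / (a - 1) by rewrite divr_gt0//; lra.
have i2 : 0 < W / (1 - b) by rewrite divr_gt0//; lra.
have i3 : 0 < (1 - b)^-1 by rewrite invr_gt0; lra.
exists (C1 + 4 * W); split; first by rewrite /C1; lra.
move=> N; exists (fun j => W ^+ j); split.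
- by move=> j; right.
- move=> z z0; have [->|zN0] := eqVneq z 0.
    rewrite big1 => [|j _]; last by rewrite mulr0 phi0 mulr0.
    by rewrite mulr_ge0 ?powR_ge0// /C1; lra.
  have zp : 0 < z by rewrite lt_neqAle eq_sym zN0.
  have ta j : W ^+ j * phi (dyad j * z) <= a ^+ j * z.
    rewrite -wa -mulrA ler_wpM2l ?exprn_ge0 ?phi_le//; first by lra.
    by rewrite mulr_ge0// ltW// dyad_gt0.
  have tb j : W ^+ j * phi (dyad j * z) <= b ^+ j * z ^+ 2.
    rewrite -wb -mulrA -exprMn ler_wpM2l ?exprn_ge0 ?phi_le_sqr//; first by lra.
    by rewrite mulr_ge0// ltW// dyad_gt0.
  have zpp : 0 < z `^ p by rewrite powR_gt0.
  have [z1|/ltW z1] := leP z 1.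
    apply: (@le_trans _ _ (\sum_(0 <= j < N.+1) b ^+ j * z ^+ 2)).
      by apply: ler_sum => j _; exact: tb.
    rewrite -mulr_suml.
    have := @geometric_sum_lt1 b 0 N.+1 b01; rewrite expr0 div1r => hs.
    have hz : z ^+ 2 <= z `^ p.
      by rewrite -powR_mulrn// ger_powR ?zp ?z1// ltW.
    apply: (@le_trans _ _ ((1 - b)^-1 * z `^ p)).
      apply: ler_pM => //; first by apply: sumr_ge0 => j _; rewrite exprn_ge0//; lra.
      exact: sqr_ge0.
    by rewrite ler_wpM2r ?(ltW zpp)// /C1; lra.
  (* The sum is cut at the scale of [z]: the linear bound up to [k], the quadratic one beyond. Both
     pieces are of the order of the term at the cut, and [W ^+ k] is at most z^p. *)
  have [k /andP[k1 /ltW k2]] := dyadic_floor z1.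
  have Wk : W ^+ k <= z `^ p.
    by rewrite /W -powR_dyad ge0_ler_powR ?nnegrE ?exprn_ge0//; lra.
  have sa n : (n <= k.+1)%N -> \sum_(0 <= j < n) W ^+ j * phi (dyad j * z) <=
      W / (a - 1) * z `^ p.
    move=> nk; apply: (@le_trans _ _ (a ^+ k.+1 / (a - 1) * z)).
      apply: (@le_trans _ _ (\sum_(0 <= j < n) a ^+ j * z)).
        by apply: ler_sum => j _; exact: ta.
      rewrite -mulr_suml ler_wpM2r// big_mkord.
      apply: (le_trans (geometric_sum_gt1 _ a1)).
      by rewrite ler_wpM2r ?invr_ge0 ?subr_ge0 ?(ltW a1)// ler_eXn2l.
    rewrite mulrAC [leRHS]mulrAC ler_wpM2r ?invr_ge0 ?subr_ge0 ?(ltW a1)//.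
    have -> : a ^+ k.+1 * z = W * (W ^+ k * (z / 2 ^+ k.+1)).
      rewrite /a exprMn exprVn exprS; ring.
    rewrite ler_wpM2l//; first by lra.
    apply: le_trans Wk; rewrite ler_piMr//; first by have := Wj k; lra.
    by rewrite ler_pdivrMr ?exprn_gt0// mul1r.
  have sb n : \sum_(k.+1 <= j < n) W ^+ j * phi (dyad j * z) <=
      W / (1 - b) * z `^ p.
    apply: (@le_trans _ _ (b ^+ k.+1 / (1 - b) * z ^+ 2)).
      apply: (@le_trans _ _ (\sum_(k.+1 <= j < n) b ^+ j * z ^+ 2)).
        by apply: ler_sum => j _; exact: tb.
      by rewrite -mulr_suml ler_wpM2r ?sqr_ge0// geometric_sum_lt1.
    rewrite mulrAC [leRHS]mulrAC ler_wpM2r//; first by apply/ltW.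
    rewrite -wb exprS -!mulrA ler_wpM2l//; first by lra.
    apply: le_trans Wk; rewrite ler_piMr//; first by have := Wj k; lra.
    rewrite mulrA -expr2 -exprMn exprn_ile1//; first by rewrite mulr_ge0// ltW// dyad_gt0.
    by rewrite mulrC /dyad ler_pdivrMr ?exprn_gt0// mul1r.
  apply: (@le_trans _ _ ((W / (a - 1) + W / (1 - b)) * z `^ p)); last first.
    by rewrite ler_wpM2r ?(ltW zpp)// /C1; lra.
  have q0 : 0 <= W / (1 - b) * z `^ p by rewrite mulr_ge0 ?ltW.
  rewrite mulrDl; have [Nk|kN] := leqP N.+1 k.+1.
    by have := sa _ Nk; lra.
  rewrite (@big_cat_nat _ _ _ k.+1)//=; last by rewrite ltnW.
  by apply: lerD; [exact: sa|exact: sb].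
- move=> y yN.
  have S0 : 0 <= \sum_(0 <= j < N.+1) W ^+ j * phi (dyad j * y).
    apply: sumr_ge0 => j _; rewrite mulr_ge0 ?phi_ge0//.
    by have := Wj j; lra.
  have C10 : 0 < C1 by rewrite /C1; lra.
  have [y1|/ltW y1] := leP `|y| 1.
    have : `|y| `^ p <= 1 `^ p.
      by rewrite ge0_ler_powR ?nnegrE//; lra.
    rewrite powR1; nra.
  (* One term suffices: at the scale of [y] the argument has modulus in [1, 2), where [phi] is at
     least 1/4 whatever the sign. *)
  have [j /andP[j1 j2]] := dyadic_floor y1.
  have jN : (j < N.+1)%N.
    by rewrite ltnS -(@ler_eXn2l R 2) ?ltr1n// (le_trans j1).
  have hj : W ^+ j / 4 <= \sum_(0 <= i < N.+1) W ^+ i * phi (dyad i * y).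
    rewrite (bigD1_seq j) ?mem_index_iota ?iota_uniq//=.
    apply: (@le_trans _ _ (W ^+ j * phi (dyad j * y))); last first.
      rewrite lerDl; apply: sumr_ge0 => i _; rewrite mulr_ge0 ?phi_ge0//.
      by have := Wj i; lra.
    rewrite ler_wpM2l ?exprn_ge0//; first by lra.
    have d0 := dyad_gt0 j.
    have e : `|dyad j * y| = `|y| / 2 ^+ j.
      by rewrite normrM gtr0_norm// mulrC.
    apply: (@le_trans _ _ ((dyad j * y) ^+ 2 / 4)); last first.
      apply: phi_lb; apply: (le_trans (ler_norm _)); rewrite e.
      by rewrite ler_pdivrMr ?exprn_gt0// -exprS ltW.
    rewrite -[leLHS]mul1r ler_wpM2r// -real_normK ?num_real// e.
    by rewrite exprn_ege1// ler_pdivlMr ?exprn_gt0// mul1r.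
  have : `|y| `^ p <= W ^+ j.+1.
    by rewrite /W -powR_dyad ge0_ler_powR ?nnegrE ?exprn_ge0//; [lra|exact: ltW].
  rewrite exprS; have := Wj j; nra.
Qed.
End dyadic_weights.

(** * Measure-theoretic preliminaries *)

Section mixture.
Context d d' (Y : measurableType d) (Z : measurableType d') (R : realType).
Import HBNNSimple.
Local Open Scope ereal_scope.

(** The usual passage from sets to simple functions to monotone limits. It turns identities assumed
    for sets only, such as the definition of [gamma] or the Markov property, into identities for
    integrals. *)
Lemma integral_mixture (m0 m1 : {measure set Z -> \bar R})
    (H : {measure set Y -> \bar R}) (D : set Y)
    (kap : Y -> {measure set Z -> \bar R}) (f : Z -> \bar R) :
  measurable D ->
  (forall U, measurable U -> measurable_fun setT (kap ^~ U)) ->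
  (forall U, measurable U -> m1 U = m0 U + \int[H]_(y in D) kap y U) ->
  (forall z, 0 <= f z) -> measurable_fun setT f ->
  \int[m1]_z f z = \int[m0]_z f z + \int[H]_(y in D) \int[kap y]_z f z.
Proof.
move=> mD mk hyp f0 mf.
have mI (g : Z -> \bar R) : (forall z, 0 <= g z) -> measurable_fun setT g ->
    measurable_fun setT (fun y => \int[kap y]_z g z).
  by move=> g0 mg; exact: measurable_fun_integral_kernel.
have step (g : {nnsfun Z >-> R}) :
    \int[m1]_z (g z)%:E = \int[m0]_z (g z)%:E +
                          \int[H]_(y in D) \int[kap y]_z (g z)%:E.
  have mp r : measurable (g @^-1` [set r]) by exact: measurable_sfunP.
  have ge0 r (mu : {measure set Z -> \bar R}) : 0 <= r%:E * mu (g @^-1` [set r]).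
    have [r0|r0] := leP 0%R r; first by rewrite mule_ge0.
    by rewrite preimage_nnfun0// measure0 mule0.
  rewrite !integralT_nnsfun !sintegralE.
  under [X in _ = _ + X]eq_integral do rewrite integralT_nnsfun sintegralE.
  rewrite ge0_integral_fsum//; last first.
    by move=> r; apply: measurable_funeM; exact: measurable_funTS (mk _ _).
  rewrite -fsbig_split//=.
  apply: eq_fsbigr => r _; rewrite hyp//.
  have [r0|r0] := leP 0%R r.
    rewrite ge0_integralZl//; last exact: measurable_funTS (mk _ _).
    by rewrite ge0_muleDr// integral_ge0.
  rewrite preimage_nnfun0// measure0.
  by rewrite [X in _ = _ + X]integral0_eq ?integral0_eq ?adde0//=;
    move=> y _; rewrite measure0 ?mule0.
pose f_ := nnsfun_approx measurableT mf.
have fE (mu : {measure set Z -> \bar R}) :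
    \int[mu]_z (f_ n z)%:E @[n --> \oo] --> \int[mu]_z f z.
  have -> : \int[mu]_z f z = \int[mu]_z (lim ((f_ n z)%:E @[n --> \oo])).
    by apply/eq_integral => z _; apply/esym/cvg_lim => //=; exact: cvg_nnsfun_approx.
  apply: cvg_monotone_convergence => //.
  - by move=> n; exact/measurable_EFinP.
  - by move=> n z _; rewrite lee_fin.
  - by move=> z _ a b ab; rewrite lee_fin; exact/lefP/nd_nnsfun_approx.
have nd (mu : {measure set Z -> \bar R}) a b : (a <= b)%N ->
    \int[mu]_z (f_ a z)%:E <= \int[mu]_z (f_ b z)%:E.
  move=> ab; apply: ge0_le_integral => //.
  - by move=> z _; rewrite lee_fin.
  - exact/measurable_EFinP.
  - exact/measurable_EFinP.
  - by move=> z _; rewrite lee_fin; exact/lefP/nd_nnsfun_approx.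
have mf_ n : measurable_fun setT (fun y => \int[kap y]_z (f_ n z)%:E).
  by apply: mI; [move=> z; rewrite lee_fin|exact/measurable_EFinP].
have := fE m1; under eq_fun do rewrite step.
move=> /(@cvg_lim _ _) <-//; apply/cvg_lim => //; apply: cvgeD.
- by apply: ge0_adde_def; rewrite inE ?integral_ge0// => y _; exact: integral_ge0.
- exact: fE.
- have -> : \int[H]_(y in D) \int[kap y]_z f z =
      \int[H]_(y in D) (lim (\int[kap y]_z (f_ n z)%:E @[n --> \oo])).
    by apply: eq_integral => y _; apply/esym/cvg_lim => //; exact: fE.
  apply: cvg_monotone_convergence => //.
  - by move=> n; exact: measurable_funTS.
  - by move=> n y _; apply: integral_ge0 => z _; rewrite lee_fin.
  - by move=> y _ a b ab; exact: nd.
Qed.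

Lemma integral_mixture0 (m1 : {measure set Z -> \bar R})
    (H : {measure set Y -> \bar R}) (D : set Y)
    (kap : Y -> {measure set Z -> \bar R}) (f : Z -> \bar R) :
  measurable D ->
  (forall U, measurable U -> measurable_fun setT (kap ^~ U)) ->
  (forall U, measurable U -> m1 U = \int[H]_(y in D) kap y U) ->
  (forall z, 0 <= f z) -> measurable_fun setT f ->
  \int[m1]_z f z = \int[H]_(y in D) \int[kap y]_z f z.
Proof.
move=> mD mk hyp f0 mf.
rewrite (@integral_mixture mzero m1 H D kap f)//.
  by rewrite integral_measure_zero add0e.
by move=> U mU; rewrite hyp// /mzero/= add0e.
Qed.

End mixture.

Section integral_mrestr.
Context d (Y : measurableType d) (R : realType).
Local Open Scope ereal_scope.

(** The restriction to [D] is the mixture over [D] of the Dirac masses. *)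
Lemma ge0_integral_mrestr (mu : {measure set Y -> \bar R}) (D : set Y)
    (mD : measurable D) (f : Y -> \bar R) :
  (forall z, 0 <= f z) -> measurable_fun setT f ->
  \int[mrestr mu mD]_y f y = \int[mu]_(y in D) f y.
Proof.
move=> f0 mf.
rewrite (@integral_mixture0 _ _ _ _ _ _ mu D (fun y => \d_ y))//.
- by apply: eq_integral => y _; rewrite integral_dirac// diracT mul1e.
- move=> U mU; rewrite (_ : (fun y => _) = EFin \o \1_U)//.
  exact/measurable_EFinP.
- move=> U mU; rewrite /mrestr/= (_ : (fun y => _) = EFin \o \1_U)//.
  by rewrite integral_indic.
Qed.

End integral_mrestr.

Section measurable_parametric_integral.
Context d d' (X : measurableType d) (Y : measurableType d') (R : realType).
Variables (k : X -> {measure set Y -> \bar R}) (D : set Y).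
Import HBNNSimple.
Hypothesis mk : forall U, measurable U -> measurable_fun setT (k ^~ U).
Hypothesis mD : measurable D.
Hypothesis kD : forall x, (k x D < +oo)%E.

Let kk := k.
HB.instance Definition _ := isKernel.Build _ _ X Y R kk mk.

(** Finiteness is asked on [D] only, and for each [x] separately: [k x] itself may be infinite, as
    the jump kernel can be, and is replaced by its restriction to [D]. *)
Lemma measurable_fun_integral_in (F : X * Y -> \bar R) :
  (forall z, 0 <= F z)%E -> measurable_fun setT F ->
  measurable_fun setT (fun x => \int[k x]_(y in D) F (x, y))%E.
Proof.
move=> F0 mF.
pose l x : {measure set Y -> \bar R} := mrestr (kk x) mD.
rewrite (_ : (fun x => _) = (fun x => \int[l x]_y F (x, y))%E); last first.
  by apply/funext => x; rewrite /l ge0_integral_mrestr//; exact: measurableT_comp.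
pose k_ := nnsfun_approx measurableT mF.
apply: (@measurable_fun_xsection_integral _ _ X Y R F l k_).
- by move=> a b ab; exact/nd_nnsfun_approx.
- by move=> z; exact/cvg_nnsfun_approx.
- move=> n r.
  have ub x : exists M : R, forall U, measurable U -> (mrestr (kk x) mD U < M%:E)%E.
    exists (fine (kk x D) + 1)%R => U mU; rewrite /mrestr.
    apply: (@le_lt_trans _ _ (kk x D)).
      by apply: le_measure; rewrite ?inE//; exact: measurableI.
    have kf : kk x D \is a fin_num by rewrite ge0_fin_numE//; exact: kD.
    by rewrite -[ltLHS](fineK kf) lte_fin ltrDl.
  by have [] := measurable_prod_subset_xsection_kernel ub (measurable_sfunP (k_ n) (measurable_set1 r)).
Qed.

End measurable_parametric_integral.

Section bounded_integrals.
Context d (T : measurableType d) (R : realType) (mu : {measure set T -> \bar R}).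
Variable (D : set T).
Hypotheses (mD : measurable D) (fD : (mu D < +oo)%E).
Implicit Types (f g : T -> R).

Lemma bdd_integrable f C : measurable_fun D f ->
  (forall x, D x -> `|f x| <= C) -> mu.-integrable D (EFin \o f).
Proof.
move=> mf fC; apply: measurable_bounded_integrable => //.
exists C; split; first exact: num_real.
by move=> M CM x Dx /=; apply: (le_trans (fC _ Dx)); exact: ltW.
Qed.

Lemma normr_Rintegral_le f C : measurable_fun D f ->
  (forall x, D x -> `|f x| <= C) ->
  `|\int[mu]_(x in D) f x| <= C * fine (mu D).
Proof.
move=> mf fC; have fi := bdd_integrable mf fC.
apply: (le_trans (le_normr_Rintegral mD fi)).
rewrite -Rintegral_cst//; apply: le_Rintegral => //.
- exact: integrable_norm.
- by apply: (@bdd_integrable (cst C) `|C|) => //; exact: measurable_cst.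
Qed.

Lemma EFin_Rintegral f : mu.-integrable D (EFin \o f) ->
  (\int[mu]_(x in D) f x)%:E = (\int[mu]_(x in D) (f x)%:E)%E.
Proof. by move=> fi; rewrite fineK//; exact: integrable_fin_num. Qed.

Lemma Rintegral_dominated_cvg (f_ : nat -> T -> R) f g :
  (forall n, measurable_fun D (f_ n)) ->
  (forall x, D x -> f_ n x @[n --> \oo] --> f x) ->
  mu.-integrable D (EFin \o g) ->
  (forall n x, D x -> `|f_ n x| <= g x) ->
  \int[mu]_(x in D) f_ n x @[n --> \oo] --> \int[mu]_(x in D) f x.
Proof.
move=> mf_ f_f ig fg.
have mf : measurable_fun D f by exact: measurable_fun_cvg f_f.
have fi : mu.-integrable D (EFin \o f).
  apply: le_integrable ig => //; first exact/measurable_EFinP.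
  move=> x Dx /=; rewrite lee_fin; apply: le_trans (ler_norm _).
  have h1 : `|f_ n x| @[n --> \oo] --> `|f x| by exact: cvg_norm (f_f x Dx).
  rewrite -(cvg_lim _ h1)//; apply: limr_le; first by apply/cvg_ex; eexists; exact: h1.
  by apply: nearW => n; exact: fg.
apply: (@fine_cvg _ _ _ _ (fun n => \int[mu]_(x in D) (f_ n x)%:E)%E).
rewrite EFin_Rintegral//.
apply: (@dominated_cvg _ _ _ mu D mD _ _ (EFin \o g)) => //.
- by move=> n; exact/measurable_EFinP.
- by move=> x Dx; apply: cvg_EFin; [exact: nearW|exact: f_f].
Qed.

Lemma Rintegral_bounded_cvg (f_ : nat -> T -> R) f C :
  (forall n, measurable_fun D (f_ n)) ->
  (forall x, D x -> f_ n x @[n --> \oo] --> f x) ->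
  (forall n x, D x -> `|f_ n x| <= C) ->
  \int[mu]_(x in D) f_ n x @[n --> \oo] --> \int[mu]_(x in D) f x.
Proof.
move=> mf_ f_f fC; apply: (@Rintegral_dominated_cvg _ _ (cst C)) => //.
by apply: (@bdd_integrable (cst C) `|C|) => //; exact: measurable_cst.
Qed.

End bounded_integrals.

Section borel_functions.
Context (R : realType).

Lemma borel_continuous_measurable (T : ptopologicalType) (f : T -> R) :
  continuous f -> measurable_fun setT (f : borel T -> R).
Proof.
move=> /continuousP cf; apply: (measurability _ (RGenOpens.measurableE R)).
move=> _ [_ [a [b ->] <-]]; rewrite setTI; apply: sub_sigma_algebra.
exact/cf/interval_open.
Qed.

Context (E : pmetricType R).

Lemma lipschitz_continuous (g : E -> R) :
  (forall x y, `|g x - g y| <= mdist x y) -> continuous g.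
Proof.
move=> lip x; apply/cvgrPdist_lt => e e0; near=> y.
apply: (le_lt_trans (lip x y)); near: y.
by apply/nbhs_ballP; exists e => //= y; rewrite ballEmdist.
Unshelve. all: by end_near. Qed.

(** [g] is the distance to the complement of [U], capped at 1; [U = setT] is set apart because the
    infimum would run over the empty set. *)
Lemma open_bump (U : set E) : open U -> exists g : E -> R,
  [/\ continuous g, forall x, 0 <= g x <= 1 & forall x, U x <-> 0 < g x].
Proof.
move=> oU; have [->|/eqP] := eqVneq U setT.
  by exists (cst 1); split => //= x; [exact: cst_continuous|lra].
rewrite -subTset => /existsNP[z0 /not_implyP[_ Uz0]].
pose S x := [set mdist x y | y in ~` U].
pose d x := inf (S x).
have S0 x : S x !=set0 by exists (mdist x z0), z0.
have lb x : has_lbound (S x) by exists 0 => _ [y _ <-]; exact: mdist_ge0.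
have d0 x : 0 <= d x by apply: lb_le_inf => // _ [y _ <-]; exact: mdist_ge0.
have dl x y : d x <= mdist x y + d y.
  rewrite -lerBlDl; apply: lb_le_inf => // _ [z Uz <-].
  rewrite lerBlDl; apply: (le_trans _ (metric_triangle x y z)).
  by apply: ge_inf => //; exists z.
exists (fun x => Num.min 1 (d x)); split.
- apply: lipschitz_continuous => x y.
  have h1 := dl x y; have := dl y x; rewrite metric_sym => h2.
  rewrite ler_norml /Num.min; do 2 case: ifPn; rewrite -?leNgt => *; lra.
- by move=> x; rewrite le_min ler01 d0 ge_min lexx.
- move=> x; split.
    rewrite openE in oU => /oU /nbhs_ballP[e /= e0 eU].
    rewrite lt_min ltr01 (lt_le_trans e0)//; apply: lb_le_inf => // _ [y Uy <-].
    rewrite leNgt; apply/negP => xy; apply: Uy; apply: eU.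
    by rewrite ballEmdist.
  rewrite lt_min => /andP[_ dx]; apply: contrapT => Ux.
  have : d x <= mdist x x by apply: ge_inf => //; exists x.
  by rewrite mdistxx leNgt dx.
Qed.

Lemma Bbplus_ge0 (f : E -> R) x : Bbplus f -> 0 <= f x.
Proof. by case=> _ [_ /(_ x)]. Qed.

Lemma BbP (f : E -> R) : Bb f -> exists2 C, 0 <= C & forall x, `|f x| <= C.
Proof.
case=> _ [M [Mr fM]]; exists (`|M| + 1); first by rewrite addr_ge0.
by move=> x; apply: fM => //; rewrite (le_lt_trans (ler_norm _))// ltrDl.
Qed.

Lemma bounded_funP (T : Type) (f : T -> R) C : (forall x, `|f x| <= C) -> bounded_fun f.
Proof.
move=> fC; exists C; split; first exact: num_real.
by move=> M CM x _; apply: (le_trans (fC x)); exact: ltW.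
Qed.

Lemma BbI (f : E -> R) C : Borel_fun f -> (forall x, `|f x| <= C) -> Bb f.
Proof. by move=> mf fC; split => //; exact: bounded_funP fC. Qed.

Lemma BbplusP (f : E -> R) : Bbplus f -> exists2 C, 0 <= C & forall x, 0 <= f x <= C.
Proof.
move=> bf; have [C C0 fC] := BbP bf.1; exists C => // x.
by rewrite Bbplus_ge0//= (le_trans (ler_norm _)).
Qed.

Lemma BbplusI (f : E -> R) C : Borel_fun f -> (forall x, 0 <= f x <= C) -> Bbplus f.
Proof.
move=> mf fC; split; last by split=> // x; case/andP: (fC x).
by apply: (@BbI _ C) => // x; case/andP: (fC x) => f0 ?; rewrite ger0_norm.
Qed.

Lemma BbplusM (c : R) (f : E -> R) : 0 <= c -> Bbplus f -> Bbplus (fun x => c * f x).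
Proof.
move=> c0 bf; have [C C0 fC] := BbplusP bf; apply: (@BbplusI _ (c * C)).
  by apply: measurable_funM => //; exact: bf.1.1.
by move=> x; case/andP: (fC x) => f0 fC'; rewrite mulr_ge0//= ler_wpM2l.
Qed.

Lemma BbplusD (f g : E -> R) : Bbplus f -> Bbplus g -> Bbplus (fun x => f x + g x).
Proof.
move=> bf bg; have [C C0 fC] := BbplusP bf; have [D D0 gD] := BbplusP bg.
apply: (@BbplusI _ (C + D)).
  by apply: measurable_funD => //; [exact: bf.1.1|exact: bg.1.1].
by move=> x; have := fC x; have := gD x; lra.
Qed.

Lemma Bbplus_cst (c : R) : 0 <= c -> Bbplus (cst c : E -> R).
Proof. by move=> c0; apply: (@BbplusI _ c) => [|x]; [exact: measurable_cst|rewrite c0 lexx]. Qed.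

Lemma measurable_borel_set1 (x : E) : measurable ([set x] : set (borel E)).
Proof.
rewrite -[X in measurable X]setCK; apply: measurableC; apply: sub_sigma_algebra.
by apply: closed_openC; exact/accessible_closed_set1/hausdorff_accessible/metric_hausdorff.
Qed.

End borel_functions.

(** * Measurable functionals of a finite measure *)

Section fmeas_measurability.
Context (R : realType) (E : pmetricType R).
Implicit Types (nu : fmeas E).

Lemma fmeas_fin nu (B : set (borel E)) : measurable B -> (nu B < +oo)%E.
Proof. by move=> mB; rewrite ltey_eq fin_num_measure. Qed.

Lemma pairing_continuous (f : Cb E) : continuous (fun nu : fmeas E => pairing nu f).
Proof.
move=> nu; apply: (@continuous_comp (fmeas E) {ptws Cb E -> R} R (@pairing R E) (fun g => g f)).
  exact: (@initial_continuous _ _ (@pairing R E)).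
have /cvg_sup/(_ f) h : nbhs (pairing nu) --> pairing nu by exact: cvg_id.
have ci := @initial_continuous (Cb E -> R) R (fun g => g f) (pairing nu).
exact: (cvg_comp _ _ h ci).
Qed.

(** For open [U] the mass is the limit of the integrals of the continuous functions [min 1 (n * g)],
    hence a limit of functions continuous for the weak topology. Open sets are stable under
    intersection, so a Dynkin class argument reaches all Borel sets. *)
Lemma measurable_fmeas (B : set (borel E)) : measurable B ->
  measurable_fun setT (fun nu : borel (fmeas E) => (nu : fmeas E) B).
Proof.
pose H := [set B : set (borel E) | measurable B /\
  measurable_fun setT (fun nu : borel (fmeas E) => (nu : fmeas E) B)].
suff : measurable `<=` H by move=> + mB => /(_ _ mB)[].
have sub U : @open E U -> H U.
  move=> oU; have mU : measurable (U : set (borel E)) by exact: sub_sigma_algebra.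
  split => //; have [g [cg g01 Ug]] := open_bump oU.
  pose f_ n x : R := Num.min 1 (n%:R * g x).
  have cf n : continuous (f_ n).
    move=> x; apply: (@continuous_min _ E (cst 1) (fun x => n%:R * g x) x).
      exact: cst_continuous.
    by apply: (@continuousM _ E (cst n%:R) g x); [exact: cst_continuous|exact: cg].
  have f01 n x : `|f_ n x| <= 1.
    rewrite ger0_norm /f_ ?ge_min ?lexx// le_min ler01 mulr_ge0//.
    by case/andP: (g01 x).
  rewrite (_ : (fun nu => _) = fun nu : borel (fmeas E) =>
      (\int[nu : fmeas E]_x \1_U x)%:E); last first.
    apply/funext => nu; rewrite EFin_Rintegral//.
      by rewrite integral_indic ?setIT.
    apply: (@bdd_integrable _ _ _ _ _ _ _ _ 1) => //; first exact: fmeas_fin.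
    by move=> x _; rewrite ger0_norm// indicE; case: (_ \in _).
  apply/measurable_EFinP.
  apply: (@measurable_fun_cvg _ _ _ _
      (fun n (nu : borel (fmeas E)) => \int[nu : fmeas E]_x f_ n x)).
    move=> n; pose fn : Cb E := exist _ (f_ n) (conj (cf n) (bounded_funP (f01 n))).
    exact: (@borel_continuous_measurable R (fmeas E) _ (@pairing_continuous fn)).
  move=> nu _; apply: (@Rintegral_bounded_cvg _ _ _ _ _ _ _ _ _ 1) => //.
  - exact: fmeas_fin.
  - by move=> n; exact: (@borel_continuous_measurable R E).
  move=> x _; rewrite indicE; have [/set_mem/Ug gx|xU] := boolP (x \in U).
    apply: cvg_near_cst; exists (Num.truncn (g x)^-1).+1 => // n /= hn.
    rewrite /f_; apply/min_idPl.
    rewrite -ler_pdivrMr// mul1r; apply: ltW; apply: (lt_le_trans (truncnS_gt _)).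
    by rewrite ler_nat.
  have -> : f_ ^~ x = fun=> 0; last exact: cvg_cst.
  apply/funext => n; rewrite /f_; have -> : g x = 0.
    apply/eqP; rewrite eq_le; case/andP: (g01 x) => -> _; rewrite andbT leNgt.
    by apply: contra xU => /Ug; rewrite inE.
  by rewrite mulr0; apply/min_idPr.
apply: (@lambda_system_subset _ (@open E) _ setT H _ sub); last by [].
- by move=> A1 A2; exact: openI.
split => //.
- by apply: sub; exact: openT.
- move=> A1 A2 BA [mA fA] [mB fB]; split; first exact: measurableD.
  rewrite (_ : (fun nu => _) = fun nu : borel (fmeas E) =>
     ((nu : fmeas E) A1 - (nu : fmeas E) A2)%E).
    exact: emeasurable_funB.
  apply/funext => nu; rewrite measureD ?setIidr//.
  exact: fmeas_fin.
- move=> F ndF HF; split; first by apply: bigcupT_measurable => i; have [] := HF i.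
  apply: (@emeasurable_fun_cvg _ _ _ _ (fun n (nu : borel (fmeas E)) => (nu : fmeas E) (F n : set (borel E)))).
    by move=> n; have [] := HF n.
  move=> nu _; apply: nondecreasing_cvg_mu => //; first by move=> n; have [] := HF n.
  by apply: bigcupT_measurable => i; have [] := HF i.
Qed.

Lemma measurable_fmeas_integral_param d (X : measurableType d)
    (F : X * borel E -> \bar R) : (forall z, 0 <= F z)%E -> measurable_fun setT F ->
  measurable_fun setT (fun z : X * borel (fmeas E) =>
    \int[z.2 : fmeas E]_y F (z.1, y))%E.
Proof.
move=> F0 mF.
apply: (@measurable_fun_integral_in _ _ (X * borel (fmeas E))%type (borel E) R
  (fun z => z.2 : fmeas E) setT _ _ _ (fun u => F (u.1.1, u.2))) => //.
- by move=> U mU; apply: measurableT_comp (measurable_fmeas mU) _.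
- by move=> z; exact: fmeas_fin.
- apply: measurableT_comp mF _; apply/measurable_fun_pairP; split => //=.
    exact: (measurableT_comp measurable_fst measurable_fst).
  exact: measurable_snd.
Qed.

Lemma measurable_fmeas_integral (f : borel E -> \bar R) :
  (forall z, 0 <= f z)%E -> measurable_fun setT f ->
  measurable_fun setT (fun nu : borel (fmeas E) => \int[nu : fmeas E]_y f y)%E.
Proof.
move=> f0 mf; apply: (@measurable_fun_integral_kernel _ _ (borel (fmeas E)) (borel E) R
  (fun nu => nu : fmeas E)) => //.
exact: measurable_fmeas.
Qed.

Lemma fmeas_integrable nu (f : E -> R) : Bb f -> nu.-integrable setT (EFin \o f).
Proof.
move=> bf; have [C _ fC] := BbP bf; apply: (@bdd_integrable _ _ _ _ _ _ _ _ C) => //.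
  exact: fmeas_fin.
exact: bf.1.
Qed.

Lemma measurable_fmeas_Rintegral (f : E -> R) : Bbplus f ->
  measurable_fun setT (fun nu : borel (fmeas E) => \int[nu : fmeas E]_y f y).
Proof.
move=> bf; apply: measurableT_comp (fine_measurable _) _ => //.
apply: measurable_fmeas_integral; first by move=> z; rewrite lee_fin Bbplus_ge0.
by apply/measurable_EFinP; exact: bf.1.1.
Qed.

End fmeas_measurability.

(** * Occupation integrals of the spatial motion *)

Section path_measurability.
Context (R : realType) (E : pmetricType R) (dO : measure_display)
  (O : measurableType dO) (X : hunt_process E O).
Local Notation Ed := (one_point_compactification E).

(** Discretised time: the first point strictly after [s] in the grid of mesh 1/(n+1). Strictness
    matters, because right limits are taken over punctured neighbourhoods. *)
Let dsc (n : nat) (s : R) : R := (Num.truncn (s * n.+1%:R)).+1%:R / n.+1%:R.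

Let dsc_gt n s : s < dsc n s.
Proof. by rewrite /dsc ltr_pdivlMr ?ltr0n// truncnS_gt. Qed.

Let dsc_le n s : 0 <= s -> dsc n s <= s + n.+1%:R^-1.
Proof.
move=> s0; rewrite /dsc ler_pdivrMr ?ltr0n// mulrDl mulVf ?pnatr_eq0//.
by rewrite -natr1 lerD2r truncn_le// mulr_ge0.
Qed.

Let dsc_cvg s w (V : set Ed) : 0 <= s -> nbhs (xi X s w : Ed) V ->
  exists N, forall n, (N <= n)%N -> V (xi X (dsc n s) w).
Proof.
move=> s0 nV; have := @xi_right_continuous _ _ _ _ X s w s0 _ nV.
move=> [e /= e0 He]; exists (Num.truncn e^-1).+1 => n Nn.
apply: He => /=; last exact: dsc_gt.
rewrite ltr0_norm ?subr_lt0 ?dsc_gt// opprB ltrBlDl.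
apply: (le_lt_trans (dsc_le _ s0)); rewrite ltrD2l -[ltRHS]invrK ltf_pV2 ?posrE ?invr_gt0//.
by apply: (lt_le_trans (truncnS_gt _)); rewrite ler_nat (leq_trans Nn).
Qed.

Let mdsc n (B : set (borel Ed)) : measurable B ->
  measurable [set z : O * R | 0 <= z.2 /\ B (xi X (dsc n z.2) z.1)].
Proof.
move=> mB.
rewrite (_ : [set z | _] = \bigcup_j
   ((xi X (j.+1%:R / n.+1%:R) @^-1` B) `*`
    `[j%:R / n.+1%:R, j.+1%:R / n.+1%:R[%classic)).
  apply: bigcup_measurable => j _; apply: measurableX => //.
  rewrite -[X in measurable X]setTI.
  by apply: xi_measurable => //; rewrite divr_ge0.
have n0 : 0 < n.+1%:R :> R by rewrite ltr0n.
apply/seteqP; split => [[w s] /= [s0 Bs]|[w s] [j _] /= [Bs]].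
  exists (Num.truncn (s * n.+1%:R)) => //=; split => //.
  rewrite in_itv/= ler_pdivrMr// ltr_pdivlMr//.
  by apply: truncn_itv; rewrite mulr_ge0.
rewrite in_itv/= ler_pdivrMr// ltr_pdivlMr// => js.
have e : Num.truncn (s * n.+1%:R) = j by exact: truncn_def.
split; last by rewrite /dsc e.
have : 0 <= s * n.+1%:R by case/andP: js => h _; exact: le_trans h.
by rewrite pmulr_lge0.
Qed.

Definition visits (U : set E) : set (O * R) :=
  [set z | 0 <= z.2 /\ exists2 x, U x & xi X z.2 z.1 = Some x].

(** By right continuity the path is in [U] at time [s] exactly when, for some [k], its
    discretisations eventually lie in the open set where [g] exceeds 1/(k+1). For a discretised time
    such an event is a countable union of rectangles. Working with sets avoids any metric on the
    compactification. *)
Lemma measurable_visits (U : set E) : open U -> measurable (visits U).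
Proof.
move=> oU; have [g [cg g01 Ug]] := open_bump oU.
pose Uk (k : nat) : set Ed := Some @` [set x | k.+1%:R^-1 < g x].
have oUk k : open (Uk k).
  apply: one_point_compactification_open_some.
  rewrite (_ : [set x | _] = g @^-1` `]k.+1%:R^-1, +oo[%classic).
    by apply: open_comp => //; exact: interval_open.
  by apply/seteqP; split => x /=; rewrite in_itv/= andbT.
have -> : visits U = \bigcup_k \bigcup_N \bigcap_(n in [set n | (N <= n)%N])
    [set z | 0 <= z.2 /\ Uk k (xi X (dsc n z.2) z.1)].
  apply/seteqP; split => [[w s] [/= s0 [x Ux xs]]|[w s] [k _ [N _ H]]].
    have gx : 0 < g x by apply/Ug.
    exists (Num.truncn (g x)^-1) => //.
    have nV : nbhs (xi X s w : Ed) (Uk (Num.truncn (g x)^-1)).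
      rewrite xs; apply: open_nbhs_nbhs; split; first exact: oUk.
      exists x => //=; rewrite invf_plt ?posrE ?invr_gt0// truncnS_gt//.
    have [N HN] := dsc_cvg s0 nV; exists N => // n /= Nn; split => //=.
    exact: HN.
  have [/= s0 _] := H N (leqnn N); split => //=.
  case xs : (xi X s w) => [x|]; last first.
    (* A path already at the cemetery stays there, so a later discretisation could not be in
       [Uk k]. *)
    have [_ [y _ /= hy]] := H N (leqnn N); exfalso.
    have := @xi_cemetery _ _ _ _ X s (dsc N s) w _ xs.
    by rewrite -hy s0/= ltW ?dsc_gt// => /(_ isT).
  (* If [g x] were 0, the discretisations would eventually have [g] below 1/(k+1), against their
     membership in [Uk k]. *)
  exists x => //; apply/Ug; rewrite ltNge; apply/negP => gx.
  pose V : set Ed := Some @` [set y | g y < k.+1%:R^-1].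
  have nV : nbhs (xi X s w : Ed) V.
    rewrite xs; apply: open_nbhs_nbhs; split.
      apply: one_point_compactification_open_some.
      rewrite (_ : [set x | _] = g @^-1` `]-oo, k.+1%:R^-1[%classic).
        by apply: open_comp => //; exact: interval_open.
      by apply/seteqP; split => y /=; rewrite in_itv.
    by exists x => //=; rewrite (le_lt_trans gx)// invr_gt0.
  have [M HM] := dsc_cvg s0 nV.
  have [y /= y1 hy] := HM _ (leq_maxr N M).
  have [_ [y' /= y2 hy']] := H _ (leq_maxl N M).
  move: hy'; rewrite -hy => -[e]; move: y2; rewrite e => y2.
  by have := lt_trans y1 y2; rewrite ltxx.
apply: bigcup_measurable => k _; apply: bigcup_measurable => N _.
apply: bigcap_measurable; first by exists N => /=.
by move=> n _; apply: mdsc; exact: sub_sigma_algebra.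
Qed.

(** A path with values in [E] itself, along which functions on [E] can be composed; [point] is a
    placeholder at the cemetery and at negative times. *)
Definition position (z : O * R) : E :=
  if pselect (visits setT z) then (if xi X z.2 z.1 is Some x then x else point)
  else point.

Lemma measurable_position : measurable_fun setT (position : O * R -> borel E).
Proof.
apply: (@measurability _ _ (O * R)%type (borel E) setT position (@open E)) => //.
move=> _ [U oU <-]; rewrite setTI.
have mA := measurable_visits (@openT E).
have h : position @^-1` U = visits U `|`
    (~` visits setT `&` [set _ | U point]).
  apply/seteqP; split => z; rewrite /position/=.
    case: pselect => [[z0 [x _ xz]]|nz] /=; last by right.
    by rewrite xz => Ux; left; split => //; exists x.
  case: pselect => [[z0 [x _ xz]]|nz] /=; rewrite ?xz.
    by case=> [[_ [y Uy]]|[]]; [rewrite xz => -[->]|case; split => //; exists x].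
  by case=> [[z0 [y _ yz]]|[]//]; case: nz; split => //; exists y.
rewrite h; apply: measurableU; first exact: measurable_visits.
apply: measurableI; first exact: measurableC.
have [Up|Up] := pselect (U point).
  by rewrite (_ : [set _ | _] = setT)//; apply/seteqP; split.
by rewrite (_ : [set _ | _] = set0)//; apply/seteqP; split.
Qed.

End path_measurability.

Section occupation.
Context (R : realType) (E : pmetricType R) (dO : measure_display)
  (O : measurableType dO) (X : hunt_process E O).
Implicit Types (g : R -> E -> R) (t : R) (x : E).

(** The integrands for which [occupation] is a genuine double integral. Real integrals take a
    default value when the extended one is infinite, so the algebraic rules for [occupation] are
    backed by membership in this class. *)
Definition jbounded t g :=
  measurable_fun [set z : R * borel E | 0 <= z.1 <= t] (fun z => g z.1 z.2) /\
  exists C, forall s x, 0 <= s <= t -> `|g s x| <= C.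

Let slab t : set (O * R) := setT `*` `[0, t]%classic.
Let along g (z : O * R) : R := ext0 (g z.2) (xi X z.2 z.1).

Lemma measurable_time_slab t :
  measurable [set z : R * borel E | 0 <= z.1 <= t].
Proof.
rewrite (_ : [set z | _] = `[0, t]%classic `*` setT); first exact: measurableX.
by apply/seteqP; split => z /=; rewrite in_itv/=; [split|case].
Qed.

Let mslab t : measurable (slab t).
Proof. exact: measurableX. Qed.

Lemma measurable_along t g : jbounded t g -> measurable_fun (slab t) (along g).
Proof.
move=> [mg _].
have mT := measurable_time_slab t.
pose S : set (R * borel E) := [set z : R * borel E | 0 <= z.1 <= t].
pose g' := (fun z : R * borel E => g z.1 z.2) \_ S.
have mg' : measurable_fun setT g'.
  by apply/(measurable_restrictT _ _).1.
have mp : measurable_fun setT (fun z : O * R => (z.2, position X z : borel E)).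
  by apply: measurable_fun_pair; [exact: measurable_snd|exact: measurable_position].
(* The indicator of [A] restores the value 0 at the cemetery, where [position] returns [point]. *)
pose A := visits X setT.
have mA : measurable A by apply: measurable_visits; exact: openT.
apply: (@eq_measurable_fun _ _ _ _ _ (fun z => g' (z.2, position X z) * \1_A z)).
  move=> [w s] /set_mem[_ /=]; rewrite in_itv/= => st.
  rewrite /along/= indicE; case xs : (xi X s w) => [x|].
    have Az : A (w, s) by split => /=; [case/andP: st|exists x].
    rewrite mem_set// mulr1 /g' patchE mem_set//=.
    by rewrite /position; case: pselect => //= _; rewrite xs.
  rewrite memNset ?mulr0//.
  by move=> [_ [x _ /=]]; rewrite xs.
apply: measurable_funTS; apply: measurable_funM.
  exact: (measurableT_comp mg' mp).
exact: measurable_indic.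
Qed.

(* [measurableTypeR R] is [R] with the sigma-algebra under which
   [lebesgue_measure] is declared; it has the same measurable sets. *)
Let mslab2 t : measurable (slab t : set (O * measurableTypeR R)).
Proof. exact: (mslab t). Qed.

Let measurable_along2 t g : jbounded t g ->
  measurable_fun (slab t : set (O * measurableTypeR R)) (along g).
Proof. by move=> jg; exact: (measurable_along jg). Qed.

Let prodm x : {measure set (O * measurableTypeR R) -> \bar R} := (Pi X (Some x) \x lebesgue_measure)%E.

Let leb_itv t : 0 <= t ->
  lebesgue_measure (`[0%R, t]%classic : set (measurableTypeR R)) = t%:E.
Proof.
move=> t0; rewrite lebesgue_measure_itv/= lte_fin.
by case: ltP => [_|tt]; [rewrite EFinN sube0|congr EFin; lra].
Qed.

Let measurable_along0 t g : jbounded t g ->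
  measurable_fun setT ((along g) \_ (slab t) : O * measurableTypeR R -> R).
Proof. by move=> jg; apply: (measurable_restrictT _ (mslab2 t)).1; exact: measurable_along2. Qed.

Let prodm_slab t x : 0 <= t -> prodm x (slab t) = t%:E.
Proof.
move=> t0; transitivity (Pi X (Some x) setT *
    lebesgue_measure (`[0%R, t]%classic : set (measurableTypeR R)))%E.
  exact: product_measure1E.
by rewrite [X in (X * _)%E]probability_setT mul1e leb_itv.
Qed.

Lemma along_bounded t g : jbounded t g ->
  exists2 C, 0 <= C & forall z, slab t z -> `|along g z| <= C.
Proof.
move=> [_ [C gC]]; exists `|C| => // -[w s] [_ /=]; rewrite in_itv/= => st.
rewrite /along/=; case: (xi X s w) => [x|] /=; last by rewrite normr0.
by apply: (le_trans (gC _ _ st)); exact: ler_norm.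
Qed.

Lemma along_integrable t g x : 0 <= t -> jbounded t g ->
  (prodm x).-integrable (slab t) (EFin \o along g).
Proof.
move=> t0 jg; have [C C0 gC] := along_bounded jg.
apply: (@bdd_integrable _ _ _ _ _ (mslab2 t) _ _ C) => //.
  by rewrite [X in (X < _)%E]prodm_slab// ltry.
exact: measurable_along2.
Qed.

(** Fubini, with time inside. For every path the inner integral must be finite before the real and
    the extended one can be identified, which is where the bound on [g] enters. *)
Lemma occupationE t g x : 0 <= t -> jbounded t g ->
  occupation X t g x = \int[prodm x]_(z in slab t) along g z.
Proof.
move=> t0 jg; have ig := along_integrable x t0 jg.
rewrite /occupation /Rintegral; congr fine.
have ig' : (prodm x).-integrable setT ((EFin \o along g) \_ (slab t)).
  by apply: (integrable_restrict (prodm x) (mslab2 t) measurableT _).1; rewrite setTI.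
rewrite [RHS]integral_mkcond -(integral12_prod_meas1 ig').
apply: eq_integral => w _.
rewrite /fubini_F (@EFin_Rintegral _ _ R lebesgue_measure `[0, t]%classic); first last.
- have [C C0 gC] := along_bounded jg.
  apply: (@bdd_integrable _ _ _ _ _ _ _ _ C) => //.
  + by have := ltry t; rewrite -(leb_itv t0).
  + have : measurable_fun setT ((along g \_ (slab t)) \o pair w).
      apply: measurableT_comp; first exact: measurable_along0.
      exact: measurable_fun_pair.
    move=> /(measurable_funTS (D := `[0, t]%classic)).
    apply: eq_measurable_fun => s /set_mem /= st.
    by rewrite patchE mem_set.
  + by move=> s st; apply: (gC (w, s)); split.
- by [].
rewrite integral_mkcond; apply: eq_integral => s _; rewrite !patchE.
have -> : (s \in `[0, t]%classic) = ((w, s) \in slab t).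
  by apply/idP/idP => /set_mem h; apply/mem_set; [split|case: h].
by case: ifP.
Qed.

Lemma occupation_eq t g1 g2 x :
  (forall s y, 0 <= s <= t -> g1 s y = g2 s y) ->
  occupation X t g1 x = occupation X t g2 x.
Proof.
move=> e; rewrite /occupation; apply: eq_Rintegral => w _; apply: eq_Rintegral => s.
move=> /set_mem/=; rewrite in_itv/= => st; rewrite /ext0.
by case: (xi X s w) => //= y; rewrite e.
Qed.

Lemma jboundedD t g1 g2 : jbounded t g1 -> jbounded t g2 ->
  jbounded t (fun s y => g1 s y + g2 s y).
Proof.
move=> [m1 [C1 b1]] [m2 [C2 b2]]; split; first exact: measurable_funD.
exists (C1 + C2) => s y st; apply: (le_trans (ler_normD _ _)).
by rewrite lerD ?b1 ?b2.
Qed.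

Lemma jboundedM t g1 g2 : jbounded t g1 -> jbounded t g2 ->
  jbounded t (fun s y => g1 s y * g2 s y).
Proof.
move=> [m1 [C1 b1]] [m2 [C2 b2]]; split; first exact: measurable_funM.
by exists (C1 * C2) => s y st; rewrite normrM ler_pM ?b1 ?b2.
Qed.

Lemma jbounded_Bb t (f : E -> R) : Bb f -> jbounded t (fun=> f).
Proof.
move=> bf; split; last by have [C _ fC] := BbP bf; exists C.
apply: measurable_funTS; apply: measurableT_comp => //; exact: bf.1.
Qed.

Lemma jboundedZ t c g : jbounded t g -> jbounded t (fun s y => c * g s y).
Proof.
apply: jboundedM; apply: (@jbounded_Bb _ (cst c)).
by apply: (@BbI _ _ _ `|c|) => //; exact: measurable_cst.
Qed.

Lemma jboundedB t g1 g2 : jbounded t g1 -> jbounded t g2 ->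
  jbounded t (fun s y => g1 s y - g2 s y).
Proof.
move=> j1 j2; have := jboundedD j1 (jboundedZ (-1) j2).
by under [X in jbounded t X -> _]eq_fun do under eq_fun do rewrite mulN1r.
Qed.

Lemma jbounded_sum t n (g : nat -> R -> E -> R) : (forall j, jbounded t (g j)) ->
  jbounded t (fun s y => \sum_(0 <= j < n) g j s y).
Proof.
move=> jg; elim: n => [|n IH].
  have -> : (fun s y => \sum_(0 <= j < 0) g j s y) = fun _ => cst 0.
    by apply/funext => s; apply/funext => y; rewrite big_nil.
  by apply: jbounded_Bb; apply: (@BbI _ _ _ 0) => [|y]; [exact: measurable_cst|rewrite normr0].
have -> : (fun s y => \sum_(0 <= j < n.+1) g j s y) =
    fun s y => \sum_(0 <= j < n) g j s y + g n s y.
  by apply/funext => s; apply/funext => y; rewrite big_nat_recr.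
exact: jboundedD.
Qed.

Lemma occupationD t g1 g2 x : 0 <= t -> jbounded t g1 -> jbounded t g2 ->
  occupation X t (fun s y => g1 s y + g2 s y) x =
  occupation X t g1 x + occupation X t g2 x.
Proof.
move=> t0 j1 j2; rewrite !occupationE//; last exact: jboundedD.
rewrite -RintegralD//; last 2 first.
- exact: along_integrable.
- exact: along_integrable.
by apply: eq_Rintegral => z _; rewrite /along /ext0; case: (xi X _ _) => //=; rewrite addr0.
Qed.

Lemma occupationZ t c g x : 0 <= t -> jbounded t g ->
  occupation X t (fun s y => c * g s y) x = c * occupation X t g x.
Proof.
move=> t0 j1; rewrite !occupationE//; last exact: jboundedZ.
rewrite -RintegralZl//; last exact: along_integrable.
by apply: eq_Rintegral => z _; rewrite /along /ext0; case: (xi X _ _) => //=; rewrite mulr0.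
Qed.

Lemma occupationB t g1 g2 x : 0 <= t -> jbounded t g1 -> jbounded t g2 ->
  occupation X t (fun s y => g1 s y - g2 s y) x =
  occupation X t g1 x - occupation X t g2 x.
Proof.
move=> t0 j1 j2; rewrite -mulN1r -(occupationZ _ x t0 j2) -(occupationD x t0 j1 (jboundedZ _ j2)).
by apply: occupation_eq => s y _; rewrite mulN1r.
Qed.

Lemma occupation_sum t n (g : nat -> R -> E -> R) x : 0 <= t ->
  (forall j, jbounded t (g j)) ->
  occupation X t (fun s y => \sum_(0 <= j < n) g j s y) x =
  \sum_(0 <= j < n) occupation X t (g j) x.
Proof.
move=> t0 jg; elim: n => [|n IH].
  rewrite big_nil /occupation /Rintegral integral0_eq// => w _.
  by rewrite integral0_eq// => s _; rewrite /ext0; case: (xi X _ _) => //= y; rewrite big_nil.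
rewrite big_nat_recr//= -IH -(occupationD x t0 (jbounded_sum n jg) (jg n)).
by apply: occupation_eq => s y _; rewrite big_nat_recr.
Qed.

Lemma ler_occupation t g1 g2 x : 0 <= t -> jbounded t g1 -> jbounded t g2 ->
  (forall s y, 0 <= s <= t -> g1 s y <= g2 s y) ->
  occupation X t g1 x <= occupation X t g2 x.
Proof.
move=> t0 j1 j2 le12; rewrite !occupationE//; apply: le_Rintegral => //.
- exact: along_integrable.
- exact: along_integrable.
move=> [w s] [_ /=]; rewrite in_itv/= => st; rewrite /along /ext0 /=.
by case: (xi X s w) => //= y; exact: le12.
Qed.

Lemma occupation_ub t g x C : 0 <= t -> 0 <= C -> jbounded t g ->
  (forall s y, 0 <= s <= t -> g s y <= C) -> occupation X t g x <= t * C.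
Proof.
move=> t0 C0 jg gC; rewrite occupationE//.
have mt : (prodm x (slab t) < +oo)%E by rewrite prodm_slab// ltry.
apply: (@le_trans _ _ (\int[prodm x]_(z in slab t) C)).
  apply: le_Rintegral => //; first exact: along_integrable.
    by apply: (@bdd_integrable _ _ _ _ _ (mslab2 t) mt (cst C) `|C|) => //; exact: measurable_cst.
  move=> [w s] [_ /=]; rewrite in_itv/= => st; rewrite /along /ext0 /=.
  by case: (xi X s w) => //= y; exact: gC.
by rewrite Rintegral_cst// [X in fine X]prodm_slab// mulrC.
Qed.

Lemma occupation_cvg t (g_ : nat -> R -> E -> R) g x C : 0 <= t ->
  (forall n, jbounded t (g_ n)) ->
  (forall n s y, 0 <= s <= t -> `|g_ n s y| <= C) ->
  (forall s y, 0 <= s <= t -> g_ n s y @[n --> \oo] --> g s y) ->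
  jbounded t g /\
  occupation X t (g_ n) x @[n --> \oo] --> occupation X t g x.
Proof.
move=> t0 jg gC g_g.
have jgt : jbounded t g.
  split.
    apply: (@measurable_fun_cvg _ _ _ _ (fun n (z : R * borel E) => g_ n z.1 z.2)).
      by move=> n; have [] := jg n.
    by move=> z /= zt; exact: g_g.
  exists C => s y st.
  have h1 : `|g_ n s y| @[n --> \oo] --> `|g s y| by exact: cvg_norm (g_g s y st).
  rewrite -(cvg_lim _ h1)//; apply: limr_le; first by apply/cvg_ex; eexists; exact: h1.
  by apply: nearW => n; exact: gC.
split => //; rewrite occupationE//.
under eq_fun do rewrite occupationE//.
apply: (@Rintegral_bounded_cvg _ _ _ _ _ (mslab2 t) _ _ _ `|C|).
- by rewrite [X in (X < _)%E]prodm_slab// ltry.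
- by move=> n; exact: measurable_along2.
- move=> [w s] [_ /=]; rewrite in_itv/= => st; rewrite /along /ext0 /=.
  by case: (xi X s w) => [y|]; [exact: g_g|exact: cvg_cst].
- move=> n [w s] [_ /=]; rewrite in_itv/= => st; rewrite /along /ext0 /=.
  case: (xi X s w) => [y|]; last by rewrite normr0.
  by apply: (le_trans (gC _ _ _ st)); exact: ler_norm.
Qed.

(** Fubini in the other order: for fixed [s] the expectation is [semigroup X s f x], so a bound
    along time at the single point [x] is enough. This is what makes bounds proportional to [h x]
    possible. *)
Lemma occupation_time t (f : E -> R) x B : 0 <= t -> 0 <= B -> Bbplus f ->
  (forall s, 0 <= s <= t -> semigroup X s f x <= B) ->
  occupation X t (fun=> f) x <= t * B.
Proof.
move=> t0 B0 bf fB.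
have jf : jbounded t (fun=> f) by apply: jbounded_Bb; exact: bf.1.
have ig := along_integrable x t0 jf.
rewrite occupationE// -lee_fin EFin_Rintegral//.
have ig' : (prodm x).-integrable setT ((EFin \o along (fun=> f)) \_ (slab t)).
  by apply: (integrable_restrict (prodm x) (mslab2 t) measurableT _).1; rewrite setTI.
rewrite integral_mkcond -(integral21_prod_meas1 ig').
have sE s : 0 <= s <= t -> (\int[Pi X (Some x)]_w
    ((EFin \o along (fun=> f)) \_ (slab t)) (w, s) <= B%:E)%E.
  move=> st; have [C C0 gC] := along_bounded jf.
  have ie : (Pi X (Some x)).-integrable setT (EFin \o (fun w => ext0 f (xi X s w))).
    apply: (@bdd_integrable _ _ _ _ _ _ _ _ C) => //.
    - by apply: (@le_lt_trans _ _ 1%E); [exact: probability_le1|exact: ltry].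
    - have ma := measurable_along jf.
      have : measurable_fun setT ((along (fun=> f) \_ (slab t)) \o (fun w => (w, s))).
        apply: measurableT_comp; first exact: measurable_along0.
        exact: measurable_fun_pair.
      by apply: eq_measurable_fun => w _ /=; rewrite patchE mem_set//; split => //=; rewrite in_itv.
    - by move=> w _; apply: (gC (w, s)); split => //=; rewrite in_itv.
  rewrite (_ : (\int[_]_w _)%E = (semigroup X s f x)%:E) ?lee_fin ?fB//.
  rewrite EFin_Rintegral//; apply: eq_integral => w _.
  by rewrite patchE mem_set//; split => //=; rewrite in_itv.
apply: (@le_trans _ _ (\int[lebesgue_measure]_(s in `[0%R, t]) (B%:E)))%E; last first.
  rewrite integral_cst//= lebesgue_measure_itv/= lte_fin muleC.
  by case: ltP => [_|tt]; [rewrite EFinN sube0 EFinM|rewrite mul0e lee_fin mulr_ge0].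
rewrite [leRHS]integral_mkcond.
apply: ge0_le_integral => //.
- move=> s _; apply: integral_ge0 => w _; rewrite patchE; case: ifPn => // _.
  by rewrite lee_fin /along /ext0 /=; case: (xi X s w) => //= y; exact: Bbplus_ge0.
- exact: (measurable_fubini_G ig').
- by apply/(measurable_restrictT _ _).1.
move=> s _; rewrite [leRHS]patchE; case: ifPn => [/set_mem/= st|st].
  by apply: sE; move: st; rewrite in_itv.
rewrite /fubini_G integral0_eq; first exact: lexx.
move=> w _; rewrite patchE; case: ifPn => // /set_mem[_ /= h].
by move: st; rewrite mem_set.
Qed.

End occupation.

(** * The branching mechanism *)

Section branching_mechanism.
Context (R : realType) (E : pmetricType R) (k : branching E).
Local Notation F0 := (@fmeas0 R E : set (borel (fmeas E))).
Implicit Types (f g : E -> R) (x : E) (nu : fmeas E).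

(** The superlinear part of the branching mechanism: what remains of [psi] once the linear terms in
    [a] and [gamma] are removed. The jumps are now compensated by their full integral [nu f] and not
    by the contribution of [x] alone. *)
Definition rho f x : R := br_b k x * f x ^+ 2 +
  \int[br_H k x]_(nu in F0) phi (\int[nu]_y f y).

Definition total nu : R := fine (nu setT).

Lemma totalE nu : (total nu)%:E = nu setT.
Proof. by rewrite /total fineK// fin_num_measure. Qed.

Lemma total_ge0 nu : 0 <= total nu.
Proof. exact: fine_ge0. Qed.

Lemma measurable_total : measurable_fun setT (total : borel (fmeas E) -> R).
Proof.
by apply: measurableT_comp (fine_measurable _) _ => //; exact: measurable_fmeas.
Qed.

Lemma measurable_fmeas0 : measurable (F0 : set (borel (fmeas E))).
Proof.
rewrite (_ : F0 = (total : borel (fmeas E) -> R) @^-1` (~` [set 0])); last first.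
  apply/seteqP; split => nu; rewrite /fmeas0 /= -totalE eqe.
    by move/eqP.
  by move=> h; apply/eqP.
by rewrite -[X in measurable X]setTI; apply: measurable_total => //; exact: measurableC.
Qed.

Definition jump_mass nu : R := Num.min (total nu) (total nu ^+ 2).

Lemma jump_mass_ge0 nu : 0 <= jump_mass nu.
Proof. by rewrite le_min total_ge0 sqr_ge0. Qed.

Lemma measurable_jump_mass : measurable_fun setT (jump_mass : borel (fmeas E) -> R).
Proof.
apply: measurable_minr; first exact: measurable_total.
by apply: measurable_funX; exact: measurable_total.
Qed.

Lemma measurable_mass_off x :
  measurable_fun setT (fun nu : borel (fmeas E) => (nu : fmeas E) (~` [set x])).
Proof.
by apply: measurable_fmeas; apply: measurableC; exact: measurable_borel_set1.
Qed.

Lemma jump_bound : exists2 C : R, 0 <= C & forall x,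
  (\int[br_H k x]_(nu in F0) (jump_mass nu)%:E <= C%:E)%E /\
  (\int[br_H k x]_(nu in F0) ((nu : fmeas E) (~` [set x])) <= C%:E)%E.
Proof.
have := br_HP k; set S := ereal_sup _ => Soo.
have ub x : (\int[br_H k x]_(nu in F0) ((jump_mass nu)%:E +
    (nu : fmeas E) (~` [set x])) <= S)%E.
  apply: ereal_sup_ubound; exists x => //; apply: eq_integral => nu _.
  by rewrite /jump_mass EFin_min EFin_expe -totalE.
have S0 : (0 <= S)%E.
  by apply: le_trans (ub point); apply: integral_ge0 => nu _;
    rewrite adde_ge0// lee_fin jump_mass_ge0.
have Sfin : S \is a fin_num by rewrite ge0_fin_numE.
exists (fine S); first exact: fine_ge0.
move=> x; rewrite fineK//; have mF := measurable_fmeas0.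
have m1 : measurable_fun F0 (fun nu : borel (fmeas E) => (jump_mass nu)%:E).
  by apply/measurable_EFinP; apply: measurable_funTS; exact: measurable_jump_mass.
have m2 := measurable_funTS (D := F0) (measurable_mass_off x).
split; apply: le_trans (ub x); apply: ge0_le_integral => //.
- by move=> nu _; rewrite lee_fin jump_mass_ge0.
- exact: emeasurable_funD.
- by move=> nu _; rewrite leeDl.
- exact: emeasurable_funD.
- by move=> nu _; rewrite leeDr// lee_fin jump_mass_ge0.
Qed.

Lemma fmeas_Rintegral_le nu f C : Bb f -> (forall x, f x <= C) ->
  \int[nu]_y f y <= C * total nu.
Proof.
move=> bf fC; rewrite -[X in _ <= _ * X]/(fine (nu setT)) -Rintegral_cst//.
apply: le_Rintegral => //; first exact: fmeas_integrable.
by apply: fmeas_integrable; apply: (@BbI _ _ _ `|C|) => //; exact: measurable_cst.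
Qed.

Lemma phi_jump_le f C nu : Bbplus f -> 0 <= C -> (forall x, f x <= C) ->
  0 <= phi (\int[nu]_y f y) <= (C + C ^+ 2) * jump_mass nu.
Proof.
move=> bf C0 fC; rewrite phi_ge0/=.
have n0 : 0 <= \int[nu]_y f y by apply: Rintegral_ge0 => y _; exact: Bbplus_ge0.
have nC := fmeas_Rintegral_le nu bf.1 fC.
have t0 := total_ge0 nu.
have Ct : 0 <= C * total nu by rewrite mulr_ge0.
have h1 : phi (\int[nu]_y f y) <= C * total nu by apply: (le_trans (phi_le n0)).
have h2 : phi (\int[nu]_y f y) <= C ^+ 2 * total nu ^+ 2.
  apply: (le_trans (phi_le_sqr n0)); rewrite -exprMn.
  by rewrite ler_sqr ?nnegrE.
have C2 := sqr_ge0 C; have T2 := sqr_ge0 (total nu).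
rewrite /jump_mass /Num.min; case: ifP => _; nra.
Qed.

Lemma measurable_phi_jump f : Bbplus f ->
  measurable_fun setT (fun nu : borel (fmeas E) => phi (\int[nu : fmeas E]_y f y)).
Proof.
by move=> bf; apply: measurableT_comp measurable_phi _; exact: measurable_fmeas_Rintegral.
Qed.

Lemma jump_mass_integrable x C : 
  (br_H k x).-integrable F0 (EFin \o (fun nu => C * jump_mass nu)).
Proof.
have [B B0 hB] := jump_bound.
have : (br_H k x).-integrable F0 (EFin \o jump_mass).
  apply/integrableP; split.
    by apply/measurable_EFinP; apply: measurable_funTS; exact: measurable_jump_mass.
  under eq_integral do rewrite /= ger0_norm ?jump_mass_ge0//.
  by apply: (le_lt_trans (hB x).1); exact: ltry.
by move=> /(integrableZl measurable_fmeas0 C).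
Qed.

Lemma phi_jump_integrable f x : Bbplus f ->
  (br_H k x).-integrable F0 (EFin \o (fun nu => phi (\int[nu]_y f y))).
Proof.
move=> bf; have [C C0 fC] := BbplusP bf.
apply: le_integrable (jump_mass_integrable x (C + C ^+ 2)).
- exact: measurable_fmeas0.
- by apply/measurable_EFinP; apply: measurable_funTS; exact: measurable_phi_jump.
- move=> nu _ /=; rewrite lee_fin ger0_norm ?phi_ge0//.
  apply: le_trans (ler_norm _).
  by case/andP: (phi_jump_le nu bf C0 (fun x => proj2 (andP (fC x)))).
Qed.

Lemma rho_ge0 f x : 0 <= rho f x.
Proof.
apply: addr_ge0; last by apply: Rintegral_ge0 => nu _; exact: phi_ge0.
by apply: mulr_ge0; [case: (br_bP k) => _ [_ ->]|exact: sqr_ge0].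
Qed.

Lemma rho_le f g x : Bbplus f -> Bbplus g -> (forall y, f y <= g y) ->
  rho f x <= rho g x.
Proof.
move=> bf bg fg; rewrite lerD//.
  rewrite ler_wpM2l//; first by case: (br_bP k) => _ [_ ->].
  by rewrite ler_sqr ?nnegrE ?Bbplus_ge0.
apply: le_Rintegral; rewrite ?phi_jump_integrable//; first exact: measurable_fmeas0.
move=> nu _; apply: ler_phi; apply/andP; split.
  by apply: Rintegral_ge0 => y _; exact: Bbplus_ge0.
by apply: le_Rintegral => //; apply: fmeas_integrable; [exact: bf.1|exact: bg.1].
Qed.

Lemma rho_bound C : 0 <= C -> exists2 D, 0 <= D & forall f x, Bbplus f ->
  (forall y, f y <= C) -> rho f x <= D.
Proof.
move=> C0; have [B B0 hB] := jump_bound.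
have [b b0 hb] := BbplusP (br_bP k).
exists (b * C ^+ 2 + (C + C ^+ 2) * B).
  by rewrite addr_ge0 ?mulr_ge0 ?addr_ge0 ?sqr_ge0.
move=> f x bf fC; rewrite lerD//.
  apply: ler_pM; rewrite ?sqr_ge0//; try by case/andP: (hb x).
  by rewrite ler_sqr ?nnegrE ?Bbplus_ge0.
apply: (@le_trans _ _ (\int[br_H k x]_(nu in F0) ((C + C ^+ 2) * jump_mass nu))).
  apply: le_Rintegral.
  - exact: measurable_fmeas0.
  - exact: phi_jump_integrable.
  - exact: jump_mass_integrable.
  - by move=> nu _; case/andP: (phi_jump_le nu bf C0 fC).
rewrite RintegralZl; last 2 first.
- exact: measurable_fmeas0.
- have := jump_mass_integrable x 1.
  by apply: eq_integrable => [|nu _ /=]; [exact: measurable_fmeas0|rewrite mul1r].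
rewrite ler_wpM2l ?addr_ge0 ?sqr_ge0// -lee_fin fineK; first exact: (hB x).1.
rewrite ge0_fin_numE; first by apply: (le_lt_trans (hB x).1); exact: ltry.
by apply: integral_ge0 => nu _; rewrite lee_fin jump_mass_ge0.
Qed.

Lemma finite_kernel_bound (l : R.-fker (borel E) ~> (borel E)) :
  exists2 C, 0 <= C & forall x, (l x setT <= C%:E)%E.
Proof.
have [C hC] := measure_uub l; exists `|C| => // x.
by apply: (le_trans (ltW (hC x))); rewrite lee_fin ler_norm.
Qed.

Lemma finite_kernel_integrable (l : R.-fker (borel E) ~> (borel E)) x f :
  Bb f -> (l x).-integrable setT (EFin \o f).
Proof.
move=> bf; have [C C0 fC] := BbP bf.
apply: (@bdd_integrable _ _ _ _ _ _ _ _ C) => //; last exact: bf.1.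
have [D D0 hD] := finite_kernel_bound l.
by apply: (le_lt_trans (hD x)); exact: ltry.
Qed.

Lemma gamma_int_ge0 f x : (forall y, 0 <= f y) -> 0 <= gamma_int k f x.
Proof. by move=> f0; apply: Rintegral_ge0. Qed.

Lemma gamma_int_bound : exists2 G, 0 <= G & forall f C x, Bb f -> 0 <= C ->
  (forall y, `|f y| <= C) -> `|gamma_int k f x| <= G * C.
Proof.
have [G G0 hG] := finite_kernel_bound (br_gamma k); exists G => // f C x bf C0 fC.
apply: (@le_trans _ _ (C * fine (br_gamma k x setT))).
  apply: (@normr_Rintegral_le _ _ _ (br_gamma k x) setT measurableT _ f C) => //.
    by apply: (le_lt_trans (hG x)); exact: ltry.
  exact: bf.1.
rewrite mulrC ler_wpM2r// -lee_fin fineK; first exact: hG.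
by rewrite ge0_fin_numE//; apply: (le_lt_trans (hG x)); exact: ltry.
Qed.

Lemma gamma_intD f g x : Bb f -> Bb g ->
  gamma_int k (fun y => f y + g y) x = gamma_int k f x + gamma_int k g x.
Proof. by move=> bf bg; apply: RintegralD => //; exact: finite_kernel_integrable. Qed.

Lemma gamma_intB f g x : Bb f -> Bb g ->
  gamma_int k (fun y => f y - g y) x = gamma_int k f x - gamma_int k g x.
Proof. by move=> bf bg; apply: RintegralB => //; exact: finite_kernel_integrable. Qed.

Lemma gamma_intZ c f x : Bb f ->
  gamma_int k (fun y => c * f y) x = c * gamma_int k f x.
Proof. by move=> bf; apply: RintegralZl => //; exact: finite_kernel_integrable. Qed.

Definition off x nu f : R := \int[nu]_(y in ~` [set x]) f y.

Lemma ge0_gammaE x (f : borel E -> \bar R) : (forall y, 0 <= f y)%E ->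
  measurable_fun setT f ->
  (\int[br_gamma k x]_y f y = \int[br_eta k x]_y f y +
   \int[br_H k x]_(nu in F0) \int[nu : fmeas E]_(y in ~` [set x]) f y)%E.
Proof.
move=> f0 mf.
have mx : measurable (~` [set x] : set (borel E)).
  by apply: measurableC; exact: measurable_borel_set1.
rewrite (@integral_mixture _ _ _ _ _ (br_eta k x) (br_gamma k x) (br_H k x) F0
  (fun nu => mrestr (nu : fmeas E) mx) f)//.
- by congr (_ + _)%E; apply: eq_integral => nu _; rewrite ge0_integral_mrestr.
- exact: measurable_fmeas0.
- by move=> U mU; rewrite /mrestr; apply: measurable_fmeas; exact: measurableI.
- by move=> U mU; rewrite br_gammaP.
Qed.

(** Since [nu f] is [off x nu f] plus the contribution of [x], the jump integrand is
    [phi (nu f) - off x nu f]. The first term is dominated by [jump_mass] and the second by the mass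
    off [x], so each is integrable on its own and the second can be moved into [gamma]. *)
Lemma psiE f x : Bbplus f ->
  psi k f x = br_a k x * f x - gamma_int k f x + rho f x.
Proof.
move=> bf; have [C C0 fC] := BbplusP bf.
have mF := measurable_fmeas0.
have mx1 := measurable_borel_set1 x.
have mx : measurable (~` [set x] : set (borel E)) by exact: measurableC.
have foff nu : nu.-integrable (~` [set x]) (EFin \o f).
  by apply: integrableS (fmeas_integrable nu bf.1).
have offE nu : (off x nu f)%:E = (\int[nu]_(y in ~` [set x]) (f y)%:E)%E.
  by rewrite /off (EFin_Rintegral mx (foff nu)).
have off0 nu : 0 <= off x nu f by apply: Rintegral_ge0 => y _; exact: Bbplus_ge0.
have moff : measurable_fun setT (fun nu : borel (fmeas E) => off x nu f).
  rewrite (_ : (fun nu => _) = fun nu : borel (fmeas E) => \int[nu : fmeas E]_y (f \_ (~` [set x])) y).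
    apply: measurable_fmeas_Rintegral; apply: (@BbplusI _ _ _ C).
      by apply/(measurable_restrictT _ _).1 => //; apply: measurable_funTS; exact: bf.1.1.
    by move=> y; rewrite patchE; case: ifP => _; [exact: fC|rewrite lexx].
  by apply/funext => nu; rewrite /off Rintegral_mkcond.
have ioff : (br_H k x).-integrable F0 (EFin \o (fun nu => off x nu f)).
  have [B B0 hB] := jump_bound.
  apply/integrableP; split; first by apply/measurable_EFinP; exact: measurable_funTS.
  apply: (@le_lt_trans _ _ (C%:E * \int[br_H k x]_(nu in F0) (nu : fmeas E) (~` [set x]))%E).
    rewrite -ge0_integralZl//; last exact: measurable_funTS (measurable_mass_off x).
    apply: ge0_le_integral => //.
    - apply: measurableT_comp => //; apply/measurable_EFinP; exact: measurable_funTS.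
    - by apply: measurable_funeM; exact: measurable_funTS (measurable_mass_off x).
    move=> nu _ /=; rewrite ger0_norm// offE -integral_cst//.
    apply: ge0_le_integral => //.
    - by move=> y _; rewrite lee_fin Bbplus_ge0.
    - by apply/measurable_EFinP; apply: measurable_funTS; exact: bf.1.1.
    - by move=> y _; rewrite lee_fin; case/andP: (fC y).
  apply: (@le_lt_trans _ _ (C%:E * B%:E)%E); last by rewrite -EFinM ltry.
  by rewrite lee_wpmul2l ?lee_fin//; exact: (hB x).2.
have gE : gamma_int k f x = \int[br_eta k x]_y f y +
    \int[br_H k x]_(nu in F0) off x nu f.
  rewrite /gamma_int {1}/Rintegral ge0_gammaE; last 2 first.
  - by move=> y; rewrite lee_fin Bbplus_ge0.
  - by apply/measurable_EFinP; exact: bf.1.1.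
  rewrite fineD; last 2 first.
  - by apply: integrable_fin_num => //; apply: finite_kernel_integrable; exact: bf.1.
  - under eq_integral do rewrite -offE.
    exact: integrable_fin_num.
  congr (_ + _); rewrite /Rintegral; congr fine.
  by apply: eq_integral => nu _; rewrite offE.
have splitE nu : \int[nu]_y f y = off x nu f + fine (nu [set x]) * f x.
  have fi := fmeas_integrable nu bf.1.
  rewrite -(setvU [set x]) Rintegral_setU//; last 2 first.
  - by rewrite setvU.
  - by apply/disj_setPS => y [].
  congr (_ + _); rewrite (@eq_Rintegral _ _ _ _ _ (cst (f x))).
    by rewrite Rintegral_cst// mulrC.
  by move=> y /set_mem ->.
rewrite /psi /rho gE.
have -> : \int[br_H k x]_(nu in F0) (expR (- \int[nu]_y f y) - 1 +
    fine (nu [set x]) * f x) =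
    \int[br_H k x]_(nu in F0) phi (\int[nu]_y f y) -
    \int[br_H k x]_(nu in F0) off x nu f.
  rewrite -RintegralB//; last exact: phi_jump_integrable.
  apply: eq_Rintegral => nu _; rewrite /phi.
  by rewrite [X in _ = _ - 1 + X - _]splitE; lra.
lra.
Qed.

End branching_mechanism.

(** * Joint measurability in time and space *)

Section joint_measurability.
Context (R : realType) (E : pmetricType R) (k : branching E).
Implicit Types (v : R -> E -> R) (t : R).

(** Cutting off outside [[0, t]] yields a function that is measurable and bounded everywhere, as
    integration against kernels requires, while its sections at the times of interest are
    unchanged. *)
Lemma jbounded_ext t v : 0 <= t -> jbounded t v ->
  (forall s y, 0 <= s <= t -> 0 <= v s y) ->
  exists v', exists2 C, 0 <= C &
    [/\ measurable_fun setT (fun z : R * borel E => v' z.1 z.2),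
        forall s y, 0 <= v' s y <= C
      & forall s, 0 <= s <= t -> v' s = v s].
Proof.
move=> t0 [mv [C vC]] v0.
pose S : set (R * borel E) := [set z : R * borel E | 0 <= z.1 <= t].
pose g := (fun z : R * borel E => v z.1 z.2) \_ S.
exists (fun s y => g (s, y)), `|C| => //; split.
- rewrite (_ : (fun z => _) = g); last by apply/funext => -[].
  by apply/(measurable_restrictT _ _).1 => //; exact: measurable_time_slab.
- move=> s y; rewrite /g patchE; case: ifPn => [/set_mem /= st|_]; last by rewrite lexx normr_ge0.
  rewrite v0//=; apply: (le_trans (ler_norm _)); apply: (le_trans (vC _ _ st)).
  exact: ler_norm.
- by move=> s st; apply/funext => y; rewrite /g patchE mem_set.
Qed.

Lemma jmeasurable_section v s :
  measurable_fun setT (fun z : R * borel E => v z.1 z.2) -> Borel_fun (v s).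
Proof.
move=> mv; exact: (measurableT_comp mv (measurable_fun_pair
  (@measurable_cst _ _ (borel E) R setT s) (@measurable_id _ (borel E) setT))).
Qed.

Lemma jbounded_eq t v v' : (forall s y, 0 <= s <= t -> v s y = v' s y) ->
  jbounded t v -> jbounded t v'.
Proof.
move=> e [mv [C vC]]; split.
  by apply: eq_measurable_fun mv => -[s y] /set_mem /= st; exact: e.
by exists C => s y st; rewrite -e// vC.
Qed.

Lemma jbounded_Bbplus t v s : jbounded t v -> 
  (forall s y, 0 <= s <= t -> 0 <= v s y) -> 0 <= s <= t -> Bbplus (v s).
Proof.
move=> jv v0 st; have t0 : 0 <= t by case/andP: st; exact: le_trans.
have [v' [C C0 [mv' v'C <-//]]] := jbounded_ext t0 jv v0.
apply: (@BbplusI _ _ _ C) => //.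
exact: jmeasurable_section mv'.
Qed.

Lemma jbounded_rev t v : jbounded t v -> jbounded t (fun s => v (t - s)).
Proof.
move=> [mv [C vC]]; split; last by exists C => s y st; apply: vC; lra.
apply: (@measurable_comp _ _ _ _ _ _ [set z : R * borel E | 0 <= z.1 <= t]
  (fun z : R * borel E => v z.1 z.2) _ (fun z : R * borel E => (t - z.1, z.2))) => //.
- exact: measurable_time_slab.
- by move=> _ [[s y] /= st <-] /=; lra.
- apply: measurable_funTS; apply: measurable_fun_pair; last exact: measurable_snd.
  by apply: measurable_funB => //; exact: measurable_fst.
Qed.

Lemma jbounded_gamma t v : 0 <= t -> jbounded t v ->
  (forall s y, 0 <= s <= t -> 0 <= v s y) ->
  jbounded t (fun s => gamma_int k (v s)).
Proof.
move=> t0 jv v0; have [v' [C C0 [mv' v'C v'E]]] := jbounded_ext t0 jv v0.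
apply: (@jbounded_eq _ (fun s => gamma_int k (v' s))).
  by move=> s y st; rewrite v'E.
have [G G0 hG] := gamma_int_bound k.
split; last first.
  exists (G * C) => s y _; apply: hG => //; last first.
    by move=> z; case/andP: (v'C s z) => h ?; rewrite ger0_norm.
  apply: (@BbI _ _ _ C); last by move=> z; case/andP: (v'C s z) => h ?; rewrite ger0_norm.
  exact: jmeasurable_section mv'.
apply: measurable_funTS; apply: measurableT_comp (fine_measurable _) _ => //.
apply: (@measurable_fun_integral_in _ _ (R * borel E)%type (borel E) R
  (fun z => br_gamma k z.2) setT _ _ _ (fun u => (v' u.1.1 u.2)%:E)) => //.
- by move=> U mU; apply: measurableT_comp (measurable_kernel (br_gamma k) _ mU) _.
- move=> z; have [D D0 hD] := finite_kernel_bound (br_gamma k).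
  by apply: (le_lt_trans (hD _)); exact: ltry.
- by move=> u; rewrite lee_fin; case/andP: (v'C u.1.1 u.2).
- apply/measurable_EFinP.
  apply: (measurableT_comp mv' (g := fun u : R * borel E * borel E => (u.1.1, u.2))).
  apply: measurable_fun_pair => //.
  exact: (measurableT_comp measurable_fst measurable_fst).
Qed.

(** The kernel [H x] may have infinite mass near the zero measure. The sets [D_ n] of total mass
    above 1/(n+1) exhaust the nonzero measures and have finite [H x] mass, since [jump_mass] is at
    least 1/(n+1)^2 there. The jump part of [rho] is the monotone limit of the integrals over
    them. *)
Lemma jbounded_rho t v : 0 <= t -> jbounded t v ->
  (forall s y, 0 <= s <= t -> 0 <= v s y) ->
  jbounded t (fun s => rho k (v s)).
Proof.
move=> t0 jv v0; have [v' [C C0 [mv' v'C v'E]]] := jbounded_ext t0 jv v0.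
apply: (@jbounded_eq _ (fun s => rho k (v' s))).
  by move=> s y st; rewrite v'E.
have bv s : Bbplus (v' s).
  apply: (@BbplusI _ _ _ C) => //.
  exact: jmeasurable_section mv'.
have [D D0 hD] := rho_bound k C0.
split; last first.
  exists D => s y _; rewrite ger0_norm ?rho_ge0//; apply: hD => // z.
  by case/andP: (v'C s z).
apply: measurable_funTS; apply: measurable_funD.
  apply: measurable_funM; last exact: measurable_funX.
  by apply: measurableT_comp => //; case: (br_bP k) => -[].
apply: measurableT_comp (fine_measurable _) _ => //.
pose Phi (u : R * borel (fmeas E)) : R := phi (\int[u.2 : fmeas E]_y v' u.1 y).
have mPhi : measurable_fun setT Phi.
  apply: measurableT_comp measurable_phi _.
  apply: measurableT_comp (fine_measurable _) _ => //.
  apply: (@measurable_fmeas_integral_param _ _ _ R (fun z => (v' z.1 z.2)%:E)).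
    by move=> z; rewrite lee_fin; case/andP: (v'C z.1 z.2).
  exact/measurable_EFinP.
pose D_ (n : nat) : set (borel (fmeas E)) := [set nu | n.+1%:R^-1 < total nu].
have mD n : measurable (D_ n).
  rewrite (_ : D_ n = (@total R E : borel (fmeas E) -> R) @^-1` `]n.+1%:R^-1, +oo[%classic).
    rewrite -[X in measurable X]setTI; by apply: measurable_total => //; exact: measurable_itv.
  by apply/seteqP; split => nu /=; rewrite in_itv/= andbT.
have D0E : @fmeas0 R E = \bigcup_n D_ n.
  apply/seteqP; split => nu; rewrite /fmeas0 /= -totalE eqe => h.
    have tp : 0 < total nu by rewrite lt_neqAle eq_sym h total_ge0.
    exists (Num.truncn (total nu)^-1) => //; rewrite /D_ /=.
    by rewrite invf_plt ?posrE ?ltr0n ?truncnS_gt.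
  by case: h => n _ /= hn; rewrite gt_eqF// (lt_trans _ hn)// invr_gt0.
apply: (@emeasurable_fun_cvg _ _ _ _ (fun n (z : R * borel E) =>
    \int[br_H k z.2]_(nu in D_ n) (Phi (z.1, nu))%:E)%E).
  move=> n; apply: (@measurable_fun_integral_in _ _ (R * borel E)%type (borel (fmeas E)) R
    (fun z => br_H k z.2) (D_ n) _ _ _ (fun u => (Phi (u.1.1, u.2))%:E)) => //.
  - by move=> U mU; apply: measurableT_comp (measurable_kernel (br_H k) _ mU) _.
  - move=> [s x] /=; have [B B0 hB] := jump_bound k.
    have n0 : 0 < n.+1%:R^-1 :> R by rewrite invr_gt0.
    have n2 : 0 < (n.+1%:R^-1 : R) ^+ 2 by rewrite exprn_gt0.
    have : ((n.+1%:R^-1 ^+ 2)%:E * br_H k x (D_ n) <= B%:E)%E.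
      rewrite -integral_cst//; apply: le_trans (hB x).1.
      apply: (@le_trans _ _ (\int[br_H k x]_(nu in D_ n) (jump_mass nu)%:E)%E).
        apply: ge0_le_integral => //.
        - by move=> nu _; rewrite lee_fin ltW.
        - by apply/measurable_EFinP; apply: measurable_funTS; exact: measurable_jump_mass.
        move=> nu hn0; have hn : n.+1%:R^-1 < total nu := hn0.
        rewrite lee_fin le_min.
        have n1 : n.+1%:R^-1 <= 1 :> R by rewrite invf_le1// ler1n.
        apply/andP; split; last by rewrite ler_sqr ?nnegrE ?total_ge0 ?(ltW n0)// ltW.
        by apply: le_trans (ltW hn); rewrite expr2 ler_piMr// ltW.
      apply: ge0_subset_integral => //.
      - exact: measurable_fmeas0.
      - by apply/measurable_EFinP; apply: measurable_funTS; exact: measurable_jump_mass.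
      - by move=> nu _; rewrite lee_fin jump_mass_ge0.
      - by rewrite D0E; exact: bigcup_sup.
    case: (br_H k x (D_ n)) => [a _|h|//]; first exact: ltry.
    by rewrite gt0_muley ?lte_fin// in h.
  - by move=> u; rewrite lee_fin phi_ge0.
  - apply/measurable_EFinP.
    apply: (measurableT_comp mPhi (g := fun u : R * borel E * borel (fmeas E) => (u.1.1, u.2))).
    apply: measurable_fun_pair => //.
    exact: (measurableT_comp measurable_fst measurable_fst).
move=> [s x] _ /=; rewrite D0E.
apply: ge0_nondecreasing_set_cvg_integral => //.
- apply/nondecreasing_seqP => n; rewrite subsetEset => nu /=.
  by apply: le_lt_trans; rewrite lef_pV2 ?posrE// ler_nat.
- move=> n; apply/measurable_EFinP; apply: measurable_funTS.
  by apply: (measurableT_comp mPhi); exact: measurable_fun_pair.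
- by move=> n nu _; rewrite lee_fin phi_ge0.
Qed.

End joint_measurability.

Section image_measure.
Context d1 d2 (T1 : measurableType d1) (T2 : measurableType d2) (R : realType).
Variables (m : {measure set T1 -> \bar R}) (f : T1 -> T2).
Hypothesis mf : measurable_fun setT f.

Definition image_measure : {measure set T2 -> \bar R} :=
  measure_function_pushforward__canonical__measure_function_Measure m mf.

Lemma image_measureE A : image_measure A = m (f @^-1` A).
Proof. by []. Qed.

Lemma ge0_integral_image (g : T2 -> \bar R) : (forall y, 0 <= g y)%E ->
  measurable_fun setT g -> (\int[image_measure]_y g y = \int[m]_x g (f x))%E.
Proof.
move=> g0 mg; rewrite (_ : (\int[m]_x g (f x) = \int[m]_(x in f @^-1` setT) (g \o f) x)%E)//.
by rewrite -ge0_integral_pushforward.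
Qed.
End image_measure.

Section dyad_limits.
Context (R : realType).

Lemma cvg_dyad : @dyad R n @[n --> \oo] --> 0.
Proof.
rewrite (_ : @dyad R = fun n => 2^-1 ^+ n); last by apply/funext => n; rewrite /dyad exprVn.
by apply: cvg_expr; rewrite ger0_norm ?invr_ge0//; lra.
Qed.

Lemma phi_scaled_cvg (z_ th : nat -> R) D : (forall n, 0 < th n) ->
  th n @[n --> \oo] --> 0 -> (forall n, 0 <= z_ n <= D) ->
  phi (th n * z_ n) / th n @[n --> \oo] --> 0.
Proof.
move=> th0 cth zD.
have D0 : 0 <= D by have := zD 0%N; lra.
apply: (@squeeze_cvgr _ _ _ _ (fun=> 0) (fun n => th n * D ^+ 2)).
- apply: nearW => n; have tn := th0 n; have /andP[z0 zn] := zD n.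
  rewrite divr_ge0 ?phi_ge0 ?(ltW tn)//= ler_pdivrMr//.
  apply: (le_trans (phi_le_sqr _)); first by rewrite mulr_ge0// ltW.
  have : z_ n ^+ 2 <= D ^+ 2 by rewrite ler_sqr ?nnegrE.
  move=> h; have -> : th n * D ^+ 2 * th n = th n ^+ 2 * D ^+ 2 by ring.
  by rewrite exprMn ler_wpM2l ?sqr_ge0.
- exact: cvg_cst.
- rewrite -[X in _ --> X](mul0r (D ^+ 2)); apply: cvgM => //; exact: cvg_cst.
Qed.

End dyad_limits.

Section jbounded_solutions.
Context (R : realType) (E : pmetricType R).

Lemma jointly_jbounded (v : R -> E -> R) t : 0 <= t ->
  jointly_Borel v -> locally_bounded v -> jbounded t v.
Proof.
move=> t0 mv bv; split.
  apply: measurable_funS mv.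
    rewrite (_ : [set z | _] = `[0, +oo[%classic `*` setT); first exact: measurableX.
    by apply/seteqP; split => z /=; rewrite in_itv/= andbT; [split|case].
  by move=> z /= /andP[].
have [|C hC] := bv (t + 1); first by lra.
by exists C => s x st; apply: hC; lra.
Qed.
End jbounded_solutions.

Section semigroup_bounds.
Context (R : realType) (E : pmetricType R) (dO : measure_display)
  (O : measurableType dO) (X : hunt_process E O).

Lemma measurable_ext0_xi (f : E -> R) t : 0 <= t -> Bb f ->
  measurable_fun setT (fun w => ext0 f (xi X t w)).
Proof.
move=> t0 bf.
have mS : measurable (setT `*` `[0, t]%classic : set (O * R)) by exact: measurableX.
have ma := measurable_along X (jbounded_Bb t bf).
have mr := (measurable_restrictT _ mS).1 ma.
have mp : measurable_fun setT (fun w : O => (w, t)) by exact: measurable_fun_pair.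
have := measurableT_comp mr mp; apply: eq_measurable_fun => w _ /=.
by rewrite patchE mem_set//; split => //=; rewrite in_itv/= t0 lexx.
Qed.

Lemma ext0_bound (f : E -> R) C y : 0 <= C -> (forall x, `|f x| <= C) -> `|ext0 f y| <= C.
Proof. by case: y => [x|] //= C0 _; rewrite normr0. Qed.

Lemma semigroup_le (f : E -> R) C t x : 0 <= t -> 0 <= C -> Bb f ->
  (forall y, f y <= C) -> semigroup X t f x <= C.
Proof.
move=> t0 C0 bf fC; have [D D0 fD] := BbP bf.
have P1 : (Pi X (Some x) setT < +oo)%E by rewrite probability_setT ltry.
apply: (@le_trans _ _ (\int[Pi X (Some x)]_w C)); last first.
  by rewrite Rintegral_cst// [X in fine X]probability_setT mulr1.
apply: le_Rintegral => //.
- apply: (@bdd_integrable _ _ _ _ _ _ P1 _ D) => //; first exact: measurable_ext0_xi.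
  by move=> w _; exact: ext0_bound.
- by apply: (@bdd_integrable _ _ _ _ _ _ P1 (cst C) `|C|).
- by move=> w _; rewrite /ext0; case: (xi X t w).
Qed.

Lemma semigroup_ge0 (f : E -> R) t x : (forall y, 0 <= f y) -> 0 <= semigroup X t f x.
Proof. by move=> f0; apply: Rintegral_ge0 => w _; rewrite /ext0; case: (xi X t w). Qed.

Lemma semigroupZ (f : E -> R) c t x : 0 <= t -> Bb f ->
  semigroup X t (fun y => c * f y) x = c * semigroup X t f x.
Proof.
move=> t0 bf; have [D D0 fD] := BbP bf.
have P1 : (Pi X (Some x) setT < +oo)%E by rewrite probability_setT ltry.
rewrite /semigroup -RintegralZl//; last first.
  apply: (@bdd_integrable _ _ _ _ _ _ P1 _ D) => //; first exact: measurable_ext0_xi.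
  by move=> w _; exact: ext0_bound.
by apply: eq_Rintegral => w _; rewrite /ext0; case: (xi X t w) => //=; rewrite mulr0.
Qed.

End semigroup_bounds.

Section fmeas_linear.
Context (R : realType) (E : pmetricType R).
Implicit Types (nu : fmeas E) (f g : E -> R).

Lemma fmeas_RintegralZ nu c f : Bb f ->
  \int[nu]_y (c * f y) = c * \int[nu]_y f y.
Proof. by move=> bf; rewrite RintegralZl//; exact: fmeas_integrable. Qed.

Lemma fmeas_RintegralD nu f g : Bb f -> Bb g ->
  \int[nu]_y (f y + g y) = \int[nu]_y f y + \int[nu]_y g y.
Proof. by move=> bf bg; rewrite RintegralD//; exact: fmeas_integrable. Qed.

Lemma fmeas_RintegralB nu f g : Bb f -> Bb g ->
  \int[nu]_y (f y - g y) = \int[nu]_y f y - \int[nu]_y g y.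
Proof. by move=> bf bg; rewrite RintegralB//; exact: fmeas_integrable. Qed.

Lemma fmeas_le_Rintegral nu f g : Bb f -> Bb g -> (forall y, f y <= g y) ->
  \int[nu]_y f y <= \int[nu]_y g y.
Proof. by move=> bf bg fg; apply: le_Rintegral => //; exact: fmeas_integrable. Qed.
End fmeas_linear.

(** * Scaling limits of the superlinear part *)

Section rho_limits.
Context (R : realType) (E : pmetricType R) (k : branching E).

(** Dominating constant for the linearisation of the cumulant equation: [phi (th * z) <= th * phi z]
    and [th <= 1] make the quotient no larger than [rho k g x]. *)
Lemma rho_scaled (D : R) : 0 <= D -> exists2 B, 0 <= B & forall th (g : E -> R) x,
  0 < th <= 1 -> Bbplus g -> (forall y, g y <= D) ->
  rho k (fun y => th * g y) x / th <= B.
Proof.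
move=> D0; have [B B0 hB] := rho_bound k D0; exists B => // th g x /andP[t0 t1] bg gD.
apply: le_trans (hB g x bg gD); rewrite ler_pdivrMr// /rho mulrDl lerD//.
  have := sqr_ge0 (g x); case: (br_bP k) => _ [_ /(_ x)] b0 g2.
  have -> : br_b k x * (th * g x) ^+ 2 = br_b k x * g x ^+ 2 * th ^+ 2 by ring.
  by apply: ler_wpM2l; [exact: mulr_ge0|rewrite expr2 ler_piMl// ltW].
rewrite -RintegralZr; last 2 first.
- exact: measurable_fmeas0.
- exact: phi_jump_integrable.
apply: le_Rintegral.
- exact: measurable_fmeas0.
- by apply: phi_jump_integrable; apply: BbplusM => //; exact: ltW.
- have := phi_jump_integrable k x bg.
  move=> /(integrableZl (@measurable_fmeas0 R E) th).
  apply: eq_integrable => [|nu _ /=]; first exact: measurable_fmeas0.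
  by rewrite EFinM muleC.
move=> nu _; rewrite (fmeas_RintegralZ _ _ bg.1).
have z0 : 0 <= \int[nu]_y g y by apply: Rintegral_ge0 => y _; exact: Bbplus_ge0.
set z := Rintegral _ _ _ in z0 *.
(* convexity of [phi], which vanishes at 0: compare with the tangent at [th * z] *)
rewrite /phi; have h1 := expR_ge1Dx (- (z - th * z)); have h2 := expR_ge1Dx (th * z).
have e1 : expR (- z) = expR (- (th * z)) * expR (- (z - th * z)).
  by rewrite -expRD; congr expR; lra.
have e2 := expRxMexpNx_1 (th * z).
have e0 := expR_gt0 (- (th * z)).
have h3 : expR (- (th * z)) * (1 - (z - th * z)) <= expR (- z).
  by rewrite e1 ler_wpM2l// ltW.
have h4 : expR (- (th * z)) * (1 + th * z) <= 1.
  by rewrite -[leRHS]e2 mulrC ler_wpM2r// ltW.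
have h5 : th * (expR (- (th * z)) * (1 - (z - th * z))) <= th * expR (- z).
  by rewrite ler_wpM2l// ltW.
have h6 : (1 - th) * (expR (- (th * z)) * (1 + th * z)) <= (1 - th) * 1.
  by rewrite ler_wpM2l// subr_ge0.
have e3 : th * (expR (- (th * z)) * (1 - (z - th * z))) +
  (1 - th) * (expR (- (th * z)) * (1 + th * z)) = expR (- (th * z)) by ring.
lra.
Qed.

(** As [dyad n <= 1], the quotient [phi (dyad n * z) / dyad n] is at most [z] and at most [z ^+ 2].
    Once [g_ n] is replaced by [D], a multiple of [jump_mass] therefore dominates uniformly in
    [n]. *)
Lemma rho_scaled_cvg (D : R) (g_ : nat -> E -> R) x :
  (forall n, Bbplus (g_ n)) -> (forall n y, g_ n y <= D) ->
  rho k (fun y => dyad n * g_ n y) x / dyad n @[n --> \oo] --> 0.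
Proof.
move=> bg gD.
have D0 : 0 <= D by apply: le_trans (gD 0%N point); exact: Bbplus_ge0.
have bD : Bbplus (cst D : E -> R) by exact: Bbplus_cst.
have d0 n := dyad_gt0 (R := R) n.
pose J n := \int[br_H k x]_(nu in @fmeas0 R E) (phi (dyad n * (D * total nu)) / dyad n).
have tE (nu : fmeas E) : D * total nu = \int[nu]_y (cst D) y.
  by rewrite Rintegral_cst.
have iphi n c : (br_H k x).-integrable (@fmeas0 R E : set (borel (fmeas E)))
    (EFin \o (fun nu => phi (dyad n * (D * total nu)) * c)).
  have h : Bbplus (fun y : E => dyad n * cst D y) by apply: BbplusM => //; exact: ltW.
  have := phi_jump_integrable k x h.
  move=> /(integrableZl (@measurable_fmeas0 R E) c).
  apply: eq_integrable => [|nu _ /=]; first exact: measurable_fmeas0.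
  rewrite tE -EFinM mulrC; congr ((phi _ * _)%:E).
  by rewrite RintegralZl//; exact: (fmeas_integrable nu bD.1).
have J0 : J n @[n --> \oo] --> 0.
  have -> : (0 : R) = \int[br_H k x]_(nu in @fmeas0 R E) (cst 0 nu).
    rewrite /Rintegral integral0_eq//.
  apply: (@Rintegral_dominated_cvg _ _ _ (br_H k x) (@fmeas0 R E : set (borel (fmeas E)))
    _ _ (cst 0) (fun nu => (D + D ^+ 2) * jump_mass nu)).
  - exact: measurable_fmeas0.
  - move=> n; have := measurable_int _ (iphi n (dyad n)^-1).
    by move=> /measurable_EFinP.
  - move=> nu _; apply: (@phi_scaled_cvg _ (fun=> D * total nu) _ (D * total nu)) => //.
      exact: cvg_dyad.
    by move=> n; rewrite mulr_ge0 ?total_ge0/=.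
  - exact: jump_mass_integrable.
  - move=> n nu _; have t0 := total_ge0 nu.
    have z0 : 0 <= D * total nu by rewrite mulr_ge0.
    have dz0 : 0 <= dyad n * (D * total nu) by rewrite mulr_ge0// ltW.
    rewrite ger0_norm; last by rewrite divr_ge0 ?phi_ge0// ltW.
    have h1 : phi (dyad n * (D * total nu)) / dyad n <= D * total nu.
      by rewrite ler_pdivrMr// [leRHS]mulrC phi_le.
    have h2 : phi (dyad n * (D * total nu)) / dyad n <= (D * total nu) ^+ 2.
      rewrite ler_pdivrMr//; apply: (le_trans (phi_le_sqr dz0)).
      rewrite exprMn mulrC ler_wpM2l ?sqr_ge0// expr2 ler_piMl ?dyad_le1//.
      exact: ltW.
    rewrite exprMn in h2.
    have C2 := sqr_ge0 D; have T2 := sqr_ge0 (total nu).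
    rewrite /jump_mass /Num.min; case: ifP => _; nra.
have [b b0 hb] := BbplusP (br_bP k).
apply: (@squeeze_cvgr _ _ _ _ (fun=> 0) (fun n => dyad n * (b * D ^+ 2) + J n)).
- apply: nearW => n; rewrite divr_ge0 ?rho_ge0 ?(ltW (d0 n))//=.
  rewrite /rho mulrDl lerD//.
    rewrite ler_pdivrMr// exprMn.
    have -> : dyad n * (b * D ^+ 2) * dyad n = dyad n ^+ 2 * (b * D ^+ 2) by rewrite mulrAC -expr2.
    rewrite mulrCA ler_wpM2l ?sqr_ge0//; apply: ler_pM; rewrite ?sqr_ge0//.
    + by case/andP: (hb x).
    + by case/andP: (hb x).
    + by rewrite ler_sqr ?nnegrE ?Bbplus_ge0.
  have h : Bbplus (fun y : E => dyad n * g_ n y) by apply: BbplusM => //; exact: ltW.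
  rewrite -RintegralZr; last 2 first.
  - exact: measurable_fmeas0.
  - exact: phi_jump_integrable.
  apply: le_Rintegral.
  - exact: measurable_fmeas0.
  - have := phi_jump_integrable k x h.
    move=> /(integrableZl (@measurable_fmeas0 R E) (dyad n)^-1).
    apply: eq_integrable => [|nu _ /=]; first exact: measurable_fmeas0.
    by rewrite EFinM muleC.
  - exact: iphi.
  move=> nu _; rewrite ler_wpM2r ?invr_ge0 ?(ltW (d0 n))//.
  apply: ler_phi; rewrite (fmeas_RintegralZ _ _ (bg n).1).
  apply/andP; split.
    by rewrite mulr_ge0 ?(ltW (d0 n))//; apply: Rintegral_ge0 => y _; exact: Bbplus_ge0.
  rewrite ler_wpM2l ?(ltW (d0 n))//.
  by apply: fmeas_Rintegral_le; [exact: (bg n).1|exact: gD].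
- exact: cvg_cst.
- rewrite -[X in _ --> X]addr0; apply: cvgD => //.
  rewrite -[X in _ --> X](mul0r (b * D ^+ 2)); apply: cvgM; first exact: cvg_dyad.
  exact: cvg_cst.
Qed.

End rho_limits.

(** * Cumulant and mean semigroups of the superprocess *)

Section probability_total.
Context d (T : measurableType d) (R : realType) (Q : probability T R).

Lemma probability_ltry : (Q setT < +oo)%E.
Proof. by rewrite probability_setT ltry. Qed.

Lemma Rintegral_probability_cst (c : R) : \int[Q]_w c = c.
Proof. by rewrite Rintegral_cst// [X in fine X]probability_setT mulr1. Qed.

Lemma probability_bdd_integrable (f : T -> R) C : measurable_fun setT f ->
  (forall w, `|f w| <= C) -> Q.-integrable setT (EFin \o f).
Proof.
move=> mf fC; apply: (@bdd_integrable _ _ _ _ _ _ _ _ C) => //.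
exact: probability_ltry.
Qed.
End probability_total.

Section superprocess_moments.
Context (R : realType) (E : pmetricType R) (dO : measure_display)
  (O : measurableType dO) (X : hunt_process E O) (k : branching E).
Variables (V : R -> (E -> R) -> E -> R) (V_def : cumulant_semigroup k X V).
Variables (P : borel (fmeas E) -> probability (path_space E) R)
  (P_def : superprocess V P).
Implicit Types (f g : E -> R) (t s : R) (x : E) (mu nu : fmeas E).

Definition dirac_fmeas x : fmeas E := dirac (x : borel E).

Lemma Rintegral_dirac_fmeas f x : Bb f -> \int[dirac_fmeas x]_y f y = f x.
Proof.
move=> bf; rewrite /Rintegral integral_dirac//; last by apply/measurable_EFinP; exact: bf.1.
by rewrite diracT mul1e.
Qed.

Lemma jbounded_a t v : jbounded t v -> jbounded t (fun s y => br_a k y * v s y).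
Proof. by apply: jboundedM; apply: jbounded_Bb; exact: br_aP. Qed.

Lemma V_ge0 f t x : Bbplus f -> 0 <= t -> 0 <= V t f x.
Proof. by move=> bf t0; have [[_ _ h _] _] := V_def bf; exact: h. Qed.

Lemma V_jbounded f t : Bbplus f -> 0 <= t -> jbounded t (fun s => V s f).
Proof. by move=> bf t0; have [[h1 h2 _ _] _] := V_def bf; exact: jointly_jbounded. Qed.

Lemma V_Bbplus f t : Bbplus f -> 0 <= t -> Bbplus (V t f).
Proof.
move=> bf t0; apply: (@jbounded_Bbplus _ _ t _ t (V_jbounded bf t0)); last by lra.
by move=> s y /andP[s0 _]; exact: V_ge0.
Qed.

Lemma V_eq f t x : Bbplus f -> 0 <= t -> V t f x = semigroup X t f x -
  occupation X t (fun s y => br_a k y * V (t - s) f y -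
    gamma_int k (V (t - s) f) y + rho k (V (t - s) f) y) x.
Proof.
move=> bf t0; have [[_ _ _ h] _] := V_def bf.
transitivity (semigroup X t f x - occupation X t (fun s => psi k (V (t - s) f)) x).
  exact: h.
apply: (congr1 (fun z => semigroup X t f x - z)); apply: occupation_eq => s y st; apply: psiE.
by apply: V_Bbplus => //; lra.
Qed.

Lemma measurable_coordinate t : 0 <= t ->
  measurable_fun setT (coordinate t : path_space E -> borel (fmeas E)).
Proof.
move=> t0 _ B mB; rewrite setTI; apply: sub_sigma_algebra.
by exists t, B.
Qed.

Lemma measurable_mass f t : Bbplus f -> 0 <= t ->
  measurable_fun setT (mass f t : path_space E -> R).
Proof.
move=> bf t0.
exact: (measurableT_comp (measurable_fmeas_Rintegral bf) (measurable_coordinate t0)).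
Qed.

Lemma mass_ge0 f t (w : path_space E) : (forall y, 0 <= f y) -> 0 <= mass f t w.
Proof. by move=> f0; apply: Rintegral_ge0. Qed.

Lemma expR_mass_integrable mu c f t : Bbplus f -> 0 <= t -> 0 <= c ->
  (P mu).-integrable setT (EFin \o (fun w => expR (- (c * mass f t w)))).
Proof.
move=> bf t0 c0; apply: (@probability_bdd_integrable _ _ _ _ _ 1).
- apply: measurableT_comp => //; apply: measurableT_comp => //.
  by apply: measurable_funM => //; exact: measurable_mass.
- move=> w; rewrite ger0_norm ?expR_ge0// expR_le1 oppr_le0 mulr_ge0//.
  by apply: mass_ge0 => y; exact: Bbplus_ge0.
Qed.

Lemma mass_scale c f t (w : path_space E) : Bb f ->
  mass (fun y => c * f y) t w = c * mass f t w.
Proof. by move=> bf; exact: fmeas_RintegralZ. Qed.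

Lemma laplace mu c f t : Bbplus f -> 0 <= t -> 0 <= c ->
  \int[P mu]_w expR (- (c * mass f t w)) =
  expR (- \int[mu]_x V t (fun y => c * f y) x).
Proof.
move=> bf t0 c0; rewrite -(sp_laplace P_def)//; last exact: BbplusM.
by apply: eq_Rintegral => w _; rewrite mass_scale//; exact: bf.1.
Qed.

Lemma sigma_of_measurable s (A : set (path_space E)) :
  sigma_of [set r | 0 <= r <= s] (@coordinate R E) A -> measurable A.
Proof.
apply: (@sub_sigma_algebra2 _ setT) => _ [r [B [/= /andP[r0 _] mB ->]]].
by exists r, B.
Qed.

Lemma markov mu s t (A : set (path_space E)) (G : borel (fmeas E) -> \bar R) :
  0 <= s -> 0 <= t -> sigma_of [set r | 0 <= r <= s] (@coordinate R E) A ->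
  (forall nu, 0 <= G nu)%E -> measurable_fun setT G ->
  (\int[P mu]_(w in A) G (coordinate (s + t) w) =
   \int[P mu]_(w in A) \int[P (coordinate s w)]_u G (coordinate t u))%E.
Proof.
move=> s0 t0 sA G0 mG; have mA := sigma_of_measurable sA.
have st0 : 0 <= s + t by rewrite addr_ge0.
pose m1 := image_measure (mrestr (P mu) mA) (measurable_coordinate st0).
pose kap (w : path_space E) := image_measure (P (coordinate s w)) (measurable_coordinate t0).
have := @integral_mixture0 _ _ (path_space E) (borel (fmeas E)) R m1 (P mu) A kap G mA.
rewrite /m1 ge0_integral_image// ge0_integral_mrestr//; last first.
  exact: (measurableT_comp mG (measurable_coordinate st0)).
move=> ->//.
- by apply: eq_integral => w _; rewrite ge0_integral_image.
- move=> U mU; rewrite /kap.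
  have mC : measurable (coordinate t @^-1` U : set (path_space E)).
    by rewrite -[X in measurable X]setTI; exact: measurable_coordinate.
  exact: (measurableT_comp (sp_measurable P_def mC) (measurable_coordinate s0)).
- move=> U mU; rewrite image_measureE.
  transitivity (P mu (A `&` coordinate (s + t) @^-1` U)); last exact: (sp_markov P_def).
  exact: (congr1 (P mu) (setIC _ _)).
Qed.

(** The information up to time [s], packaged as a measurable type so that adapted events can be
    handled by the ordinary closure rules of measurability. *)
Definition past s := g_sigma_algebraType [set A : set (rpath E) | exists r B,
  [/\ [set r | 0 <= r <= s] r, measurable B & A = (@coordinate R E) r @^-1` B]].

Lemma sigma_ofT s : sigma_of [set r | 0 <= r <= s] (@coordinate R E) setT.
Proof. exact: (@measurableT _ (past s)). Qed.

Lemma markovT mu s t (G : borel (fmeas E) -> \bar R) :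
  0 <= s -> 0 <= t -> (forall nu, 0 <= G nu)%E -> measurable_fun setT G ->
  (\int[P mu]_w G (coordinate (s + t) w) =
   \int[P mu]_w \int[P (coordinate s w)]_u G (coordinate t u))%E.
Proof. by move=> s0 t0 G0 mG; apply: markov => //; exact: sigma_ofT. Qed.

(** Both sides are exponents of the same Laplace functional from a Dirac mass, computed directly at
    time [s + t] and through the Markov property at time [s]. *)
Lemma V_semigroup f s t x : Bbplus f -> 0 <= s -> 0 <= t ->
  V (s + t) f x = V s (V t f) x.
Proof.
move=> bf s0 t0; have st0 : 0 <= s + t by rewrite addr_ge0.
have bVt := V_Bbplus bf t0.
pose G (nu : borel (fmeas E)) : \bar R := (expR (- \int[nu : fmeas E]_y f y))%:E.
have mG : measurable_fun setT G.
  apply/measurable_EFinP; apply: measurableT_comp => //; apply: measurableT_comp => //.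
  exact: measurable_fmeas_Rintegral.
have G0 nu : (0 <= G nu)%E by rewrite lee_fin expR_ge0.
have := @markovT (dirac_fmeas x) s t G s0 t0 G0 mG.
have i1 mu g r : Bbplus g -> 0 <= r ->
    (\int[P mu]_w (expR (- mass g r w))%:E = (expR (- \int[mu]_y V r g y))%:E)%E.
  move=> bg r0; rewrite -(sp_laplace P_def)// EFin_Rintegral//.
  have := expR_mass_integrable mu bg r0 ler01.
  by apply: eq_integrable => // w _ /=; rewrite mul1r.
have e1 : (\int[P (dirac_fmeas x)]_w G (coordinate (s + t) w) =
    (expR (- \int[dirac_fmeas x]_y V (s + t) f y))%:E)%E.
  exact: (i1 (dirac_fmeas x) f (s + t) bf st0).
have e2 : (\int[P (dirac_fmeas x)]_w \int[P (coordinate s w)]_u G (coordinate t u) =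
    (expR (- \int[dirac_fmeas x]_y V s (V t f) y))%:E)%E.
  rewrite -(i1 _ _ _ bVt s0); apply: eq_integral => w _.
  exact: (i1 (coordinate s w) f t bf t0).
rewrite e1 e2 => -[] /expR_inj /oppr_inj.
rewrite !Rintegral_dirac_fmeas//.
  by have [] := V_Bbplus bVt s0.
by have [] := V_Bbplus bf st0.
Qed.

Lemma V_le_occupation f t x A G C D : Bbplus f -> 0 <= t -> 0 <= A -> 0 <= G ->
  0 <= C -> 0 <= D ->
  (forall y, `|br_a k y| <= A) ->
  (forall g B y, Bb g -> 0 <= B -> (forall z, `|g z| <= B) -> `|gamma_int k g y| <= G * B) ->
  (forall y, f y <= C) -> (forall s y, 0 <= s <= t -> V s f y <= D) ->
  V t f x <= C + t * ((A + G) * D).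
Proof.
move=> bf t0 A0 G0 C0 D0 aA gG fC VD; rewrite V_eq//.
have jV := jbounded_rev (V_jbounded bf t0).
have V0 s y : 0 <= s <= t -> 0 <= V (t - s) f y by move=> st; apply: V_ge0 => //; lra.
have ja := jbounded_a jV; have jg := jbounded_gamma k t0 jV V0.
have jr := jbounded_rho k t0 jV V0.
have jag := jboundedB ja jg.
have jagr := jboundedD jag jr.
have h1 : semigroup X t f x <= C by apply: semigroup_le => //; exact: bf.1.
have : occupation X t (fun s y => -1 * (br_a k y * V (t - s) f y -
    gamma_int k (V (t - s) f) y + rho k (V (t - s) f) y)) x <= t * ((A + G) * D).
  apply: occupation_ub => //; first by rewrite mulr_ge0// addr_ge0.
    exact: jboundedZ.
  move=> s y st; have st' : 0 <= t - s <= t by lra.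
  have v0 := V0 _ y st; have vD := VD _ y st'.
  have r0 := rho_ge0 k (V (t - s) f) y.
  have bV : Bb (V (t - s) f) by apply: (V_Bbplus bf _).1; lra.
  have hg : `|gamma_int k (V (t - s) f) y| <= G * D.
    apply: gG => // z; rewrite ger0_norm ?V0//; exact: VD.
  have ha : `|br_a k y * V (t - s) f y| <= A * D.
    by rewrite normrM ler_pM// ger0_norm.
  move: ha hg; rewrite !ler_norml => /andP[a1 a2] /andP[g1 g2]; lra.
rewrite occupationZ//; lra.
Qed.

(** Once [rho >= 0] is dropped the equation is linear, and for this [T] the supremum of [V] over
    [[0, T]] is at most [C] plus half of itself; local boundedness makes it finite, so it can be
    absorbed. [T] depends on [a] and [gamma] alone, and linearity in [C] is what later allows [f] to
    be replaced by [dyad n * f]. *)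
Lemma V_short_bound : exists2 T, 0 < T & forall f C t x, Bbplus f -> 0 <= C ->
  (forall y, f y <= C) -> 0 <= t <= T -> V t f x <= 2 * C.
Proof.
have [A A0 aA] := BbP (br_aP k); have [G G0 gG] := gamma_int_bound k.
exists (2 * (A + G + 1))^-1; first by rewrite invr_gt0; lra.
set T := _^-1; have T0 : 0 < T by rewrite invr_gt0; lra.
have TE : T * (2 * (A + G + 1)) = 1 by rewrite mulVf//; lra.
move=> f C t x bf C0 fC tT.
pose S := [set r | exists s y, 0 <= s <= T /\ r = V s f y].
have [_ [D0 hD0]] := V_jbounded bf (ltW T0).
have hS : has_sup S.
  split; first by exists (V 0 f x), 0, x; rewrite lexx (ltW T0).
  by exists D0 => _ [s [y [sT ->]]]; apply: le_trans (hD0 s y sT); exact: ler_norm.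
have VS s y : 0 <= s <= T -> V s f y <= sup S.
  by move=> sT; apply: ub_le_sup; [case: hS|exists s, y].
have S0 : 0 <= sup S by apply: le_trans (VS 0 x _); [exact: V_ge0|rewrite lexx ltW].
suff h : sup S <= 2 * C by apply: le_trans h; exact: VS.
have : sup S <= C + T * ((A + G) * sup S).
  apply: ge_sup; first by case: hS.
  move=> _ [s [y [/andP[s0 sT] ->]]].
  apply: (@le_trans _ _ (C + s * ((A + G) * sup S))).
    apply: (@V_le_occupation f s y A G C (sup S)) => // r z /andP[r0 rs].
    by apply: VS; rewrite r0 (le_trans rs).
  by rewrite lerD2l ler_wpM2r// mulr_ge0// addr_ge0.
have : T * (A + G) <= 2^-1 by lra.
nra.
Qed.

Lemma V_bound T : 0 <= T -> exists2 K, 1 <= K & forall f C t x, Bbplus f -> 0 <= C ->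
  (forall y, f y <= C) -> 0 <= t <= T -> V t f x <= K * C.
Proof.
move=> T0; have [T1 T10 hT1] := V_short_bound.
have main n : forall f C t x, Bbplus f -> 0 <= C ->
    (forall y, f y <= C) -> 0 <= t <= n.+1%:R * T1 -> V t f x <= 2 ^+ n.+1 * C.
  elim: n => [|n IH] f C t x bf C0 fC /andP[t0 tn].
    by rewrite expr1; apply: hT1 => //; rewrite t0 -[T1]mul1r.
  have C20 : 0 <= 2 ^+ n.+1 * C by rewrite mulr_ge0// exprn_ge0.
  have [tT|/ltW Tt] := leP t T1.
    apply: (@le_trans _ _ (2 * C)); first by apply: hT1 => //; rewrite t0.
    by rewrite ler_wpM2r// -[leLHS]expr1 ler_eXn2l// ltr1n.
  have tE : t = T1 + (t - T1) by lra.
  have tt0 : 0 <= t - T1 by lra.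
  rewrite tE V_semigroup ?(ltW T10)// exprS -mulrA.
  apply: hT1; rewrite ?lexx ?(ltW T10)//; first exact: V_Bbplus.
  move=> y; apply: IH => //; rewrite tt0/=.
  by move: tn; rewrite -[n.+2]addn1 natrD mulrDl mul1r; lra.
exists (2 ^+ (Num.truncn (T / T1)).+1); first by rewrite exprn_ege1// ler1n.
move=> f C t x bf C0 fC /andP[t0 tT]; apply: main => //; rewrite t0/=.
by apply: (le_trans tT); rewrite -ler_pdivrMr// ltW// truncnS_gt.
Qed.

(** The mean semigroup taken as an expectation instead of a solution of the mean equation:
    monotonicity, additivity and the semigroup property then come from those of integrals and from
    the Markov property. Uniqueness of the solution identifies it with [M] where densities are
    used. *)
Definition emean t f x : R := fine (\int[P (dirac_fmeas x)]_w (mass f t w)%:E)%E.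

(** Difference quotient of the cumulant at the zero function, whose limit is the mean. *)
Let Vd n t f x := V t (fun y => dyad n * f y) x / dyad n.

Let dy0 n : 0 < @dyad R n. Proof. exact: dyad_gt0. Qed.

Lemma BbplusZ c f : 0 <= c -> Bbplus f -> Bbplus (fun y => f y * c).
Proof. by move=> c0 /(BbplusM c0); under eq_fun do rewrite mulrC. Qed.

Let Vd_Bbplus n t f : Bbplus f -> 0 <= t -> Bbplus (Vd n t f).
Proof.
move=> bf t0; apply: BbplusZ; first by rewrite invr_ge0 ltW.
by apply: V_Bbplus => //; apply: BbplusM => //; exact: ltW.
Qed.

Let Vd_bound T f C : 0 <= T -> Bbplus f -> 0 <= C -> (forall y, f y <= C) ->
  exists2 K, 0 <= K & forall n t x, 0 <= t <= T -> 0 <= Vd n t f x <= K.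
Proof.
move=> T0 bf C0 fC; have [K K1 hK] := V_bound T0; exists (K * C); first by rewrite mulr_ge0//; lra.
move=> n t x tT; have t0 : 0 <= t by case/andP: tT.
have bd : Bbplus (fun y => dyad n * f y) by apply: BbplusM => //; exact: ltW.
rewrite divr_ge0 ?V_ge0 ?(ltW (dy0 n))//= ler_pdivrMr//.
apply: (@le_trans _ _ (K * (dyad n * C))); last by rewrite mulrA mulrAC.
apply: hK => //; first by rewrite mulr_ge0// ltW.
by move=> y; rewrite ler_wpM2l// ltW.
Qed.

(* [E (1 - expR (- c Y)) / c] increases to [E Y] as [c] decreases to 0 *)
Lemma mean_cvg mu t f : Bbplus f -> 0 <= t ->
  (((1 - expR (- \int[mu]_x V t (fun y => dyad n * f y) x)) / dyad n)%:E @[n --> \oo] -->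
   \int[P mu]_w (mass f t w)%:E)%E.
Proof.
move=> bf t0; pose Y := mass f t.
have Y0 w : 0 <= Y w by apply: mass_ge0 => y; exact: Bbplus_ge0.
pose F n (w : path_space E) : R := (1 - expR (- (dyad n * Y w))) / dyad n.
have mY : measurable_fun setT (Y : path_space E -> R) by exact: measurable_mass.
have mF n : measurable_fun setT (F n).
  apply: measurable_funM => //; apply: measurable_funB => //.
  apply: measurableT_comp => //; apply: measurableT_comp => //.
  exact: measurable_funM.
have FE n : ((1 - expR (- \int[mu]_x V t (fun y => dyad n * f y) x)) / dyad n)%:E =
    (\int[P mu]_w (F n w)%:E)%E.
  rewrite -laplace ?(ltW (dy0 n))//.
  have ie := expR_mass_integrable mu bf t0 (ltW (dy0 n)).
  have i1 : (P mu).-integrable setT (EFin \o cst 1).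
    by apply: (@probability_bdd_integrable _ _ _ _ _ 1) => // w; rewrite normr1.
  have -> : 1 - \int[P mu]_w expR (- (dyad n * mass f t w)) =
      \int[P mu]_w (1 - expR (- (dyad n * mass f t w))).
    by rewrite RintegralB// Rintegral_probability_cst.
  have i2 := integrableB measurableT i1 ie.
  rewrite -RintegralZr// EFin_Rintegral//.
  by have := integrableZr measurableT (dyad n)^-1 i2; apply: eq_integrable => // w _ /=; rewrite EFinM.
under eq_fun do rewrite FE.
rewrite (_ : (\int[P mu]_w (mass f t w)%:E)%E =
    (\int[P mu]_w lim ((F n w)%:E @[n --> \oo]))%E); last first.
  apply: eq_integral => w _; apply/esym/cvg_lim => //; apply: cvg_EFin; first exact: nearW.
  have -> : fine \o (fun n => (F n w)%:E) = fun n => Y w - phi (dyad n * Y w) / dyad n.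
    apply/funext => n; rewrite /= /F /phi.
    have d0 := dy0 n; have dn : @dyad R n != 0 by rewrite gt_eqF.
    by field.
  rewrite -[X in _ --> X](subr0 (Y w)); apply: cvgB; first exact: cvg_cst.
  apply: (@phi_scaled_cvg _ (fun=> Y w) _ (Y w)) => //; first exact: cvg_dyad.
  by move=> n; rewrite Y0 lexx.
apply: cvg_monotone_convergence => //.
- by move=> n; exact/measurable_EFinP.
- move=> n w _; rewrite lee_fin divr_ge0 ?(ltW (dy0 n))// subr_ge0 expR_le1 oppr_le0.
  by rewrite mulr_ge0// ltW.
(* Monotone in [n]: since [dyad n] is twice [dyad n.+1], its exponential is a square [u ^+ 2], and
   [1 - u ^+ 2 <= 2 * (1 - u)]. *)
move=> w _; apply/nondecreasing_seqP => n; rewrite lee_fin /F.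
have -> : @dyad R n = 2 * dyad n.+1.
  by rewrite /dyad exprS invfM mulrA divff ?mul1r.
have d0 := dy0 n.+1; set d := dyad n.+1 in d0 *; set y := Y w.
have -> : expR (- (2 * d * y)) = expR (- (d * y)) ^+ 2.
  by rewrite -expRM_natl; congr expR; rewrite mulrN mulrA.
have -> : (1 - expR (- (d * y))) / d = (2 * (1 - expR (- (d * y)))) / (2 * d).
  by have dn : d != 0 by [rewrite gt_eqF]; field.
rewrite ler_pM2r ?invr_gt0 ?mulr_gt0//.
have := sqr_ge0 (1 - expR (- (d * y))); lra.
Qed.

(** [mean_cvg] gives the limit of a quantity that differs from [q n] by
    [phi (dyad n * q n) / dyad n]. The bound on [V] keeps [q n] bounded, so this gap vanishes; the
    same bound shows that the expected mass is finite. *)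
Lemma Vd_cvg_mass mu t f : Bbplus f -> 0 <= t -> exists l,
  (\int[P mu]_w (mass f t w)%:E = l%:E)%E /\
  \int[mu]_x (Vd n t f x) @[n --> \oo] --> l.
Proof.
move=> bf t0; have [C C0 fC] := BbplusP bf.
have fC' y : f y <= C by case/andP: (fC y).
have [K K0 hK] := Vd_bound t0 bf C0 fC'.
have tt : 0 <= t <= t by rewrite t0 lexx.
pose q n := \int[mu]_x (Vd n t f x).
have bV n := Vd_Bbplus n bf t0.
have q0 n : 0 <= q n <= K * total mu.
  rewrite Rintegral_ge0/=; last by move=> x _; case/andP: (hK n t x tt).
  by apply: fmeas_Rintegral_le => [|x]; [exact: (bV n).1|case/andP: (hK n t x tt)].
have qE n : \int[mu]_x V t (fun y => dyad n * f y) x = dyad n * q n.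
  rewrite /q -fmeas_RintegralZ; last exact: (bV n).1.
  by apply: eq_Rintegral => x _; rewrite /Vd mulrCA divff ?mulr1// gt_eqF.
have h := @mean_cvg mu t f bf t0.
have eqn n : (1 - expR (- \int[mu]_x V t (fun y => dyad n * f y) x)) / dyad n =
    q n - phi (dyad n * q n) / dyad n.
  rewrite qE /phi; have dn : @dyad R n != 0 by rewrite gt_eqF.
  by field.
have h0 := @phi_scaled_cvg R q (@dyad R) (K * total mu) dy0 (@cvg_dyad R) q0.
have fin : (\int[P mu]_w (mass f t w)%:E \is a fin_num)%E.
  rewrite ge0_fin_numE; last first.
    apply: integral_ge0 => w _; rewrite lee_fin mass_ge0// => y; exact: Bbplus_ge0.
  apply: (@le_lt_trans _ _ (K * total mu)%:E); last exact: ltry.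
  rewrite -(cvg_lim _ h)//; apply: lime_le; first by apply/cvg_ex; eexists; exact: h.
  apply: nearW => n; rewrite eqn lee_fin.
  have p0 : 0 <= phi (dyad n * q n) / dyad n by rewrite divr_ge0 ?phi_ge0 ?ltW.
  by case/andP: (q0 n) => _; lra.
exists (fine (\int[P mu]_w (mass f t w)%:E)%E); split; first by rewrite fineK.
move: h; rewrite -{1}(fineK fin) => /fine_cvg h.
have e : (fun n => \int[mu]_x Vd n t f x) = fun n =>
    (1 - expR (- \int[mu]_x V t (fun y => dyad n * f y) x)) / dyad n +
    phi (dyad n * q n) / dyad n.
  by apply/funext => n; rewrite eqn subrK.
rewrite e -[X in _ --> X]addr0; apply: cvgD; [exact: h|exact: h0].
Qed.

Lemma Vd_cvg t f x : Bbplus f -> 0 <= t -> Vd n t f x @[n --> \oo] --> emean t f x.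
Proof.
move=> bf t0; have [l [e h]] := Vd_cvg_mass (dirac_fmeas x) bf t0.
rewrite /emean e /= -(_ : (fun n => \int[dirac_fmeas x]_y (Vd n t f y)) = fun n => Vd n t f x)//.
by apply/funext => n; rewrite Rintegral_dirac_fmeas//; exact: (Vd_Bbplus n bf t0).1.
Qed.

Lemma mean_ge0 t f x : (forall y, 0 <= f y) -> 0 <= emean t f x.
Proof. by move=> f0; apply: fine_ge0; apply: integral_ge0 => w _; rewrite lee_fin mass_ge0. Qed.

Lemma mean_bound T f : 0 <= T -> Bbplus f ->
  exists2 K, 0 <= K & forall t x, 0 <= t <= T -> emean t f x <= K.
Proof.
move=> T0 bf; have [C C0 fC] := BbplusP bf.
have [K K0 hK] := Vd_bound T0 bf C0 (fun y => proj2 (andP (fC y))).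
exists K => // t x tT; have t0 : 0 <= t by case/andP: tT.
have h := @Vd_cvg t f x bf t0.
rewrite -(cvg_lim _ h)//; apply: limr_le; first by apply/cvg_ex; eexists; exact: h.
by apply: nearW => n; case/andP: (hK n t x tT).
Qed.

Lemma mean_mass mu t f : Bbplus f -> 0 <= t ->
  (\int[P mu]_w (mass f t w)%:E = (\int[mu]_x emean t f x)%:E)%E.
Proof.
move=> bf t0; have [l [-> h]] := Vd_cvg_mass mu bf t0; congr EFin.
rewrite -(cvg_lim _ h)//; apply/cvg_lim => //.
have [C C0 fC] := BbplusP bf.
have [K K0 hK] := Vd_bound t0 bf C0 (fun y => proj2 (andP (fC y))).
apply: (@Rintegral_bounded_cvg _ _ _ _ _ measurableT _ _ _ K).
- exact: fmeas_fin.
- by move=> n; exact: (Vd_Bbplus n bf t0).1.1.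
- by move=> x _; exact: Vd_cvg.
- move=> n x _; have /andP[h1 h2] : 0 <= Vd n t f x <= K by apply: hK; rewrite t0 lexx.
  by rewrite ger0_norm.
Qed.

(** The cumulant equation of [dyad n * f] is divided by [dyad n]. The linear terms pass to the limit
    by bounded convergence, and the quotient of [rho] disappears. *)
Lemma mean_is_solution f : Bbplus f -> mean_solution k X f (fun t => emean t f).
Proof.
move=> bf; have [C C0 fC] := BbplusP bf.
have bdf n : Bbplus (fun y => dyad n * f y) by apply: BbplusM => //; exact: ltW.
split.
- rewrite /jointly_Borel.
  apply: (@measurable_fun_cvg _ _ _ _ (fun n (z : R * borel E) => Vd n z.1 f z.2)).
    move=> n; apply: measurable_funM => //.
    by have [[h _ _ _] _] := V_def (bdf n).
  by move=> z /= z0; exact: Vd_cvg.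
- move=> T T0; have [K K0 hK] := mean_bound (ltW T0) bf; exists K => t x tT.
  by rewrite ger0_norm ?hK ?mean_ge0// => y; exact: Bbplus_ge0.
move=> t x t0; have tt s : 0 <= s <= t -> 0 <= t - s <= t by lra.
have [K K0 hK] := Vd_bound t0 bf C0 (fun y => proj2 (andP (fC y))).
have [A A0 aA] := BbP (br_aP k); have [G G0 gG] := gamma_int_bound k.
have [B B0 hB] := rho_scaled k K0.
pose W n s := Vd n (t - s) f.
have bW n s : 0 <= s <= t -> Bbplus (W n s) by move=> st; apply: Vd_Bbplus => //; lra.
have W0K n s y : 0 <= s <= t -> 0 <= W n s y <= K by move=> st; apply: hK; exact: tt.
have W0 n s y : 0 <= s <= t -> 0 <= W n s y by move=> /(W0K n s y) /andP[].
have jW n : jbounded t (W n).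
  have := jboundedZ (dyad n)^-1 (jbounded_rev (V_jbounded (bdf n) t0)).
  by apply: jbounded_eq => s y st; rewrite mulrC.
pose r_ n s y := rho k (fun z => dyad n * W n s z) y / dyad n.
have jr n : jbounded t (r_ n).
  have jd : jbounded t (fun s z => dyad n * W n s z) by exact: jboundedZ.
  have d0 s z : 0 <= s <= t -> 0 <= dyad n * W n s z.
    by move=> st; rewrite mulr_ge0 ?W0// ltW.
  have := jboundedZ (dyad n)^-1 (jbounded_rho k t0 jd d0).
  by apply: jbounded_eq => s y st; rewrite mulrC.
pose S n s y := br_a k y * W n s y - gamma_int k (W n s) y + r_ n s y.
pose S' s y := br_a k y * emean (t - s) f y - gamma_int k (emean (t - s) f) y.
have jS n : jbounded t (S n).
  apply: jboundedD => //; apply: jboundedB; first exact: jbounded_a.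
  by apply: jbounded_gamma => //; exact: W0.
have eqn n : Vd n t f x = semigroup X t f x - occupation X t (S n) x.
  rewrite /Vd V_eq// mulrBl semigroupZ//; last exact: bf.1.
  rewrite mulrAC divff ?gt_eqF// mul1r; congr (_ - _).
  have jV := jbounded_rev (V_jbounded (bdf n) t0).
  have V0 s y : 0 <= s <= t -> 0 <= V (t - s) (fun y => dyad n * f y) y.
    by move=> st; apply: V_ge0 => //; lra.
  have jJ := jboundedD (jboundedB (jbounded_a jV) (jbounded_gamma k t0 jV V0))
    (jbounded_rho k t0 jV V0).
  rewrite mulrC -(occupationZ X _ x t0 jJ).
  apply: occupation_eq => s y st.
  have VW : V (t - s) (fun y => dyad n * f y) = fun z => dyad n * W n s z.
    by apply/funext => z; rewrite /W /Vd mulrCA divff ?mulr1// gt_eqF.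
  rewrite VW gamma_intZ; last exact: (bW n s st).1.
  rewrite /S /r_; have dn : @dyad R n != 0 by rewrite gt_eqF.
  by field.
have [jS' cS] : jbounded t S' /\
    occupation X t (S n) x @[n --> \oo] --> occupation X t S' x.
  apply: (@occupation_cvg _ _ _ _ _ _ _ _ _ (A * K + G * K + B)) => //.
  - move=> n s y st; have /andP[w0 wK] := W0K n s y st.
    have h1 : `|br_a k y * W n s y| <= A * K by rewrite normrM ler_pM// ger0_norm.
    have h2 : `|gamma_int k (W n s) y| <= G * K.
      apply: gG => //; first exact: (bW n s st).1.
      by move=> z; have /andP[z0 zK] := W0K n s z st; rewrite ger0_norm.
    have h3 : r_ n s y <= B.
      apply: hB; [by rewrite dy0 dyad_le1|exact: bW|by move=> z; case/andP: (W0K n s z st)].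
    have h4 : 0 <= r_ n s y by rewrite divr_ge0 ?rho_ge0// ltW.
    move: h1 h2; rewrite !ler_norml /S => /andP[? ?] /andP[? ?]; lra.
  move=> s y st; rewrite /S /S' -[X in _ --> X]addr0.
  have ts0 : 0 <= t - s by lra.
  apply: cvgD; first apply: cvgB.
  - by apply: cvgM; [exact: cvg_cst|exact: Vd_cvg].
  - apply: (@Rintegral_bounded_cvg _ _ _ _ _ measurableT _ _ _ K).
    + have [D D0 hD] := finite_kernel_bound (br_gamma k).
      by apply: (le_lt_trans (hD _)); exact: ltry.
    + by move=> n; exact: (bW n s st).1.1.
    + by move=> z _; exact: Vd_cvg.
    + by move=> n z _; have /andP[z0 zK] := W0K n s z st; rewrite ger0_norm.
  - apply: (@rho_scaled_cvg _ _ k K (fun n => W n s)); first by move=> n; exact: bW.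
    by move=> n z; case/andP: (W0K n s z st).
have jm : jbounded t (fun s => emean (t - s) f).
  have [] := @occupation_cvg _ _ _ _ X t W (fun s => emean (t - s) f) x K t0 jW.
  - by move=> n s y st; have /andP[z0 zK] := W0K n s y st; rewrite ger0_norm.
  - by move=> s y st; apply: Vd_cvg => //; lra.
  by [].
have m0 s y : 0 <= s <= t -> 0 <= emean (t - s) f y.
  by move=> _; apply: mean_ge0 => z; exact: Bbplus_ge0.
have -> : emean t f x = semigroup X t f x - occupation X t S' x.
  have h := @Vd_cvg t f x bf t0; rewrite -(cvg_lim _ h)//; apply/cvg_lim => //.
  under eq_fun do rewrite eqn.
  by apply: cvgB => //; exact: cvg_cst.
rewrite /S' occupationB//; first by rewrite opprB addrA addrAC.
- exact: jbounded_a.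
- exact: jbounded_gamma.
Qed.

End superprocess_moments.

(** * The gap between the mean and the cumulant semigroups *)

Section mean_semigroup.
Context (R : realType) (E : pmetricType R) (dO : measure_display)
  (O : measurableType dO) (X : hunt_process E O) (k : branching E).
Variables (V : R -> (E -> R) -> E -> R) (V_def : cumulant_semigroup k X V).
Variables (P : borel (fmeas E) -> probability (path_space E) R)
  (P_def : superprocess V P).
Implicit Types (f g : E -> R) (t s : R) (x : E) (mu nu : fmeas E).
Local Notation mean := (emean P).

Lemma mean_jbounded f t : Bbplus f -> 0 <= t -> jbounded t (fun s => mean s f).
Proof.
move=> bf t0; have [h1 h2 _] := mean_is_solution V_def P_def bf.
exact: jointly_jbounded.
Qed.

Lemma mean_Bbplus f t : Bbplus f -> 0 <= t -> Bbplus (mean t f).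
Proof.
move=> bf t0; apply: (@jbounded_Bbplus _ _ t _ t (mean_jbounded bf t0)); last by lra.
by move=> s y _; apply: mean_ge0 => z; exact: Bbplus_ge0.
Qed.

Lemma mean_eq f t x : Bbplus f -> 0 <= t -> mean t f x = semigroup X t f x
  + occupation X t (fun s y => gamma_int k (mean (t - s) f) y - br_a k y * mean (t - s) f y) x.
Proof.
move=> bf t0; have [_ _ h] := mean_is_solution V_def P_def bf; rewrite (h _ _ t0).
have jm := jbounded_rev (mean_jbounded bf t0).
have m0 s y : 0 <= s <= t -> 0 <= mean (t - s) f y.
  by move=> _; apply: mean_ge0 => z; exact: Bbplus_ge0.
rewrite occupationB//; last exact: jbounded_a.
  by rewrite -addrA [- _ + _]addrC.
exact: jbounded_gamma.
Qed.

Lemma mass_integrable mu f t : Bbplus f -> 0 <= t ->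
  (P mu).-integrable setT (EFin \o (mass f t : path_space E -> R)).
Proof.
move=> bf t0; apply/integrableP; split.
  by apply/measurable_EFinP; exact: measurable_mass.
rewrite (_ : (\int[P mu]_w `|_|)%E = (\int[P mu]_w (mass f t w)%:E)%E); last first.
  apply: eq_integral => w _; rewrite /= ger0_norm// mass_ge0// => y; exact: Bbplus_ge0.
by rewrite (mean_mass V_def P_def)// ltry.
Qed.

Lemma Rintegral_mass mu f t : Bbplus f -> 0 <= t ->
  \int[P mu]_w mass f t w = \int[mu]_x mean t f x.
Proof. by move=> bf t0; rewrite /Rintegral (mean_mass V_def P_def). Qed.

Lemma mean_Rintegral f t x : Bbplus f -> 0 <= t ->
  mean t f x = \int[P (dirac_fmeas x)]_w mass f t w.
Proof. by []. Qed.

Lemma massD f g t (w : path_space E) : Bb f -> Bb g ->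
  mass (fun y => f y + g y) t w = mass f t w + mass g t w.
Proof. exact: fmeas_RintegralD. Qed.

Lemma mass_le f g t (w : path_space E) : Bb f -> Bb g -> (forall y, f y <= g y) ->
  mass f t w <= mass g t w.
Proof. exact: fmeas_le_Rintegral. Qed.

Lemma meanD f g t x : Bbplus f -> Bbplus g -> 0 <= t ->
  mean t (fun y => f y + g y) x = mean t f x + mean t g x.
Proof.
move=> bf bg t0; rewrite !mean_Rintegral//; last exact: BbplusD.
rewrite -RintegralD//; [|exact: mass_integrable|exact: mass_integrable].
by apply: eq_Rintegral => w _; apply: massD; [exact: bf.1|exact: bg.1].
Qed.

Lemma meanZ c f t x : Bbplus f -> 0 <= c -> 0 <= t ->
  mean t (fun y => c * f y) x = c * mean t f x.
Proof.
move=> bf c0 t0; rewrite !mean_Rintegral//; last exact: BbplusM.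
rewrite -RintegralZl//; last exact: mass_integrable.
by apply: eq_Rintegral => w _; apply: mass_scale; exact: bf.1.
Qed.

Lemma mean_le f g t x : Bbplus f -> Bbplus g -> 0 <= t -> (forall y, f y <= g y) ->
  mean t f x <= mean t g x.
Proof.
move=> bf bg t0 fg; rewrite !mean_Rintegral//.
apply: le_Rintegral => //; [exact: mass_integrable|exact: mass_integrable|].
by move=> w _; apply: mass_le => //; [exact: bf.1|exact: bg.1].
Qed.

Lemma mean_semi f s t x : Bbplus f -> 0 <= s -> 0 <= t ->
  mean (s + t) f x = mean s (mean t f) x.
Proof.
move=> bf s0 t0; rewrite /emean; congr fine.
pose G (nu : borel (fmeas E)) : \bar R := (\int[nu : fmeas E]_y f y)%:E.
have G0 nu : (0 <= G nu)%E.
  by rewrite lee_fin; apply: Rintegral_ge0 => y _; exact: Bbplus_ge0.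
have mG : measurable_fun setT G.
  by apply/measurable_EFinP; exact: measurable_fmeas_Rintegral.
rewrite (markovT P_def (dirac_fmeas x) s0 t0 G0 mG).
apply: eq_integral => w _.
exact: (mean_mass V_def P_def (coordinate s w) bf t0).
Qed.

(** Jensen's inequality, from the tangent of [expR (- y)] at the mean [m]. *)
Lemma V_le_mean f t x : Bbplus f -> 0 <= t -> V t f x <= mean t f x.
Proof.
move=> bf t0; have bV := V_Bbplus V_def bf t0.
rewrite -lerN2 -ler_expR.
have := laplace P_def (dirac_fmeas x) bf t0 ler01.
rewrite (_ : (fun y => 1 * f y) = f); last by apply/funext => y; rewrite mul1r.
rewrite Rintegral_dirac_fmeas; last exact: bV.1.
move=> <-; set m := mean t f x.
have im := mass_integrable (dirac_fmeas x) bf t0.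
have i1 : (P (dirac_fmeas x)).-integrable setT (EFin \o cst (1 + m)).
  by apply: (@probability_bdd_integrable _ _ _ _ _ `|1 + m|).
have i2 := integrableB measurableT i1 im.
have -> : expR (- m) = \int[P (dirac_fmeas x)]_w (expR (- m) * (1 + m - mass f t w)).
  rewrite RintegralZl// RintegralB// Rintegral_probability_cst -mean_Rintegral//.
  by rewrite -/m addrK mulr1.
apply: le_Rintegral => //.
- by have := integrableZl measurableT (expR (- m)) i2; apply: eq_integrable.
- by apply: expR_mass_integrable => //; exact: ler01.
move=> w _; rewrite mul1r.
have e : - mass f t w = - m + (m - mass f t w) by lra.
by rewrite [in leRHS]e expRD ler_wpM2l ?expR_ge0// -addrA expR_ge1Dx.
Qed.

Definition defect t f x := mean t f x - V t f x.

Lemma defect_ge0 t f x : Bbplus f -> 0 <= t -> 0 <= defect t f x.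
Proof. by move=> bf t0; rewrite subr_ge0 V_le_mean. Qed.

Lemma defect_jbounded f t : Bbplus f -> 0 <= t -> jbounded t (fun s => defect s f).
Proof. by move=> bf t0; apply: jboundedB; [exact: mean_jbounded|exact: (V_jbounded V_def)]. Qed.

Lemma defect_Bbplus f t : Bbplus f -> 0 <= t -> Bbplus (defect t f).
Proof.
move=> bf t0; apply: (@jbounded_Bbplus _ _ t _ t (defect_jbounded bf t0)); last by lra.
by move=> s y /andP[s0 _]; exact: defect_ge0.
Qed.

(** The terms [semigroup X t f x] cancel, so the defect solves a linear equation whose only source
    is the superlinear part [rho]. *)
Lemma defect_eq f t x : Bbplus f -> 0 <= t -> defect t f x =
  occupation X t (fun s y => (gamma_int k (defect (t - s) f) y -
    br_a k y * defect (t - s) f y) + rho k (V (t - s) f) y) x.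
Proof.
move=> bf t0; rewrite {1}/defect mean_eq// (V_eq V_def)//.
have jm := jbounded_rev (mean_jbounded bf t0).
have m0 s y : 0 <= s <= t -> 0 <= mean (t - s) f y.
  by move=> _; apply: mean_ge0 => z; exact: Bbplus_ge0.
have jV := jbounded_rev (V_jbounded V_def bf t0).
have V0 s y : 0 <= s <= t -> 0 <= V (t - s) f y by move=> st; apply: (V_ge0 V_def) => //; lra.
have jgm := jbounded_gamma k t0 jm m0; have jam := jbounded_a k jm.
have jgV := jbounded_gamma k t0 jV V0; have jaV := jbounded_a k jV.
have jr := jbounded_rho k t0 jV V0.
have j1 := jboundedB jgm jam; have j2 := jboundedD (jboundedB jaV jgV) jr.
rewrite (_ : forall a b c : R, a + b - (a - c) = b + c); last by move=> *; ring.
rewrite -(occupationD X x t0 j1 j2).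
apply: occupation_eq => s y st; rewrite /defect gamma_intB.
- by ring.
- by apply: (mean_Bbplus bf _).1; lra.
- by apply: (V_Bbplus V_def bf _).1; lra.
Qed.

Section eigenfunction.
Variables (h : E -> R) (lambda1 : R).
Hypotheses (bh : Bbplus h) (h_gt0 : forall x, 0 < h x) (l0 : lambda1 < 0).
Hypothesis mean_h : forall t x, 0 <= t -> mean t h x = expR (- lambda1 * t) * h x.

Lemma expR_decay s t : s <= t -> expR (lambda1 * t) <= expR (lambda1 * s).
Proof. by move=> st; rewrite ler_expR ler_wnM2l// ltW. Qed.

Lemma expR_growth s t : s <= t -> expR (- lambda1 * s) <= expR (- lambda1 * t).
Proof. by move=> st; rewrite ler_expR ler_wpM2l// oppr_ge0 ltW. Qed.

Lemma expR_decay1 t : 0 <= t -> expR (lambda1 * t) <= 1.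
Proof. by move=> /expR_decay; rewrite mulr0 expR0. Qed.

Lemma expR_growth1 t : 0 <= t -> 1 <= expR (- lambda1 * t).
Proof. by move=> /expR_growth; rewrite mulr0 expR0. Qed.

Lemma occupation_h_short : exists T C : R, [/\ 0 < T, 0 <= C & forall t x,
  0 <= t <= T -> occupation X t (fun=> h) x <= t * (C * h x)].
Proof.
have [A A0 aA] := BbP (br_aP k); have [H H0 hH] := BbplusP bh.
(* [T] will be at most 1, so [c] bounds every growth factor [expR (- lambda1 * s)] in use. *)
pose c := expR (- lambda1); have c1 : 1 <= c by rewrite /c -expR0 ler_expR oppr_ge0 ltW.
pose T := (2 * A * c + 1)^-1.
have Ac : 0 <= A * c by rewrite mulr_ge0//; lra.
have T0 : 0 < T by rewrite invr_gt0; lra.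
have T1 : T <= 1 by rewrite invf_le1//; lra.
have TE : T * (2 * A * c + 1) = 1 by rewrite mulVf//; lra.
exists T, (2 * c); split => //; first by lra.
have ct s : 0 <= s <= T -> expR (- lambda1 * s) <= c.
  by move=> /andP[_ sT]; rewrite /c -[leRHS](congr1 expR (mulr1 _)) expR_growth// (le_trans sT).
move=> t x /andP[t0 tT].
pose S := [set r | exists s, 0 <= s <= T /\ r = semigroup X s h x].
have Sub s : 0 <= s <= T -> semigroup X s h x <= H.
  move=> /andP[s0 _]; apply: semigroup_le => //; first exact: bh.1.
  by move=> y; case/andP: (hH y).
have hS : has_sup S.
  split; first by exists (semigroup X 0 h x), 0; rewrite lexx ltW.
  by exists H => _ [s [sT ->]]; exact: Sub.
have leS s : 0 <= s <= T -> semigroup X s h x <= sup S.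
  by move=> sT; apply: ub_le_sup; [case: hS|exists s].
have S0 : 0 <= sup S.
  by apply: le_trans (leS 0 _); [apply: semigroup_ge0 => y; exact: Bbplus_ge0|rewrite lexx ltW].
have occS s : 0 <= s <= T -> occupation X s (fun=> h) x <= s * sup S.
  move=> /andP[s0 sT]; apply: occupation_time => // r /andP[r0 rs].
  by apply: leS; rewrite r0 (le_trans rs).
have : sup S <= c * h x + A * c * (T * sup S).
  apply: ge_sup; first by case: hS.
  move=> _ [s [/[dup] sT /andP[s0 sT'] ->]].
  have := mean_eq x bh s0; rewrite mean_h// => e.
  have e1 : semigroup X s h x = expR (- lambda1 * s) * h x - occupation X s
     (fun r y => gamma_int k (mean (s - r) h) y - br_a k y * mean (s - r) h y) x.
    by rewrite e addrK.
  have jm := jbounded_rev (mean_jbounded bh s0).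
  have m0 r y : 0 <= r <= s -> 0 <= mean (s - r) h y.
    by move=> _; apply: mean_ge0 => z; exact: Bbplus_ge0.
  have jgm := jbounded_gamma k s0 jm m0; have jam := jbounded_a k jm.
  have j1 := jboundedB jgm jam.
  have jh : jbounded s (fun=> h) by apply: jbounded_Bb; exact: bh.1.
  have : - (A * c) * occupation X s (fun=> h) x <= occupation X s
     (fun r y => gamma_int k (mean (s - r) h) y - br_a k y * mean (s - r) h y) x.
    rewrite -(occupationZ X _ x s0 jh); apply: ler_occupation => //; first exact: jboundedZ.
    move=> r y rs; have sr : 0 <= s - r by lra.
    have g0 : 0 <= gamma_int k (mean (s - r) h) y.
      by apply: gamma_int_ge0 => z; exact: m0.
    have hm : 0 <= mean (s - r) h y <= c * h y.
      by rewrite m0//= mean_h// ler_wpM2r ?(ltW (h_gt0 y))// ct//; lra.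
    have := aA y; rewrite ler_norml => /andP[a1 a2].
    have : br_a k y * mean (s - r) h y <= A * (c * h y).
      case/andP: hm => m1 m2; apply: (@le_trans _ _ (A * mean (s - r) h y)).
        by rewrite ler_wpM2r.
      by rewrite ler_wpM2l.
    lra.
  have := occS s sT; have := ct s sT; have hx := h_gt0 x.
  have sS : s * sup S <= T * sup S by rewrite ler_wpM2r.
  rewrite e1 => q1 q2 q3.
  have q4 : expR (- lambda1 * s) * h x <= c * h x by rewrite ler_wpM2r// ltW.
  have q5 : A * c * occupation X s (fun=> h) x <= A * c * (T * sup S).
    by rewrite ler_wpM2l// (le_trans q2).
  clear -q1 q2 q3 q4 q5 sS; lra.
have TAc : A * c * T <= 2^-1 by nra.
move=> q; have : sup S <= 2 * c * h x by nra.
move=> q'; apply: (le_trans (occS t _)); first by rewrite t0.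
by rewrite ler_wpM2l.
Qed.

Section weighted_family.
Variables (n : nat) (w l : nat -> R) (kappa : R).
Hypotheses (w0 : forall j, 0 <= w j) (l_ge0 : forall j, 0 <= l j) (kappa0 : 0 <= kappa).
Hypothesis w_rho : forall x,
  \sum_(0 <= j < n) w j * rho k (fun y => l j * h y) x <= kappa * h x.

Definition wdefect t (g : nat -> E -> R) x := \sum_(0 <= j < n) w j * defect t (g j) x.

(** [c] is a safety margin: for [c = expR (lambda1 * d)] the mean of [g j], hence also [V], stays
    below [l j * h] up to time [d], so that the hypothesis on [rho] applies throughout. *)
Let below (c : R) (g : nat -> E -> R) :=
  (forall j, Bbplus (g j)) /\ forall j y, g j y <= l j * c * h y.

Lemma wdefect_ge0 t (g : nat -> E -> R) x c : below c g -> 0 <= t -> 0 <= wdefect t g x.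
Proof. by move=> [bg _] t0; apply: sumr_ge0 => j _; rewrite mulr_ge0// defect_ge0. Qed.

Lemma wdefect_jbounded t (g : nat -> E -> R) c : below c g -> 0 <= t -> jbounded t (fun s => wdefect s g).
Proof.
move=> [bg _] t0; apply: (@jbounded_sum _ _ t n (fun j s y => w j * defect s (g j) y)) => j.
by apply: jboundedZ; exact: defect_jbounded.
Qed.

Lemma wdefect_Bbplus t (g : nat -> E -> R) c : below c g -> 0 <= t -> Bbplus (wdefect t g).
Proof.
move=> bg t0; apply: (@jbounded_Bbplus _ _ t _ t (wdefect_jbounded bg t0)); last by lra.
by move=> s y /andP[s0 _]; exact: (wdefect_ge0 _ bg).
Qed.

Let A := sval (cid2 (BbP (br_aP k))).
Let G := sval (cid2 (gamma_int_bound k)).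
Let A0 : 0 <= A. Proof. by rewrite /A; case: cid2. Qed.
Let aA y : `|br_a k y| <= A. Proof. by rewrite /A; case: cid2. Qed.
Let G0 : 0 <= G. Proof. by rewrite /G; case: cid2. Qed.
Let gG f C x : Bb f -> 0 <= C -> (forall y, `|f y| <= C) -> `|gamma_int k f x| <= G * C.
Proof. by rewrite /G; case: cid2 => c c0 hc /=; exact: hc. Qed.

Lemma gamma_int_sum (g : nat -> E -> R) N x : (forall j, Bbplus (g j)) ->
  gamma_int k (fun y => \sum_(0 <= j < N) w j * g j y) x =
  \sum_(0 <= j < N) w j * gamma_int k (g j) x.
Proof.
move=> bg; elim: N => [|N IH].
  rewrite big_nil -[RHS](mul0r (gamma_int k (g 0%N) x)) -gamma_intZ; last exact: (bg 0%N).1.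
  by congr gamma_int; apply/funext => y; rewrite big_nil mul0r.
rewrite big_nat_recr//= -IH -gamma_intZ; last exact: (bg N).1.
have bs : Bbplus (fun y => \sum_(0 <= j < N) w j * g j y).
  elim: N {IH} => [|N IH].
    rewrite (_ : (fun y => _) = cst 0); first exact: Bbplus_cst.
    by apply/funext => y; rewrite big_nil.
  rewrite (_ : (fun y => _) = fun y => \sum_(0 <= j < N) w j * g j y + w N * g N y).
    by apply: BbplusD => //; exact: BbplusM.
  by apply/funext => y; rewrite big_nat_recr.
rewrite -gamma_intD; [|exact: bs.1|by apply: (BbplusM (w0 N) (bg N)).1].
by congr gamma_int; apply/funext => y; rewrite big_nat_recr.
Qed.

Lemma mean_below t d (g : nat -> E -> R) j y : 0 <= t <= d -> below (expR (lambda1 * d)) g ->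
  mean t (g j) y <= l j * expR (lambda1 * (d - t)) * h y.
Proof.
move=> /andP[t0 td] [bg gh].
have c0 : 0 <= l j * expR (lambda1 * d) by rewrite mulr_ge0// expR_ge0.
have := mean_le y (bg j) (BbplusM c0 bh) t0 (gh j).
rewrite meanZ// mean_h//; move/le_trans; apply.
have -> : expR (lambda1 * (d - t)) = expR (lambda1 * d) * expR (- lambda1 * t).
  by rewrite -expRD; congr expR; ring.
by rewrite le_eqVlt; apply/orP; left; apply/eqP; ring.
Qed.

(** The linear part of the defect equation is bounded through the sup norm, its source through
    [kappa * h]. Applied twice, with the output of the first use as the [D] of the second, it leaves
    a sup-norm error quadratic in time. *)
Lemma wdefect_step t d D (g : nat -> E -> R) x : 0 <= t <= d -> 0 <= D -> below (expR (lambda1 * d)) g ->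
  (forall s y, 0 <= s <= t -> wdefect s g y <= D) ->
  wdefect t g x <= t * ((A + G) * D) + kappa * occupation X t (fun=> h) x.
Proof.
move=> /andP[t0 td] D0 bg wD; have [bgj gh] := bg.
pose src j s y := (gamma_int k (defect (t - s) (g j)) y -
    br_a k y * defect (t - s) (g j) y) + rho k (V (t - s) (g j)) y.
have jsrc j : jbounded t (src j).
  have jd := jbounded_rev (defect_jbounded (bgj j) t0).
  have jV := jbounded_rev (V_jbounded V_def (bgj j) t0).
  have d0 s y : 0 <= s <= t -> 0 <= defect (t - s) (g j) y.
    by move=> st; apply: defect_ge0 => //; lra.
  have V0 s y : 0 <= s <= t -> 0 <= V (t - s) (g j) y.
    by move=> st; apply: (V_ge0 V_def) => //; lra.
  by apply: jboundedD; [apply: jboundedB; [exact: jbounded_gamma|exact: jbounded_a]|exact: jbounded_rho].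
have jws : jbounded t (fun s y => \sum_(0 <= j < n) w j * src j s y).
  by apply: (@jbounded_sum _ _ t n (fun j s y => w j * src j s y)) => j; exact: jboundedZ.
have -> : wdefect t g x = occupation X t (fun s y => \sum_(0 <= j < n) w j * src j s y) x.
  rewrite (@occupation_sum _ _ _ _ X t n (fun j s y => w j * src j s y))//; last first.
    by move=> j; exact: jboundedZ.
  by apply: eq_bigr => j _; rewrite occupationZ// defect_eq.
have jc : jbounded t (fun=> cst ((A + G) * D) : E -> R).
  by apply: jbounded_Bb; apply: (Bbplus_cst _ _).1; rewrite mulr_ge0// addr_ge0.
have jh : jbounded t (fun=> h) by apply: jbounded_Bb; exact: bh.1.
apply: (@le_trans _ _ (occupation X t (fun s y => (A + G) * D + kappa * h y) x)); last first.
  rewrite occupationD//; last exact: jboundedZ.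
  rewrite occupationZ// lerD2r; apply: occupation_ub => //.
  by rewrite mulr_ge0// addr_ge0.
apply: ler_occupation => //.
  by apply: jboundedD => //; exact: jboundedZ.
move=> s y st; have ts : 0 <= t - s <= t by lra.
have ts0 : 0 <= t - s by lra.
rewrite (eq_bigr (fun j => (w j * gamma_int k (defect (t - s) (g j)) y -
   br_a k y * (w j * defect (t - s) (g j) y)) + w j * rho k (V (t - s) (g j)) y)); last first.
  by move=> j _; rewrite /src; ring.
rewrite big_split/= sumrB -mulr_sumr -/(wdefect _ _ _).
rewrite -gamma_int_sum; last by move=> j; exact: defect_Bbplus.
apply: lerD.
  have wb := wdefect_Bbplus bg ts0.
  have wd0 z := wdefect_ge0 z bg ts0.
  have h1 : `|gamma_int k (wdefect (t - s) g) y| <= G * D.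
    apply: gG => //; first exact: wb.1.
    by move=> z; rewrite ger0_norm// wD.
  have h2 : `|br_a k y * wdefect (t - s) g y| <= A * D.
    by rewrite normrM ler_pM// ger0_norm// wD.
  move: h1 h2; rewrite !ler_norml -/(wdefect (t - s) g) => /andP[? ?] /andP[? ?]; lra.
apply: le_trans (w_rho y); apply: ler_sum => j _; rewrite ler_wpM2l//.
apply: rho_le; [exact: (V_Bbplus V_def)|exact: BbplusM|].
move=> z; apply: (le_trans (V_le_mean _ _ ts0)) => //.
have tsd : 0 <= t - s <= d by lra.
apply: (le_trans (mean_below j z tsd bg)).
by rewrite ler_wpM2r ?(ltW (h_gt0 z))// ler_piMr// expR_decay1//; lra.
Qed.

(* Cut [0, t] into [m] steps of length [d].  Since [V] and the mean are
   semigroups, the defect at time [(i + 1) d] is the mean of the defect at time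
   [d] plus the defect at time [i d] of [V d g]; the crude error of one step is
   of order [d ^ 2], so that it disappears as [m] goes to infinity. *)
Lemma wdefect_bound T C T' t (g : nat -> E -> R) x : 0 < T' -> 0 <= C ->
  (forall s y, 0 <= s <= T' -> occupation X s (fun=> h) y <= s * (C * h y)) ->
  0 <= t <= T -> below (expR (lambda1 * T)) g ->
  wdefect t g x <= C * kappa * t * expR (- lambda1 * T) * h x.
Proof.
move=> T'0 C0 occC /andP[t0 tT] bg.
have T0 : 0 <= T by apply: le_trans tT.
have [H H0 hH] := BbplusP bh.
pose B0 := \sum_(0 <= j < n) w j * (l j * H).
have B00 : 0 <= B0 by apply: sumr_ge0 => j _; rewrite !mulr_ge0.
pose B1 := (A + G) * B0 + kappa * (C * H).
have AG0 : 0 <= A + G by rewrite addr_ge0.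
have B10 : 0 <= B1 by rewrite addr_ge0 ?mulr_ge0.
pose B2 := (A + G) * B1.
have B20 : 0 <= B2 by rewrite mulr_ge0.
(* [crude] has no factor [d], [crude2] gains one and the last use of [wdefect_step] a second, so
   that at first order only the source remains, and it is proportional to [h]. *)
have one d (g' : nat -> E -> R) y : 0 <= d <= T' -> below (expR (lambda1 * d)) g' ->
    wdefect d g' y <= C * kappa * d * h y + B2 * d ^+ 2.
  move=> /andP[d0 dT] bg'; have [bgj _] := bg'.
  have crude s z : 0 <= s <= d -> wdefect s g' z <= B0.
    move=> sd; have s0 : 0 <= s by case/andP: sd.
    apply: ler_sum => j _; rewrite ler_wpM2l//.
    apply: (@le_trans _ _ (mean s (g' j) z)).
      by rewrite /defect gerBl (V_ge0 V_def).
    apply: (le_trans (mean_below j z sd bg')).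
    rewrite -mulrA ler_wpM2l//; apply: (@le_trans _ _ (1 * h z)).
      by rewrite ler_wpM2r ?(ltW (h_gt0 z))// expR_decay1//; lra.
    by rewrite mul1r; case/andP: (hH z).
  have crude2 s z : 0 <= s <= d -> wdefect s g' z <= d * B1.
    move=> /[dup] sd /andP[s0 sd']; have sT : 0 <= s <= T' by rewrite s0 (le_trans sd').
    have step := @wdefect_step s d B0 g' z sd B00 bg'.
    apply: (le_trans (step _)).
      by move=> r v /andP[r0 rs]; apply: crude; rewrite r0 (le_trans rs).
    have oc := occC s z sT; have /andP[_ hz] := hH z.
    have q1 : occupation X s (fun=> h) z <= s * (C * H).
      by apply: (le_trans oc); rewrite !ler_wpM2l.
    have q2 : kappa * occupation X s (fun=> h) z <= kappa * (s * (C * H)) by rewrite ler_wpM2l.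
    apply: (@le_trans _ _ (s * B1)); last by rewrite ler_wpM2r.
    rewrite /B1; lra.
  have dd : 0 <= d <= d by rewrite d0 lexx.
  have dB : 0 <= d * B1 by rewrite mulr_ge0.
  apply: (le_trans (@wdefect_step d d (d * B1) g' y dd dB bg' crude2)).
  have dT' : 0 <= d <= T' by rewrite d0.
  have := occC d y dT' => oc.
  have q2 : kappa * occupation X d (fun=> h) y <= kappa * (d * (C * h y)) by rewrite ler_wpM2l.
  have -> : d * ((A + G) * (d * B1)) = B2 * d ^+ 2 by rewrite /B2; ring.
  lra.
have b1 : Bbplus (cst 1 : E -> R) by exact: Bbplus_cst.
(* [K] propagates the part of the error that is not a multiple of [h], through the mean of the
   constant 1. *)
have [K K0 hK] := mean_bound V_def P_def T0 b1.
pose e := expR (- lambda1 * T).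
have e1 : 1 <= e by exact: expR_growth1.
have main d i (g' : nat -> E -> R) y : 0 <= d <= T' -> i%:R * d <= T -> below (expR (lambda1 * (i%:R * d))) g' ->
    wdefect (i%:R * d) g' y <= i%:R * (C * kappa * d * e * h y + B2 * d ^+ 2 * K).
  move=> dT'; have d0 : 0 <= d by case/andP: dT'.
  elim: i g' y => [|i IH] g' y iT bg'.
    rewrite !mul0r; have z0 : 0 <= (0 : R) <= T' by rewrite lexx ltW.
    have b0 : below (expR (lambda1 * 0)) g' by rewrite mul0r in bg'.
    by have := one 0 g' y z0 b0; rewrite expr2 !mulr0 !mul0r addr0.
  have id0 : 0 <= i%:R * d by rewrite mulr_ge0.
  have iE : i.+1%:R * d = i%:R * d + d by rewrite -natr1 mulrDl mul1r.
  have iT' : i%:R * d <= T by rewrite iE in iT; lra.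
  have [bgj gh] := bg'.
  (* Running for time [d] uses up part of the margin and leaves exactly the one for the remaining
     [i] steps. *)
  have bVg : below (expR (lambda1 * (i%:R * d))) (fun j => V d (g' j)).
    split; first by move=> j; exact: (V_Bbplus V_def).
    move=> j z; apply: (le_trans (V_le_mean _ (bgj j) d0)).
    have dd : 0 <= d <= i.+1%:R * d by rewrite d0 iE; lra.
    apply: (le_trans (mean_below j z dd bg')).
    by rewrite iE addrK.
  have bd : below (expR (lambda1 * d)) g'.
    split => // j z; apply: (le_trans (gh j z)).
    by rewrite ler_wpM2r ?(ltW (h_gt0 z))// ler_wpM2l// expR_decay// iE lerDr.
  have split_ : wdefect (i.+1%:R * d) g' y =
      mean (i%:R * d) (wdefect d g') y + wdefect (i%:R * d) (fun j => V d (g' j)) y.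
    have mean_sum N : mean (i%:R * d) (fun z => \sum_(0 <= j < N) w j * defect d (g' j) z) y =
        \sum_(0 <= j < N) w j * mean (i%:R * d) (defect d (g' j)) y /\
        Bbplus (fun z => \sum_(0 <= j < N) w j * defect d (g' j) z).
      elim: N => [|N [IHN bN]].
        rewrite big_nil (_ : (fun z => _) = cst 0); last by apply/funext => z; rewrite big_nil.
        split; last exact: Bbplus_cst.
        have := meanZ y b1 (lexx 0) id0; rewrite mul0r => {2}<-.
        by congr (emean _ _ _ _); apply/funext => z; rewrite mul0r.
      rewrite big_nat_recr//= -IHN (_ : (fun z => _) =
        fun z => \sum_(0 <= j < N) w j * defect d (g' j) z + w N * defect d (g' N) z); last first.
        by apply/funext => z; rewrite big_nat_recr.
      have bdN := defect_Bbplus (bgj N) d0.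
      split; last by apply: BbplusD => //; exact: BbplusM.
      by rewrite meanD//; [rewrite meanZ|exact: BbplusM].
    rewrite (mean_sum n).1 -big_split/=; apply: eq_bigr => j _.
    rewrite -mulrDr; congr (_ * _).
    rewrite iE /defect mean_semi// (V_semigroup V_def P_def)//.
    have bVj := V_Bbplus V_def (bgj j) d0; have bdj := defect_Bbplus (bgj j) d0.
    rewrite addrA; congr (_ - _); rewrite -(meanD y bdj bVj id0).
    by congr emean; apply/funext => z; rewrite subrK.
  rewrite split_ -[X in _ <= X * _]natr1 mulrDl mul1r addrC; apply: lerD; first exact: IH.
  have Ckd : 0 <= C * kappa * d by rewrite !mulr_ge0.
  have Bd : 0 <= B2 * d ^+ 2 by rewrite mulr_ge0 ?sqr_ge0.
  have bw := wdefect_Bbplus bd d0.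
  have bu1 := BbplusM Ckd bh; have bu2 := BbplusM Bd b1.
  have := mean_le y bw (BbplusD bu1 bu2) id0.
  rewrite meanD// !meanZ// mean_h// => q.
  apply: (le_trans (q _)).
    by move=> z; rewrite mulr1; exact: one.
  apply: lerD; last first.
    rewrite ler_wpM2l//; apply: hK; rewrite id0//.
  rewrite -[leRHS]mulrA ler_wpM2l// ler_wpM2r ?(ltW (h_gt0 y))//.
  exact: expR_growth.
rewrite -/e.
apply/ler_addgt0Pl => eps eps0.
(* Enough steps for [d <= T'] and for the accumulated error [B2 * t ^+ 2 * K / m] to be at most
   [eps]. *)
pose m := ((Num.truncn (t / T')).+1 + (Num.truncn (B2 * t ^+ 2 * K / eps)).+1)%N.
have m0 : 0 < m%:R :> R by rewrite ltr0n /m addSn.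
pose d := t / m%:R.
have mE : m%:R * d = t by rewrite /d mulrCA divff ?mulr1// gt_eqF.
have m1 : t / T' <= m%:R.
  apply: (le_trans (ltW (truncnS_gt _))); rewrite ler_nat; exact: leq_addr.
have m2 : B2 * t ^+ 2 * K / eps <= m%:R.
  apply: (le_trans (ltW (truncnS_gt _))); rewrite ler_nat; exact: leq_addl.
have dT' : 0 <= d <= T'.
  by rewrite divr_ge0 ?(ltW m0)//= ler_pdivrMr// mulrC -ler_pdivrMr.
have bg' : below (expR (lambda1 * (m%:R * d))) g.
  split; first by case: bg.
  move=> j y; case: bg => _ gh; apply: (le_trans (gh j y)).
  rewrite ler_wpM2r ?(ltW (h_gt0 y))// ler_wpM2l// expR_decay// mE//.
have := main d m g x dT'; rewrite mE => /(_ tT); rewrite mE in bg'; move=> /(_ bg').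
move=> q; apply: (le_trans q).
have -> : m%:R * (C * kappa * d * e * h x + B2 * d ^+ 2 * K) =
    B2 * t ^+ 2 * K / m%:R + C * kappa * t * e * h x.
  by rewrite /d; have mn : m%:R != 0 :> R by [rewrite gt_eqF]; field.
by rewrite lerD2r ler_pdivrMr// [leRHS]mulrC -ler_pdivrMr.
Qed.

End weighted_family.
End eigenfunction.
End mean_semigroup.

(** * Moments of order r of the fluctuations *)

Section linear_combinations.
Context d (T : measurableType d) (R : realType).
Variables (mu : {measure set T -> \bar R}) (D : set T).
Hypothesis mD : measurable D.

Lemma Rintegral_lincomb (F : nat -> T -> R) (w : nat -> R) n :
  (forall j, mu.-integrable D (EFin \o F j)) ->
  mu.-integrable D (EFin \o (fun x => \sum_(0 <= j < n) w j * F j x)) /\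
  \int[mu]_(x in D) (\sum_(0 <= j < n) w j * F j x) =
  \sum_(0 <= j < n) w j * \int[mu]_(x in D) F j x.
Proof.
move=> iF; elim: n => [|n [IH1 IH2]].
  rewrite (_ : (fun x => _) = cst 0); last by apply/funext => x; rewrite big_nil.
  split; first exact: integrable0.
  by rewrite big_nil Rintegral_cst// mul0r.
have iw : mu.-integrable D (EFin \o (fun x => w n * F n x)).
  exact: (integrableZl mD (w n) (iF n)).
rewrite (_ : (fun x => _) = fun x => \sum_(0 <= j < n) w j * F j x + w n * F n x); last first.
  by apply/funext => x; rewrite big_nat_recr.
split; first exact: (integrableD mD IH1 iw).
by rewrite RintegralD// IH2 RintegralZl// big_nat_recr.
Qed.
End linear_combinations.

Section fluctuation.
Context (R : realType) (E : pmetricType R) (dO : measure_display)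
  (O : measurableType dO) (X : hunt_process E O) (k : branching E).
Variables (V : R -> (E -> R) -> E -> R) (V_def : cumulant_semigroup k X V).
Variables (P : borel (fmeas E) -> probability (path_space E) R)
  (P_def : superprocess V P).
Implicit Types (f g : E -> R) (t s : R) (x : E) (mu nu : fmeas E).
Local Notation mean := (emean P).
Local Notation defect := (defect V P).
Variables (h : E -> R) (lambda1 : R).
Hypotheses (bh : Bbplus h) (h_gt0 : forall x, 0 < h x) (l0 : lambda1 < 0).
Hypothesis mean_h : forall t x, 0 <= t -> mean t h x = expR (- lambda1 * t) * h x.
Variables (r : R) (r_range : 1 < r <= 2) (C1 : R) (C1_ge0 : 0 <= C1).
Hypothesis H_moment : forall x,
  (\int[br_H k x]_(nu in @fmeas0 R E) ((\int[nu]_y h y) `^ r)%:E <= (C1 * h x)%:E)%E.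

Let int_h0 nu : 0 <= \int[nu]_y h y.
Proof. by apply: Rintegral_ge0 => y _; exact: ltW. Qed.

(** The upper bound on the weighted sum, taken at [z = c * nu h] and integrated over the jumps,
    reduces all scales at once to the [r]-th moment. *)
Lemma jump_moment C n (w : nat -> R) c x : 0 < C -> 0 <= c -> (forall j, 0 <= w j) ->
  (forall z, 0 <= z -> \sum_(0 <= j < n) w j * phi (dyad j * z) <= C * z `^ r) ->
  \sum_(0 <= j < n) w j *
    (\int[br_H k x]_(nu in @fmeas0 R E) phi (\int[nu]_y (dyad j * c * h y)))
  <= C * c `^ r * (C1 * h x).
Proof.
move=> C0 c0 w0 wC.
have bj j : Bbplus (fun y => dyad j * c * h y).
  by apply: BbplusM => //; rewrite mulr_ge0// ltW// dyad_gt0.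
have [iS <-] := @Rintegral_lincomb _ _ _ (br_H k x) _ (@measurable_fmeas0 R E) _ w n
  (fun j => @phi_jump_integrable R E k _ x (bj j)).
rewrite -lee_fin EFin_Rintegral//; last exact: measurable_fmeas0.
have Cc0 : 0 <= C * c `^ r by rewrite mulr_ge0 ?powR_ge0// ltW.
have mP : measurable_fun setT (fun nu : borel (fmeas E) => ((\int[nu : fmeas E]_y h y) `^ r)%:E).
  by apply/measurable_EFinP; exact: (measurableT_comp (measurable_powR r) (measurable_fmeas_Rintegral bh)).
apply: (@le_trans _ _ (\int[br_H k x]_(nu in @fmeas0 R E)
    ((C * c `^ r)%:E * ((\int[nu]_y h y) `^ r)%:E))%E).
  apply: ge0_le_integral => //.
  - exact: measurable_fmeas0.
  - by move=> nu _; rewrite lee_fin sumr_ge0// => j _; rewrite mulr_ge0// phi_ge0.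
  - by case/integrableP: iS.
  - by apply: measurable_funeM; exact: measurable_funTS.
  - move=> nu _; rewrite -EFinM lee_fin.
    rewrite -mulrA -powRM// -[leRHS]/(C * _); apply: le_trans (wC _ _); last by rewrite mulr_ge0.
    apply: ler_sum => j _; rewrite ler_wpM2l// (_ : \int[nu]_y _ = dyad j * (c * \int[nu]_y h y))//.
    by rewrite fmeas_RintegralZ ?mulrA//; exact: bh.1.
rewrite ge0_integralZl//=; [|exact: measurable_fmeas0|exact: measurable_funTS|
  by move=> nu _; rewrite lee_fin powR_ge0].
by rewrite [leRHS]EFinM; apply: lee_wpmul2l => //; rewrite lee_fin.
Qed.

(** The jump part is [jump_moment]. For the part in [b] the weights are tested at [z = 1], where
    [phi_lb] bounds the sum of [w j * dyad j ^+ 2] by [4 * C]; one factor [h] is bounded by its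
    supremum, and th^2 is at most th^r because [th <= 1] and [r <= 2]. [K] depends neither on the
    weights nor on their number. *)
Lemma rho_family_bound C L : 0 < C -> 0 <= L -> exists2 K, 0 <= K &
  forall n (w : nat -> R) th x, (forall j, 0 <= w j) ->
  (forall z, 0 <= z -> \sum_(0 <= j < n) w j * phi (dyad j * z) <= C * z `^ r) ->
  0 < th <= 1 ->
  \sum_(0 <= j < n) w j * rho k (fun y => dyad j * (th * L) * h y) x <= K * th `^ r * h x.
Proof.
move=> C0 L0; have [H H0 hH] := BbplusP bh; have [B B0 hB] := BbplusP (br_bP k).
exists (B * L ^+ 2 * H * (4 * C) + C * L `^ r * C1).
  by rewrite addr_ge0 ?mulr_ge0 ?powR_ge0 ?sqr_ge0// ltW.
move=> n w th x w0 wC /andP[th0 th1].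
have tL0 : 0 <= th * L by rewrite mulr_ge0// ltW.
have sq : \sum_(0 <= j < n) w j * dyad j ^+ 2 <= 4 * C.
  have := wC 1 ler01; rewrite powR1 mulr1 => q.
  rewrite -ler_pdivrMl//; apply: le_trans q.
  rewrite mulr_sumr; apply: ler_sum => j _; rewrite mulr1 mulrCA ler_wpM2l//.
  by rewrite mulrC; apply: phi_lb; have := @dyad_le1 R j; lra.
have hx0 := ltW (h_gt0 x).
rewrite (eq_bigr (fun j => br_b k x * h x ^+ 2 * (th * L) ^+ 2 * (w j * dyad j ^+ 2) +
  w j * (\int[br_H k x]_(nu in @fmeas0 R E) phi (\int[nu]_y (dyad j * (th * L) * h y))))); last first.
  by move=> j _; rewrite /rho; ring.
rewrite big_split/= -mulr_sumr.
have b0 : 0 <= br_b k x by apply: Bbplus_ge0; exact: br_bP.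
have th2 : th ^+ 2 <= th `^ r.
  rewrite -powR_mulrn; last exact: ltW.
  by apply: ger_powR; [rewrite th0|case/andP: r_range].
have p1 : br_b k x * h x ^+ 2 * (th * L) ^+ 2 * (\sum_(0 <= j < n) w j * dyad j ^+ 2) <=
    B * L ^+ 2 * H * (4 * C) * th `^ r * h x.
  have q1 : br_b k x * h x ^+ 2 <= B * (H * h x).
    rewrite expr2; apply: ler_pM => //; first by rewrite mulr_ge0.
      by case/andP: (hB x).
    by rewrite ler_wpM2r//; case/andP: (hH x).
  have q2 : (th * L) ^+ 2 <= th `^ r * L ^+ 2 by rewrite exprMn ler_wpM2r// sqr_ge0.
  have s0 : 0 <= \sum_(0 <= j < n) w j * dyad j ^+ 2.
    by apply: sumr_ge0 => j _; rewrite mulr_ge0// sqr_ge0.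
  rewrite (_ : B * L ^+ 2 * H * (4 * C) * th `^ r * h x =
     B * (H * h x) * (th `^ r * L ^+ 2) * (4 * C)); last by ring.
  by apply: ler_pM => //; [rewrite mulr_ge0 ?sqr_ge0// mulr_ge0 ?sqr_ge0|apply: ler_pM => //; rewrite ?sqr_ge0// mulr_ge0 ?sqr_ge0].
have p2 := jump_moment x C0 tL0 w0 wC.
rewrite powRM// in p2; last exact: ltW.
apply: (le_trans (lerD p1 p2)); rewrite le_eqVlt; apply/orP; left; apply/eqP; ring.
Qed.

Lemma centered_phi nu f t c : Bbplus f -> 0 <= t -> 0 <= c ->
  let Z w := mass f t w - \int[nu]_y mean t f y in
  (P nu).-integrable setT (EFin \o (fun w : path_space E => phi (c * Z w))) /\
  \int[P nu]_w phi (c * Z w) = expR (\int[nu]_y defect t (fun y => c * f y) y) - 1.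
Proof.
move=> bf t0 c0 Z; set a := \int[nu]_y mean t f y.
have bcf := BbplusM c0 bf.
pose F1 (w : path_space E) := expR (c * a) * expR (- (c * mass f t w)).
pose F2 (w : path_space E) := c * mass f t w.
pose F3 (w : path_space E) : R := - (1 + c * a).
have i1 : (P nu).-integrable setT (EFin \o F1).
  exact: (integrableZl measurableT (expR (c * a)) (expR_mass_integrable P nu bf t0 c0)).
have i2 : (P nu).-integrable setT (EFin \o F2).
  exact: (integrableZl measurableT c (mass_integrable V_def P_def nu bf t0)).
have i3 : (P nu).-integrable setT (EFin \o F3).
  exact: (finite_measure_integrable_cst (P nu) (- (1 + c * a))).
have e w : phi (c * Z w) = F1 w + F2 w + F3 w.
  rewrite /F1 /F2 /F3 -expRD /phi (_ : - (c * Z w) = c * a + - (c * mass f t w)).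
    by rewrite /Z -/a; ring.
  by rewrite /Z -/a; ring.
have i12 : (P nu).-integrable setT (EFin \o (fun w => F1 w + F2 w)).
  exact: (integrableD measurableT i1 i2).
rewrite (_ : (fun w => _) = fun w => F1 w + F2 w + F3 w); last exact/funext.
split; first exact: (integrableD measurableT i12 i3).
rewrite RintegralD// RintegralD// /F3 Rintegral_probability_cst.
rewrite /F1 RintegralZl//; last exact: (expR_mass_integrable P nu bf t0 c0).
rewrite (laplace P_def)// /F2 RintegralZl//; last exact: (mass_integrable V_def P_def nu bf t0).
rewrite (Rintegral_mass V_def P_def)// -/a -expRD.
rewrite (_ : \int[nu]_y defect t (fun y => c * f y) y = \int[nu]_y (mean t (fun y => c * f y) y - V t (fun y => c * f y) y))// fmeas_RintegralB; last 2 first.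
- exact: (mean_Bbplus V_def P_def bcf t0).1.
- exact: (V_Bbplus V_def bcf t0).1.
rewrite (_ : \int[nu]_y mean t (fun y => c * f y) y = c * a).
  by ring.
rewrite -fmeas_RintegralZ; last exact: (mean_Bbplus V_def P_def bf t0).1.
by apply: eq_Rintegral => y _; rewrite (meanZ V_def P_def).
Qed.

(* [w j * rj j] is bounded and [w j] is [0] or at least [1], hence [rj j] is
   bounded wherever it counts, and there [expR (rj j) - 1] is linear in it. *)
Lemma centered_family_bound f t D C N (w : nat -> R) nu th : 
  Bbplus f -> 0 <= t -> 0 <= th -> 0 <= D ->
  (forall j, w j = 0 \/ 1 <= w j) ->
  (forall y, \sum_(0 <= j < N) w j * defect t (fun z => dyad j * th * f z) y <= D * h y) ->
  D * \int[nu]_y h y <= C ->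
  let Z w := mass f t w - \int[nu]_y mean t f y in
  let S v := \sum_(0 <= j < N) w j * phi (dyad j * (th * Z v)) in
  (P nu).-integrable setT (EFin \o (S : path_space E -> R)) /\
  \int[P nu]_v S v <= C * expR C.
Proof.
move=> bf t0 th0 D0 w01 wD DC Z S.
have w0 j : 0 <= w j by case: (w01 j) => [->//|]; lra.
have cj j : 0 <= dyad j * th by rewrite mulr_ge0// ltW// dyad_gt0.
have bj j : Bbplus (fun y => dyad j * th * f y) by exact: BbplusM.
pose rj j := \int[nu]_y defect t (fun y => dyad j * th * f y) y.
have rj0 j : 0 <= rj j.
  by apply: Rintegral_ge0 => y _; exact: (defect_ge0 V_def P_def).
have bd j : Bbplus (defect t (fun y => dyad j * th * f y)) by exact: (defect_Bbplus V_def P_def).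
have srj : \sum_(0 <= j < N) w j * rj j <= C.
  have [iS <-] := @Rintegral_lincomb _ _ _ nu _ measurableT
    (fun j => defect t (fun y => dyad j * th * f y)) w N (fun j => fmeas_integrable nu (bd j).1).
  apply: le_trans DC; rewrite -fmeas_RintegralZ; last exact: bh.1.
  apply: le_Rintegral => //.
  by apply: fmeas_integrable; exact: (BbplusM D0 bh).1.
have C0 : 0 <= C by apply: le_trans srj; apply: sumr_ge0 => j _; rewrite mulr_ge0.
rewrite (_ : S = fun v => \sum_(0 <= j < N) w j * phi (dyad j * th * Z v)); last first.
  by apply/funext => v; apply: eq_bigr => j _; rewrite mulrA.
have [iS ->] := @Rintegral_lincomb _ _ _ (P nu) _ measurableT
    (fun j v => phi (dyad j * th * Z v)) w N (fun j => (centered_phi nu bf t0 (cj j)).1).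
split=> //; apply: (@le_trans _ _ (\sum_(0 <= j < N) w j * rj j * expR C)); last first.
  by rewrite -mulr_suml ler_wpM2r// expR_ge0.
rewrite big_nat [leRHS]big_nat; apply: ler_sum => j jN.
rewrite (centered_phi nu bf t0 (cj j)).2 -/(rj j).
have [->|wj1] := w01 j; first by rewrite !mul0r.
rewrite -mulrA ler_wpM2l//.
have rjC : rj j <= C.
  apply: le_trans srj; rewrite (bigD1_seq j) ?iota_uniq ?mem_index_iota//=.
  rewrite -[leLHS]addr0 lerD//; first by rewrite ler_peMl.
  by apply: sumr_ge0 => i _; rewrite mulr_ge0.
apply: (@le_trans _ _ (rj j * expR (rj j))); last by rewrite ler_wpM2l// ler_expR.
have e1 : 1 = expR (- rj j) * expR (rj j) by rewrite -expRD addNr expR0.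
have e2 := expR_ge1Dx (- rj j); have e3 := expR_gt0 (rj j).
have : (1 - rj j) * expR (rj j) <= 1 by rewrite {2}e1 ler_pM2r.
by lra.
Qed.

(** Linearity in the [h]-mass of an arbitrary [nu] is the point: the bound will be integrated over
    [nu = X_t], whose expected [h]-mass is known exactly. *)
Lemma fluctuation_bound f c T : Bbplus f -> 0 <= c -> (forall y, f y <= c * h y) -> 0 <= T ->
  exists2 C, 0 <= C & forall t nu, 0 <= t <= T ->
  (\int[P nu]_w (`|mass f t w - \int[nu]_y mean t f y| `^ r)%:E <=
   (C * (1 + \int[nu]_y h y))%:E)%E.
Proof.
move=> bf c0 fch T0.
have [T' [Co [T'0 Co0 occ]]] := occupation_h_short V_def P_def bh h_gt0 l0 mean_h.
have [Cw [Cw0 hw]] := dyadic_weights r_range.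
(* The exponential pays for the margin [expR (lambda1 * T)] that [wdefect_bound] requires of the
   family. *)
pose L := c * expR (- lambda1 * T).
have L0 : 0 <= L by rewrite mulr_ge0// expR_ge0.
have [K K0 hK] := rho_family_bound Cw0 L0.
pose D := Co * K * T * expR (- lambda1 * T).
have D0 : 0 <= D by rewrite !mulr_ge0// expR_ge0.
exists (Cw * (1 + D * expR D)).
  by apply: mulr_ge0; [exact: ltW|rewrite addr_ge0// mulr_ge0// expR_ge0].
move=> t nu /[dup] tT /andP[t0 tT'].
pose A := 1 + \int[nu]_y h y.
have A1 : 1 <= A by rewrite lerDl.
have A0 : 0 < A by exact: lt_le_trans A1.
(* At this scale the centered exponents stay bounded, as [th `^ r * nu(h) <= 1]. *)
pose th := A `^ (- r^-1).
have r1 : 1 < r by case/andP: r_range.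
have r0 : r != 0 by rewrite gt_eqF//; lra.
have thr : th `^ r = A^-1 by rewrite /th -powRrM mulNr mulVf// powR_inv1// ltW.
have th0 : 0 < th by rewrite powR_gt0.
have th1 : th <= 1 by rewrite /th -(powRr0 A) ler_powR// oppr_le0 invr_ge0; lra.
pose Z (w : path_space E) := mass f t w - \int[nu]_y mean t f y.
have mZ : measurable_fun setT Z.
  by apply: measurable_funB => //; exact: measurable_mass.
have mthZ : measurable_fun setT (fun w => th * Z w) by apply: measurable_funM.
have mF : measurable_fun setT (fun w => (`|th * Z w| `^ r)%:E).
  apply/measurable_EFinP; apply: (measurableT_comp (measurable_powR r)).
  exact: measurableT_comp.
(* On [U N] the [N + 1] scales of [dyadic_weights] control the [r]-th power. The constant is the
   same for all [N], so monotone convergence removes the truncation. *)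
pose U N := [set w : path_space E | `|th * Z w| <= 2 ^+ N].
have mU N : measurable (U N).
  rewrite (_ : U N = (fun w => `|th * Z w|) @^-1` `]-oo, (2 ^+ N)]%classic).
    rewrite -[X in measurable X]setTI; apply: (_ : measurable_fun setT _) => //.
    exact: measurableT_comp.
  by apply/seteqP; split => w; rewrite /U/= in_itv.
have main N : (\int[P nu]_(w in U N) (`|th * Z w| `^ r)%:E <= (Cw * (1 + D * expR D))%:E)%E.
  have [w [w01 w1 w2]] := hw N.
  have w0 j : 0 <= w j by case: (w01 j) => [->//|]; lra.
  have Dth : 0 <= D * th `^ r by rewrite mulr_ge0// powR_ge0.
  have hwd y : \sum_(0 <= j < N.+1) w j * defect t (fun z => dyad j * th * f z) y <= D * th `^ r * h y.
    have l0' j : 0 <= dyad j * (th * L) by rewrite !mulr_ge0// ltW// dyad_gt0.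
    have kap0 : 0 <= K * th `^ r by rewrite mulr_ge0// powR_ge0.
    have tth : 0 < th <= 1 by rewrite th0.
    have bg j : Bbplus (fun z => dyad j * th * f z).
      by apply: BbplusM => //; rewrite mulr_ge0// ltW// dyad_gt0.
    have gb j z : dyad j * th * f z <= dyad j * (th * L) * expR (lambda1 * T) * h z.
      rewrite (_ : _ * h z = dyad j * th * (c * h z)).
        by rewrite ler_wpM2l// mulr_ge0// ltW// dyad_gt0.
      have e : expR (- lambda1 * T) * expR (lambda1 * T) = 1.
        by rewrite -expRD mulNr addNr expR0.
      by rewrite /L -[RHS]mulr1 -e; ring.
    have := wdefect_bound V_def P_def bh h_gt0 l0 mean_h w0 l0' kap0
      (fun x => hK _ w th x w0 w1 tth) y T'0 Co0 occ tT (conj bg gb).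
    move=> q; apply: (le_trans q); rewrite ler_wpM2r ?(ltW (h_gt0 y))//.
    rewrite (_ : D * th `^ r = Co * (K * th `^ r) * T * expR (- lambda1 * T)).
      by rewrite ler_wpM2r ?expR_ge0// ler_wpM2l// mulr_ge0.
    by rewrite /D; ring.
  have hDC : D * th `^ r * \int[nu]_y h y <= D.
    rewrite -mulrA ler_piMr// thr mulrC ler_pdivrMr// mul1r /A; lra.
  pose S (v : path_space E) := \sum_(0 <= j < N.+1) w j * phi (dyad j * (th * Z v)).
  have [iS hS] : (P nu).-integrable setT (EFin \o S) /\ \int[P nu]_v S v <= D * expR D.
    exact: (centered_family_bound bf t0 (ltW th0) Dth w01 hwd hDC).
  have S0 v : 0 <= S v by apply: sumr_ge0 => j _; rewrite mulr_ge0// phi_ge0.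
  have iS0 : (P nu).-integrable setT (EFin \o (fun v => 1 + S v)).
    have i1 : (P nu).-integrable setT (EFin \o (fun=> 1 : R)).
      exact: finite_measure_integrable_cst.
    exact: (integrableD measurableT i1 iS).
  have iS1 : (P nu).-integrable setT (EFin \o (fun v => Cw * (1 + S v))).
    exact: (integrableZl measurableT Cw iS0).
  apply: (@le_trans _ _ (\int[P nu]_(v in U N) (Cw * (1 + S v))%:E)%E).
    apply: ge0_le_integral => //.
    - exact: measurable_funTS.
    - by apply: measurable_funTS; case/integrableP: iS1.
    - by move=> v Uv; rewrite lee_fin; exact: w2.
  apply: (@le_trans _ _ (\int[P nu]_v (Cw * (1 + S v))%:E)%E).
    apply: ge0_subset_integral => //; first by case/integrableP: iS1.
    by move=> v _; rewrite lee_fin mulr_ge0 ?addr_ge0// ltW.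
  rewrite -EFin_Rintegral// lee_fin RintegralZl//.
  rewrite ler_wpM2l ?(ltW Cw0)// RintegralD//; last exact: finite_measure_integrable_cst.
  by rewrite Rintegral_probability_cst lerD2l.
have bigU : \bigcup_N U N = setT.
  by apply/seteqP; split => // w _; have [N hN] := dyadic_bound (th * Z w); exists N.
have cv : (\int[P nu]_(w in U N) (`|th * Z w| `^ r)%:E @[N --> \oo] -->
    \int[P nu]_w (`|th * Z w| `^ r)%:E)%E.
  rewrite -bigU; apply: ge0_nondecreasing_set_cvg_integral => //.
  - apply/nondecreasing_seqP => n; apply/subsetPset => w /le_trans; apply.
    by rewrite exprS ler_peMl ?exprn_ge0// ler1n.
  - by move=> n; exact: measurable_funTS.
have fin : (\int[P nu]_w (`|th * Z w| `^ r)%:E <= (Cw * (1 + D * expR D))%:E)%E.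
  by apply: (cvge_le _ cv); exact: nearW.
(* Undoing the scaling costs the inverse of th^r, that is [A], the factor linear in the [h]-mass. *)
rewrite (_ : (\int[P nu]_w _)%E = (A%:E * \int[P nu]_w (`|th * Z w| `^ r)%:E)%E).
  rewrite -/A [X in (_ <= X%:E)%E]mulrC EFinM; apply: lee_wpmul2l => //.
  by rewrite lee_fin ltW.
rewrite -ge0_integralZl//; last by rewrite lee_fin ltW.
apply: eq_integral => w _; rewrite -EFinM; congr EFin.
rewrite normrM powRM// ger0_norm ?(ltW th0)// thr mulrA divff ?mul1r//.
by rewrite gt_eqF.
Qed.
End fluctuation.

(** * Joint laws, maximal inequality and dyadic times *)

Section mixture_measure.
Context d d' (Y : measurableType d) (Z : measurableType d') (R : realType).
Variables (H : {measure set Y -> \bar R}) (kap : Y -> {measure set Z -> \bar R}).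
Hypothesis mkap : forall U, measurable U -> measurable_fun setT (kap ^~ U).
Local Open Scope ereal_scope.

(** Measurability of the kernel is passed as an argument so that the measure structure, which
    depends on it, can be attached to the term [mixture mkap]. *)
Definition mixture (_ : forall U, measurable U -> measurable_fun setT (kap ^~ U))
  (U : set Z) : \bar R := \int[H]_y kap y U.

Let mixture0 : mixture mkap set0 = 0.
Proof. by rewrite /mixture integral0_eq. Qed.

Let mixture_ge0 U : 0 <= mixture mkap U.
Proof. exact: integral_ge0. Qed.

Let mixture_sigma_additive : semi_sigma_additive (mixture mkap).
Proof.
move=> B mB tB mUB; rewrite [X in _ --> X](_ : _ =
    \int[H]_y \sum_(0 <= n <oo) kap y (B n)); last first.
  by apply: eq_integral => y _; rewrite measure_semi_bigcup.
rewrite integral_nneseries//; last by move=> n; exact: mkap.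
by apply: is_cvg_ereal_nneg_natsum => n _; exact: integral_ge0.
Qed.

HB.instance Definition _ := isMeasure.Build _ _ _ (mixture mkap)
  mixture0 mixture_ge0 mixture_sigma_additive.
End mixture_measure.

Section joint_law.
Context d d1 d2 (Om : measurableType d) (T1 : measurableType d1)
  (T2 : measurableType d2) (R : realType).
Variables (H : probability Om R) (a : Om -> T1) (b : Om -> T2)
  (kap : Om -> {measure set T2 -> \bar R}).
Hypotheses (ma : measurable_fun setT a) (mb : measurable_fun setT b).
Hypothesis mkap : forall U, measurable U -> measurable_fun setT (kap ^~ U).
Hypothesis kap_fin : forall w, (kap w setT < +oo)%E.
Hypothesis rect : forall A B, measurable A -> measurable B ->
  H (a @^-1` A `&` b @^-1` B) = (\int[H]_(w in a @^-1` A) kap w B)%E.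
Local Open Scope ereal_scope.

Let mab : measurable_fun setT (fun w => (a w, b w)).
Proof. exact: measurable_fun_pair. Qed.

Let mpair w : measurable_fun setT (fun y : T2 => (a w, y)).
Proof. by apply: measurable_fun_pair => //; exact: measurable_id. Qed.

Let kap2 w : {measure set (T1 * T2) -> \bar R} := image_measure (kap w) (mpair w).

Let mkap2 U : measurable U -> measurable_fun setT (kap2 ^~ U).
Proof.
move=> mU; rewrite (_ : (fun w => _) = fun w => \int[kap w]_(y in setT) (\1_U (a w, y))%:E).
  apply: (@measurable_fun_integral_in _ _ _ _ _ kap setT mkap measurableT kap_fin
    (fun z : Om * T2 => (\1_U (a z.1, z.2))%:E)) => //.
  have m2 : measurable_fun setT (fun z : Om * T2 => (a z.1, z.2)).
    apply: measurable_fun_pair; last exact: measurable_snd.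
    exact: (measurableT_comp ma measurable_fst).
  have mi : measurable_fun setT (\1_U : T1 * T2 -> R) by exact: measurable_indic.
  by apply/measurable_EFinP; exact: (measurableT_comp mi m2).
apply/funext => w; rewrite /kap2 image_measureE.
have mS : measurable ((fun y => (a w, y)) @^-1` U).
  by rewrite -[X in measurable X]setTI; exact: mpair.
transitivity (\int[kap w]_y (\1_((fun y => (a w, y)) @^-1` U) y)%:E) => //.
by rewrite integral_indic// setIT.
Qed.

(** The law of the pair and the mixture of the products of a Dirac mass at [a w] with [kap w] agree
    on rectangles, hence everywhere. The fluctuation compares masses at two times, whereas [markov]
    handles a functional of the later one only. *)
Lemma ge0_integral_joint (F : T1 * T2 -> \bar R) :
  (forall z, 0 <= F z) -> measurable_fun setT F ->
  \int[H]_w F (a w, b w) = \int[H]_w \int[kap w]_y F (a w, y).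
Proof.
move=> F0 mF.
have := @integral_mixture0 _ _ Om _ R (image_measure H mab) H setT kap2 F measurableT mkap2.
rewrite ge0_integral_image// => ->//.
  by apply: eq_integral => w _; rewrite ge0_integral_image.
move=> U mU; rewrite -[RHS]/(mixture H mkap2 U).
apply: (measure_unique [set C | exists A, measurable A /\ exists B, measurable B /\ C = A `*` B]
   (fun=> setT)) => //.
- rewrite measurable_prod_measurableType //; congr (<<s _ >>).
  rewrite predeqE; split => [[A mA [B mB <-]]|[A [mA [B [mB ->]]]]].
    by exists A; split => //; exists B.
  by exists A => //; exists B.
- move=> /= _ _ [X1 [mX1 [X2 [mX2 ->]]]] [Y1 [mY1 [Y2 [mY2 ->]]]].
  rewrite -setXI; exists (X1 `&` Y1); split; first exact: measurableI.
  by exists (X2 `&` Y2); split => //; exact: measurableI.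
- by move=> n; exists setT; split => //; exists setT; rewrite setXTT.
- by rewrite bigcup_const.
- move=> _ [A [mA [B [mB ->]]]]; rewrite /mixture image_measureE.
  rewrite [LHS](_ : _ = H (a @^-1` A `&` b @^-1` B))// rect// [LHS]integral_mkcond.
  apply: eq_integral => w _; rewrite patchE /kap2 image_measureE.
  case: ifPn => [/set_mem Aw|/negP Aw].
    by congr (kap w _); apply/seteqP; split => y //= [].
  rewrite (_ : _ @^-1` _ = set0) ?measure0//.
  by apply/seteqP; split => y //= [/= Aw' _]; apply: Aw; exact/mem_set.
- move=> n; rewrite image_measureE preimage_setT.
  by rewrite [X in X < _]probability_setT ltry.
Qed.
End joint_law.

Section weak_maximal.
Context d (T : measurableType d) (R : realType).
Variables (y : nat -> T -> R) (N : nat) (e : R).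

Definition first_passage j := [set w | e < y j w /\ forall i, (i < j)%N -> y i w <= e].

Let measurable_gt i : measurable_fun setT (y i) -> measurable [set w | e < y i w].
Proof.
move=> my; rewrite (_ : [set w | _] = y i @^-1` `]e, +oo[%classic).
  by rewrite -[X in measurable X]setTI; exact: my.
by apply/seteqP; split => w; rewrite /= in_itv/= andbT.
Qed.

Lemma measurable_first_passage j :
  (forall i, (i <= j)%N -> measurable_fun setT (y i)) -> measurable (first_passage j).
Proof.
move=> my; rewrite (_ : first_passage j =
    [set w | e < y j w] `&` \bigcap_(i in `I_j) ~` [set w | e < y i w]).
  apply: measurableI; first exact/measurable_gt/my.
  by apply: bigcap_measurableType => i /ltnW ij; exact/measurableC/measurable_gt/my.
apply/seteqP; split => w [h1 h2]; split=> // i ij.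
  by move=> /=; apply/negP; rewrite -leNgt h2.
by rewrite leNgt; apply/negP; exact: h2.
Qed.

Variable Q : probability T R.
Hypotheses (e0 : 0 < e) (my : forall j, measurable_fun setT (y j)).

Definition passage := [set w | exists2 j, (j <= N)%N & e < y j w].

Lemma measurable_passage : measurable passage.
Proof.
rewrite (_ : passage = \bigcup_(j in [set j | (j <= N)%N]) [set w | e < y j w]).
  by apply: bigcup_measurable => j _; exact: measurable_gt.
by apply/seteqP; split => w [j jN ey]; exists j.
Qed.

(** Doob's inequality for finitely many times. The submartingale property is asked only on the first
    passage sets with [j <= N], which partition [passage]. *)
Lemma weak_maximal :
  (forall j, (j <= N)%N -> (\int[Q]_(w in first_passage j) (y j w)%:E <=
     \int[Q]_(w in first_passage j) (`|y N w|)%:E)%E) ->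
  (e%:E * Q passage <= \int[Q]_w (`|y N w|)%:E)%E.
Proof.
move=> hyp; pose A j := if (j <= N)%N then first_passage j else set0.
have mA j : measurable (A j) by rewrite /A; case: ifP => // _; by apply: measurable_first_passage => i _.
have tA : trivIset setT A.
  apply/trivIsetP => i j _ _ ij; apply/seteqP; split => // w [].
  rewrite /A; case: ifP => // _; case: ifP => // _ [yi hi] [yj hj].
  have [ij'|ji|/eqP] := ltngtP i j; last by rewrite (negbTE ij).
    by have := hj _ ij'; rewrite leNgt yi.
  by have := hi _ ji; rewrite leNgt yj.
have UA : passage = \bigcup_j A j.
  apply/seteqP; split => w.
    case=> j jN ey; have ex : exists n, e < y n w by exists j.
    exists (ex_minn ex) => //; case: ex_minnP => n yn hn; rewrite /A.
    rewrite (leq_trans (hn _ ey) jN); split=> // i ni.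
    by rewrite leNgt; apply/negP => /hn; rewrite leqNgt ni.
  by move=> [j _]; rewrite /A; case: ifPn => // jN [yj _]; exists j.
have mN : measurable_fun setT (fun w => (`|y N w|)%:E).
  by apply/measurable_EFinP; exact: measurableT_comp.
rewrite UA measure_semi_bigcup//; last exact: bigcup_measurable.
apply: (@le_trans _ _ (\int[Q]_(w in \bigcup_j A j) (`|y N w|)%:E)%E); last first.
  by apply: ge0_subset_integral => //; exact: bigcup_measurable.
rewrite ge0_integral_bigcup//; last exact: measurable_funTS.
rewrite -nneseriesZl//; apply: lee_nneseries => j _; first by rewrite mule_ge0// lee_fin ltW.
rewrite /A; case: ifPn => jN; last by rewrite measure0 mule0 integral_set0.
apply: le_trans (hyp j jN); rewrite -integral_cst; last by apply: measurable_first_passage => i _.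
apply: ge0_le_integral => //; first by apply: measurable_first_passage => i _.
- by move=> w _; rewrite lee_fin ltW.
- by apply/measurable_EFinP; exact: measurable_funTS.
- by move=> w [yw _]; rewrite lee_fin ltW.
Qed.
End weak_maximal.

Section dyadic_times.
Context (R : realType).
Implicit Types (y : R -> R).

(** Convergence at infinity tested on countably many times and tolerances, so that it defines a
    measurable event. *)
Definition dyadic_cauchy y := forall k : nat, exists N : nat, forall j K j' K' : nat,
  N%:R <= j%:R * dyad K :> R -> N%:R <= j'%:R * dyad K' :> R ->
  `|y (j%:R * dyad K) - y (j'%:R * dyad K')| <= k.+1%:R^-1.

Lemma dyadic_between (a b : R) : 0 <= a -> a < b -> exists j K : nat, a < j%:R * dyad K < b.
Proof.
move=> a0 ab; have d0 : 0 < b - a by rewrite subr_gt0.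
have := @cvg_dyad R => /cvgrPdist_lt /(_ _ d0) [K _ /(_ K (leqnn K))].
rewrite sub0r normrN gtr0_norm ?dyad_gt0// => dK.
exists (Num.truncn (a / dyad K)).+1, K.
have dK0 := @dyad_gt0 R K.
rewrite -ltr_pdivrMr// truncnS_gt/=.
have : (Num.truncn (a / dyad K))%:R <= a / dyad K by rewrite truncn_le// divr_ge0// ltW.
rewrite ler_pdivlMr// -natr1 mulrDl mul1r; lra.
Qed.

Lemma right_cvg_between y t e : 0 <= t -> y s @[s --> t^'+] --> y t -> 0 < e ->
  exists j K : nat, t < j%:R * dyad K /\ `|y t - y (j%:R * dyad K)| < e.
Proof.
move=> t0 /cvgrPdist_lt yt e0; have [d /= d0 hd] := yt _ e0.
have td : t < t + d by rewrite ltrDl.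
have [j [K /andP[h1 h2]]] := dyadic_between t0 td.
exists j, K; split => //; apply: hd => //.
by rewrite /ball_/= ltr0_norm ?subr_lt0//; lra.
Qed.

(** Right continuity puts just after any real time a dyadic one with almost the same value; two such
    replacements and the dyadic bound account for the factor 3. *)
Lemma dyadic_cauchy_cvg y : (forall t, 0 <= t -> y s @[s --> t^'+] --> y t) ->
  cvg (y t @[t --> +oo]) <-> dyadic_cauchy y.
Proof.
move=> yr; split.
  move=> /cvg_ex[l] /cvgrPdist_lt yl k.
  have e0 : 0 < (k.+1%:R^-1 / 2 : R) by rewrite divr_gt0// invr_gt0.
  have [A [_ hA]] := yl _ e0.
  exists (Num.truncn `|A|).+1 => j K j' K' h1 h2.
  have A' : A < (Num.truncn `|A|).+1%:R by apply: (le_lt_trans (ler_norm A)); exact: truncnS_gt.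
  have g1 := hA _ (lt_le_trans A' h1); have g2 := hA _ (lt_le_trans A' h2).
  move: g1 g2; move: (k.+1%:R^-1 : R) => c /=.
  by rewrite !ltr_norml => /andP[? ?] /andP[? ?]; rewrite ler_norml; lra.
move=> cy.
have main k : exists N : nat, forall s t, N%:R <= s -> N%:R <= t -> `|y s - y t| <= 3 * k.+1%:R^-1.
  have [N hN] := cy k; exists N => s t Ns Nt.
  have s0 : 0 <= s by apply: le_trans Ns.
  have t0 : 0 <= t by apply: le_trans Nt.
  have e0 : 0 < (k.+1%:R^-1 : R) by rewrite invr_gt0.
  have [j [K [h1 g1]]] := right_cvg_between s0 (yr _ s0) e0.
  have [j' [K' [h2 g2]]] := right_cvg_between t0 (yr _ t0) e0.
  have := hN j K j' K' (le_trans Ns (ltW h1)) (le_trans Nt (ltW h2)).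
  move: g1 g2; move: (k.+1%:R^-1 : R) => c.
  by rewrite !ltr_norml !ler_norml => /andP[? ?] /andP[? ?] /andP[? ?]; lra.
apply/cauchy_cvgP; apply: cauchy_exP => e e0.
pose k := Num.truncn (3 / e); have ke : 3 * k.+1%:R^-1 < e.
  rewrite ltr_pdivrMr// mulrC -ltr_pdivrMr//; exact: truncnS_gt.
have [N hN] := main k; exists (y N%:R); exists N%:R; split => //= t Nt.
by rewrite /ball/= (le_lt_trans _ ke)// hN// ltW.
Qed.

(** A dyadic time is its integer part [q] plus a remainder below 1: the remainder costs [rho ^+ q],
    the integer steps from [n] to [q] a geometric sum. Both are at most [rho ^+ n / (1 - rho)],
    whence the constant [2 / (1 - rho)]. *)
Lemma dyadic_cauchy_geometric y rho : 0 < rho < 1 ->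
  (exists N : nat, forall n j K : nat, (N <= n)%N -> (j <= 2 ^ K)%N ->
    `|y (n%:R + j%:R * dyad K) - y n%:R| <= rho ^+ n) -> dyadic_cauchy y.
Proof.
move=> /[dup] r01 /andP[r0 r1] [N hN].
have r1' : 0 < 1 - rho by rewrite subr_gt0.
have step n : (N <= n)%N -> `|y n.+1%:R - y n%:R| <= rho ^+ n.
  move=> Nn; have := hN n 1%N 0%N Nn (leqnn _).
  by rewrite /dyad expr0 invr1 mulr1 natr1.
have steps n m : (N <= n)%N -> `|y (n + m)%:R - y n%:R| <= \sum_(n <= i < n + m) rho ^+ i.
  move=> Nn; elim: m => [|m IH]; first by rewrite addn0 subrr normr0 big_geq.
  rewrite addnS big_nat_recr ?leq_addr//=.
  rewrite (_ : y _ - y n%:R = (y (n + m).+1%:R - y (n + m)%:R) + (y (n + m)%:R - y n%:R)); last by ring.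
  rewrite addrC; apply: (le_trans (ler_normD _ _)); apply: lerD => //.
  by apply: step; rewrite (leq_trans Nn)// leq_addr.
have all n j K : (N <= n)%N -> n%:R <= j%:R * dyad K :> R ->
    `|y (j%:R * dyad K) - y n%:R| <= rho ^+ n * (2 / (1 - rho)).
  move=> Nn nj; have d0 : 0 < 2 ^+ K :> R by rewrite exprn_gt0.
  pose q := (j %/ 2 ^ K)%N; pose i := (j %% 2 ^ K)%N.
  have jE : j%:R * dyad K = q%:R + i%:R * dyad K :> R.
    rewrite [in LHS](divn_eq j (2 ^ K)) natrD natrM natrX mulrDl -/q -/i; congr (_ + _).
    by rewrite /dyad mulfK// gt_eqF.
  have nq : (n <= q)%N.
    rewrite leq_divRL ?expn_gt0//.
    by rewrite -(ler_nat R) natrM natrX -ler_pdivlMr.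
  have h1 : `|y (j%:R * dyad K) - y q%:R| <= rho ^+ q.
    by rewrite jE; apply: hN; rewrite ?(leq_trans Nn)// ltnW// ltn_pmod// expn_gt0.
  have h2 : `|y q%:R - y n%:R| <= rho ^+ n / (1 - rho).
    rewrite -(subnKC nq); apply: (le_trans (steps _ _ Nn)).
    exact: geometric_sum_lt1.
  have h3 : rho ^+ q <= rho ^+ n by rewrite ler_wiXn2l// ltW.
  have h4 : rho ^+ n <= rho ^+ n / (1 - rho).
    by rewrite ler_peMr ?exprn_ge0 ?ltW// invf_cp1//; lra.
  rewrite (_ : y _ - y n%:R = (y (j%:R * dyad K) - y q%:R) + (y q%:R - y n%:R)); last by ring.
  apply: (le_trans (ler_normD _ _)); apply: (le_trans (lerD h1 h2)); lra.
move=> k.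
have e0 : 0 < (k.+1%:R^-1 / 2 * ((1 - rho) / 2) : R) by rewrite mulr_gt0// divr_gt0// invr_gt0.
have cr : rho ^+ n @[n --> \oo] --> 0 by apply: cvg_expr; rewrite ger0_norm// ltW.
have /cvgrPdist_lt /(_ _ e0) [M _ hM] := cr.
pose n := maxn N M; exists n => j K j' K' h1 h2.
have hn : rho ^+ n * (2 / (1 - rho)) <= k.+1%:R^-1 / 2.
  have rn0 : 0 <= rho ^+ n by rewrite exprn_ge0// ltW.
  have := hM n (leq_maxr N M); rewrite sub0r normrN ger0_norm// => /ltW q.
  rewrite -ler_pdivlMr ?divr_gt0//; apply: (le_trans q).
  by rewrite le_eqVlt; apply/orP; left; apply/eqP; rewrite invf_div.
have g1 := le_trans (all n j K (leq_maxl N M) h1) hn.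
have g2 := le_trans (all n j' K' (leq_maxl N M) h2) hn.
move: g1 g2; move: (k.+1%:R^-1 : R) => c.
by rewrite !ler_norml => /andP[? ?] /andP[? ?]; lra.
Qed.
End dyadic_times.

(** * Ergodicity and the eigenfunction *)

Lemma triangle_gap (R : realType) (a b c u v : R) :
  `|b - c| <= v -> b <= a + u -> a <= b + u -> `|a - c| <= u + v.
Proof. by rewrite !ler_norml => /andP[? ?] ? ?; apply/andP; split; lra. Qed.

Section ergodicity.
Context (R : realType) (E : pmetricType R) (m : {measure set (borel E) -> \bar R})
  (dO : measure_display) (O : measurableType dO) (X : hunt_process E O) (k : branching E).
Variables (V : R -> (E -> R) -> E -> R) (V_def : cumulant_semigroup k X V).
Variables (P : borel (fmeas E) -> probability (path_space E) R)
  (P_def : superprocess V P).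
Variables (M : R -> (E -> R) -> E -> R) (M_def : mean_semigroup k X M)
  (q : R -> E -> E -> R) (q_density : transition_density m M q).
Variables (lambda1 : R) (h hh : E -> R).
Hypotheses (bh : Bbplus h) (mhh : Borel_fun hh).
Hypotheses (h_gt0 : forall x, 0 < h x) (hh_gt0 : forall x, 0 < hh x)
  (h_hh : ip m h hh = 1).
Hypothesis q_ergodic : ereal_sup [set ess_sup m
       (fun y => `|expR (lambda1 * t) / (h x * hh y) * q t x y - 1|%:E)
       | x in [set: E]] @[t --> +oo] --> 0%E.
Implicit Types (f g : E -> R) (t s : R) (x : E).
Local Notation mean := (emean P).

Lemma mean_semigroupE t f x : Bbplus f -> 0 <= t -> M t f x = mean t f x.
Proof.
move=> bf t0; have [_ u] := M_def bf.1.
by rewrite (u _ (mean_is_solution V_def P_def bf) t x t0).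
Qed.

Lemma ergodic_density e : 0 < e -> exists2 T, 0 < T & forall t x, T <= t ->
  \forall y \ae m, `|expR (lambda1 * t) * q t x y - h x * hh y| <= e * (h x * hh y).
Proof.
move=> e0; have ne : nbhs (0%E : \bar R) [set z | (z < e%:E)%E].
  by apply: open_nbhs_nbhs; split; [exact: open_ereal_lt_ereal|rewrite /= lte_fin].
have [A [_ hA]] := q_ergodic ne.
exists (`|A| + 1); first by rewrite ltr_wpDl.
move=> t x At; have At' : A < t by have := ler_norm A; lra.
have := hA _ At'; rewrite /=; set S := ereal_sup _ => Se.
have := ess_sup_ge m (fun y => `|expR (lambda1 * t) / (h x * hh y) * q t x y - 1|%:E).
apply: filterS => y hy.
have hxy : 0 < h x * hh y by rewrite mulr_gt0.
have : (`|expR (lambda1 * t) / (h x * hh y) * q t x y - 1|%:E <= e%:E)%E.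
  apply: (le_trans hy); apply: le_trans (ltW Se).
  by apply: ereal_sup_ubound; exists x.
rewrite lee_fin => h1.
rewrite (_ : _ - h x * hh y = (expR (lambda1 * t) / (h x * hh y) * q t x y - 1) * (h x * hh y)).
  by rewrite normrM (gtr0_norm hxy) ler_wpM2r// ltW.
by have hn : h x * hh y != 0 by [rewrite gt_eqF]; field; move: hn; rewrite mulf_eq0 negb_or andbC.
Qed.

Lemma h_hh_integrable : m.-integrable setT (EFin \o (fun y => h y * hh y)).
Proof.
have mf : measurable_fun setT (fun y : borel E => h y * hh y).
  by apply: measurable_funM => //; exact: bh.1.1.
apply/integrableP; split; first exact/measurable_EFinP.
rewrite (_ : (\int[m]_x _)%E = (\int[m]_x (h x * hh x)%:E)%E); last first.
  by apply: eq_integral => x _ /=; rewrite ger0_norm// mulr_ge0// ltW.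
have := h_hh; rewrite /ip /Rintegral.
have : (0 <= \int[m]_x (h x * hh x)%:E)%E.
  by apply: integral_ge0 => x _; rewrite lee_fin mulr_ge0// ltW.
case: (\int[m]_x _)%E => [r _ _|_ /= /eqP|//]; first exact: ltry.
by rewrite eq_sym oner_eq0.
Qed.

Lemma f_hh_integrable f c : Bbplus f -> (forall y, f y <= c * h y) ->
  m.-integrable setT (EFin \o (fun y => f y * hh y)).
Proof.
move=> bf fc; apply: le_integrable (integrableZl measurableT c h_hh_integrable) => //.
  by apply/measurable_EFinP; apply: measurable_funM => //; exact: bf.1.1.
move=> y _; rewrite /= lee_fin ger0_norm ?mulr_ge0 ?(Bbplus_ge0 y bf) ?(ltW (hh_gt0 y))//.
by apply: le_trans (ler_norm _); rewrite mulrA ler_wpM2r// ltW.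
Qed.

Lemma measurable_density t x : 0 < t -> Borel_fun (q t x).
Proof.
move=> t0; have [mq _ _] := q_density.
apply: (@measurable_comp _ _ _ _ _ _ [set z : R * (borel E * borel E) | 0 < z.1]
  (fun z : R * (borel E * borel E) => q z.1 z.2.1 z.2.2) _
  (fun y : borel E => (t, ((x : borel E), y)))) => //.
- rewrite (_ : [set z | _] = `]0, +oo[%classic `*` setT); first exact: measurableX.
  by apply/seteqP; split => z /=; rewrite in_itv/= andbT; [split|case].
- by move=> _ [y _ <-].
- apply: measurable_fun_pair => //; exact: measurable_fun_pair.
Qed.

Lemma ergodic_mean e : 0 < e -> exists2 T, 0 < T & forall t f c x, T <= t ->
  Bbplus f -> (forall y, f y <= c * h y) ->
  `|expR (lambda1 * t) * mean t f x - h x * ip m f hh| <= e * h x * ip m f hh.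
Proof.
(* The cap at 1 keeps the lower density [(1 - e') * (h x * hh y)] nonnegative, so both comparisons
   are between nonnegative integrals; the upper one then shows that the middle integral is
   finite. *)
move=> e0; pose e' := Num.min e 1.
have e'0 : 0 < e' by rewrite lt_min e0 ltr01.
have e'1 : e' <= 1 by rewrite ge_min lexx orbT.
have e'e : e' <= e by rewrite ge_min lexx.
have [T T0 hT] := ergodic_density e'0; exists T => // t f c x Tt bf fc.
have t0 : 0 < t by exact: lt_le_trans Tt.
have [_ q0 qM] := q_density.
have fi := f_hh_integrable bf fc; set B := ip m f hh.
have fB : (\int[m]_y (f y * hh y)%:E = B%:E)%E by rewrite /B /ip EFin_Rintegral.
have B0 : 0 <= B by apply: Rintegral_ge0 => y _; rewrite mulr_ge0 ?(Bbplus_ge0 y bf) ?ltW.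
have f0 y := Bbplus_ge0 y bf.
have mqf : measurable_fun setT (fun y : borel E => (q t x y * f y)%:E).
  by apply/measurable_EFinP; apply: measurable_funM; [exact: measurable_density|exact: bf.1.1].
have mfh : measurable_fun setT (fun y : borel E => (f y * hh y)%:E).
  by apply/measurable_EFinP; apply: measurable_funM => //; exact: bf.1.1.
have mE : mean t f x = fine (\int[m]_y (q t x y * f y)%:E)%E.
  by rewrite -(mean_semigroupE x bf (ltW t0)) (qM _ _ _ t0 bf.1).
have hx0 := ltW (h_gt0 x); have Ex0 := expR_ge0 (lambda1 * t).
have I0 : (0 <= \int[m]_y (q t x y * f y)%:E)%E.
  by apply: integral_ge0 => y _; rewrite lee_fin mulr_ge0// q0.
have ub : ((expR (lambda1 * t))%:E * \int[m]_y (q t x y * f y)%:E <= (((1 + e') * h x) * B)%:E)%E.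
  have c0 : 0 <= (1 + e') * h x by rewrite mulr_ge0// addr_ge0// ltW.
  rewrite EFinM -fB -!ge0_integralZl//; last 2 first.
  - by move=> y _; rewrite lee_fin mulr_ge0 ?f0 ?ltW.
  - by move=> y _; rewrite lee_fin mulr_ge0 ?f0 ?q0.
  apply: ae_ge0_le_integral => //.
  - by move=> y _; rewrite -EFinM lee_fin !mulr_ge0// q0.
  - exact: measurable_funeM.
  - by move=> y _; rewrite -EFinM lee_fin !mulr_ge0 ?(ltW (hh_gt0 y))// addr_ge0// ltW.
  - exact: measurable_funeM.
  apply: (@filterS _ _ (ae_filter_ringOfSetsType m) _ _ _ (hT t x Tt)) => y hy _.
  rewrite -!EFinM lee_fin.
  rewrite (_ : _ * (q t x y * f y) = (expR (lambda1 * t) * q t x y) * f y); last by ring.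
  rewrite (_ : _ * (f y * hh y) = ((1 + e') * (h x * hh y)) * f y); last by ring.
  by rewrite ler_wpM2r//; move: hy; rewrite ler_norml => /andP[_ ?]; lra.
have lb : ((((1 - e') * h x) * B)%:E <= (expR (lambda1 * t))%:E * \int[m]_y (q t x y * f y)%:E)%E.
  have c0 : 0 <= (1 - e') * h x by rewrite mulr_ge0// subr_ge0.
  rewrite EFinM -fB -!ge0_integralZl//; last 2 first.
  - by move=> y _; rewrite lee_fin mulr_ge0 ?f0 ?q0.
  - by move=> y _; rewrite lee_fin mulr_ge0 ?f0 ?ltW.
  apply: ae_ge0_le_integral => //.
  - by move=> y _; rewrite -EFinM lee_fin !mulr_ge0 ?(ltW (hh_gt0 y))// subr_ge0.
  - exact: measurable_funeM.
  - by move=> y _; rewrite -EFinM lee_fin !mulr_ge0// q0.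
  - exact: measurable_funeM.
  apply: (@filterS _ _ (ae_filter_ringOfSetsType m) _ _ _ (hT t x Tt)) => y hy _.
  rewrite -!EFinM lee_fin.
  rewrite (_ : _ * (q t x y * f y) = (expR (lambda1 * t) * q t x y) * f y); last by ring.
  rewrite (_ : _ * (f y * hh y) = ((1 - e') * (h x * hh y)) * f y); last by ring.
  by rewrite ler_wpM2r//; move: hy; rewrite ler_norml => /andP[? _]; lra.
have If : (\int[m]_y (q t x y * f y)%:E)%E \is a fin_num.
  rewrite ge0_fin_numE// ltNge leye_eq; apply/negP => /eqP e2.
  by move: ub; rewrite e2 gt0_muley ?lte_fin ?expR_gt0.
move: ub lb; rewrite mE -(fineK If) -EFinM !lee_fin.
set a := expR _ * _ => ub lb.
apply: (@le_trans _ _ (e' * h x * B)); last by rewrite !ler_wpM2r.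
by rewrite ler_norml; apply/andP; split; lra.
Qed.

(** For large [s] the rescaled mean of [h] at time [s + t] is within relative error [e] of [h]. It
    is also [expR (lambda1 * t)] times [mean t] of a function within relative error [e] of [h].
    Comparing the two and letting [e] vanish gives an exact identity at every [t], not an asymptotic
    one. *)
Lemma mean_eigenfunction t x : 0 <= t -> mean t h x = expR (- lambda1 * t) * h x.
Proof.
move=> t0.
suff : `|expR (lambda1 * t) * mean t h x - h x| <= 0.
  rewrite normr_le0 subr_eq0 => /eqP e1.
  by rewrite -[in RHS]e1 mulrA -expRD mulNr addNr expR0 mul1r.
set a := expR (lambda1 * t) * mean t h x.
have a0 : 0 <= a by rewrite mulr_ge0 ?expR_ge0//; apply: mean_ge0 => y; exact: ltW.
have hx0 := ltW (h_gt0 x).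
have main e : 0 < e -> `|a - h x| <= e * (a + h x).
  move=> e0; have [s s0 hs] := ergodic_mean e0.
  have s0' := ltW s0.
  have hc y : h y <= 1 * h y by rewrite mul1r.
  have st : s <= s + t by rewrite lerDl.
  have := hs _ _ _ x st bh hc; rewrite h_hh !mulr1 => h1.
  have h2 y := hs _ _ _ y (lexx s) bh hc.
  have bms := mean_Bbplus V_def P_def bh s0'.
  have bE := BbplusM (expR_ge0 (lambda1 * s)) bms.
  have beh := BbplusM (ltW e0) bh.
  have mE : mean t (fun y => expR (lambda1 * s) * mean s h y) x =
      expR (lambda1 * s) * mean (s + t) h x.
    rewrite (meanZ V_def P_def x bms (expR_ge0 _) t0).
    by rewrite -(mean_semi V_def P_def x bh t0 s0') [t + s]addrC.
  have mD : mean t (fun y => h y + e * h y) x = mean t h x + e * mean t h x.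
    by rewrite (meanD V_def P_def)// (meanZ V_def P_def)// ltW.
  have g1 : expR (lambda1 * s) * mean (s + t) h x <= mean t h x + e * mean t h x.
    rewrite -mE -mD; apply: (mean_le V_def P_def) => //; first exact: BbplusD.
    by move=> y; have := h2 y; rewrite h_hh !mulr1 ler_norml lerBlDl => /andP[].
  have g2 : mean t h x <= expR (lambda1 * s) * mean (s + t) h x + e * mean t h x.
    rewrite -mE -(meanZ V_def P_def x bh (ltW e0) t0) -(meanD V_def P_def x bE beh t0).
    apply: (mean_le V_def P_def) => //; first exact: BbplusD.
    by move=> y; have := h2 y; rewrite h_hh !mulr1 ler_norml lerBrDl lerBlDr => /andP[].
  have Et : expR (lambda1 * (s + t)) = expR (lambda1 * t) * expR (lambda1 * s).
    by rewrite -expRD; congr expR; ring.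
  have E0 := expR_ge0 (lambda1 * t).
  have g1' := ler_wpM2l E0 g1; have g2' := ler_wpM2l E0 g2.
  move: h1 g1' g2'; rewrite Et !mulrDr.
  have Ea : expR (lambda1 * t) * (e * mean t h x) = e * a by rewrite mulrCA.
  rewrite Ea.
  by rewrite -/a mulrA; exact: triangle_gap.
apply/ler_addgt0Pl => e e0; rewrite addr0.
have d0 : 0 < e / (a + h x + 1) by rewrite divr_gt0// ltr_wpDl// addr_ge0.
apply: (le_trans (main _ d0)); rewrite mulrAC ler_pdivrMr; last by rewrite ltr_wpDl// addr_ge0.
by rewrite ler_wpM2l ?ltW//; lra.
Qed.
End ergodicity.

(** * The martingale and its limit *)

Section Lr_norm.
Context d (T : measurableType d) (R : realType) (Q : {measure set T -> \bar R}).
Variable r : R.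
Hypothesis r1 : 1 < r.
Implicit Types Y : T -> R.
Local Notation N Y := ('N[Q]_(r%:E)[EFin \o Y])%E.

Let r_gt0 : 0 < r. Proof. exact: lt_trans r1. Qed.
Let r0 : r != 0. Proof. by rewrite gt_eqF. Qed.
Let inoo (x : \bar R) : (0 <= x)%E -> x \in `[0%E, +oo%E].
Proof. by move=> x0; rewrite in_itv/= x0 leey. Qed.

Lemma measurable_powR_norm Y : measurable_fun setT Y ->
  measurable_fun setT (fun w => (`|Y w| `^ r)%:E).
Proof.
move=> mY; apply/measurable_EFinP; apply: (measurableT_comp (measurable_powR r)).
exact: measurableT_comp.
Qed.

Lemma Lnorm_leP Y K : 0 <= K ->
  (N Y <= K%:E)%E <-> (\int[Q]_w (`|Y w| `^ r)%:E <= (K `^ r)%:E)%E.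
Proof.
move=> K0; rewrite (_ : (\int[Q]_w (`|Y w| `^ r)%:E)%E = (N Y `^ r)%E); last first.
  by rewrite poweR_Lnorm.
have rr : (r * r^-1 = 1)%R by rewrite divff.
split=> h.
  rewrite -poweR_EFin; apply: gt0_ler_poweR => //; first exact: ltW.
  - exact/inoo/Lnorm_ge0.
  - exact: inoo.
have : ((N Y `^ r) `^ r^-1 <= (K `^ r)%:E `^ r^-1)%E.
  apply: gt0_ler_poweR => //; first by rewrite invr_ge0 ltW.
  - exact/inoo/poweR_ge0.
  - by apply: inoo; rewrite lee_fin powR_ge0.
by rewrite -poweRrM rr poweRe1 ?Lnorm_ge0// poweR_EFin -powRrM rr powRr1.
Qed.

Lemma Lnorm_root Y K : 0 <= K -> (\int[Q]_w (`|Y w| `^ r)%:E <= K%:E)%E ->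
  (N Y <= (K `^ r^-1)%:E)%E.
Proof.
by move=> K0 h; apply/Lnorm_leP; rewrite ?powR_ge0// -powRrM mulVf// powRr1.
Qed.

Lemma Lnorm_add Y1 Y2 K1 K2 : measurable_fun setT Y1 -> measurable_fun setT Y2 ->
  (N Y1 <= K1%:E -> N Y2 <= K2%:E -> N (fun w => (Y1 w + Y2 w)%R) <= (K1 + K2)%:E)%E.
Proof.
move=> m1 m2 h1 h2; apply: (le_trans (minkowski_EFin Q m1 m2 (ltW r1))).
by rewrite EFinD leeD.
Qed.

Lemma le_Lnorm Y1 Y2 : measurable_fun setT Y1 -> measurable_fun setT Y2 ->
  (forall w, `|Y1 w| <= `|Y2 w|) -> (N Y1 <= N Y2)%E.
Proof.
move=> m1 m2 h; rewrite unlock; apply: gt0_ler_poweR => //.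
- by rewrite invr_ge0 ltW.
- by apply: inoo; apply: integral_ge0 => w _; exact: poweR_ge0.
- by apply: inoo; apply: integral_ge0 => w _; exact: poweR_ge0.
apply: ge0_le_integral => //.
- by move=> w _; exact: poweR_ge0.
- exact: measurable_powR_norm.
- exact: measurable_powR_norm.
- by move=> w _; rewrite /= lee_fin ge0_ler_powR// ltW.
Qed.

Lemma Lnorm_scale Y c K : measurable_fun setT Y -> 0 <= K -> (N Y <= K%:E)%E ->
  (N (fun w => (c * Y w)%R) <= (`|c| * K)%:E)%E.
Proof.
move=> mY K0 /(Lnorm_leP _ K0) h; apply/Lnorm_leP; first by rewrite mulr_ge0.
rewrite (_ : (\int[Q]_w _)%E = ((`|c| `^ r)%:E * \int[Q]_w (`|Y w| `^ r)%:E)%E).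
  by rewrite powRM// [leRHS]EFinM; apply: lee_wpmul2l => //; rewrite lee_fin powR_ge0.
rewrite -ge0_integralZl//.
- by apply: eq_integral => w _; rewrite normrM powRM// EFinM.
- exact: measurable_powR_norm.
Qed.

Lemma powR_cvg (u : nat -> R) y : (forall n, 0 <= u n) -> u n @[n --> \oo] --> y ->
  u n `^ r @[n --> \oo] --> y `^ r.
Proof.
move=> u0 uy; have y0 : 0 <= y.
  by rewrite -(cvg_lim _ uy)//; apply: limr_ge; [exact: cvgP uy|exact: nearW].
(* The limit 0 is treated apart, as powers are given by a logarithm at positive numbers; there
   [r > 1] makes the power no larger than [u n] once [u n <= 1]. *)
move: y0; rewrite le_eqVlt => /predU1P[ye|y0].
  rewrite -ye powR0//; move: uy; rewrite -ye => uy.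
  apply: (@squeeze_cvgr _ _ _ _ (fun=> 0) u) => //; last exact: cvg_cst.
  near=> n; rewrite powR_ge0/=.
  have un1 : u n <= 1.
    near: n; have /cvgrPdist_le /(_ _ ltr01) := uy; apply: filterS => n.
    by rewrite sub0r normrN ger0_norm.
  have := u0 n; rewrite le_eqVlt => /predU1P[<-|un0]; first by rewrite powR0.
  by apply: ge1r_powR; [rewrite un0|exact: ltW].
have -> : y `^ r = expR (r * ln y) by rewrite /powR gt_eqF.
have c : expR (r * ln (u n)) @[n --> \oo] --> expR (r * ln y).
  apply: (continuous_cvg _ (@continuous_expR R _)); apply: cvgMr.
  exact: (continuous_cvg _ (continuous_ln y0) uy).
apply: cvg_trans c; apply: near_eq_cvg; near=> n.
rewrite /powR ifF//; apply/negbTE; rewrite gt_eqF//; near: n.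
exact: (cvgr_gt _ uy).
Unshelve. all: by end_near. Qed.

Lemma Lnorm_Fatou (Y_ : nat -> T -> R) Y K : 0 <= K ->
  (forall n, measurable_fun setT (Y_ n)) -> measurable_fun setT Y ->
  (\forall w \ae Q, Y_ n w @[n --> \oo] --> Y w) ->
  (forall n, N (Y_ n) <= K%:E)%E -> (N Y <= K%:E)%E.
Proof.
move=> K0 mY_ mY cv hK; apply/Lnorm_leP => //.
pose F n w := (`|Y_ n w| `^ r)%:E.
have mF n : measurable_fun setT (F n) by exact: measurable_powR_norm.
have F0 n w : (0 <= F n w)%E by rewrite lee_fin powR_ge0.
have ml : measurable_fun setT (fun w => limn_einf (F ^~ w)).
  by apply: measurableT_comp => //; apply: measurable_fun_limn_esup => n; exact: measurableT_comp.
apply: (@le_trans _ _ (\int[Q]_w limn_einf (F ^~ w))%E).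
  rewrite le_eqVlt; apply/orP; left; apply/eqP; apply: ae_eq_integral => //.
    exact: measurable_powR_norm.
  apply: (@filterS _ _ (ae_filter_ringOfSetsType Q) _ _ _ cv) => w hw _.
  have c1 : F n w @[n --> \oo] --> (`|Y w| `^ r)%:E.
    apply: cvg_EFin; first exact: nearW.
    by apply: powR_cvg => //; exact: cvg_norm.
  by rewrite (cvg_limn_einf_sup c1).1.
apply: (le_trans (fatou Q measurableT mF _)); first by move=> n w _; exact: F0.
apply: (le_trans (limn_einf_sup _)); rewrite limn_esup_lim.
apply: lime_le; first exact: is_cvg_esups.
apply: nearW => n; apply: ge_ereal_sup => _ [i _ <-]; exact/Lnorm_leP.
Qed.
End Lr_norm.

(** The normalisation contributes [lambda1], and the [r]-th root of the expected mass, of order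
    [expR (- lambda1 * t)], contributes [- lambda1 / r]. The sum is negative because [r > 1]. *)
Definition decay_rate (R : realType) (r lambda1 : R) := (r - 1) * lambda1 / r.

Section limit_theorem.
Context (R : realType) (E : pmetricType R) (dO : measure_display)
  (O : measurableType dO) (X : hunt_process E O) (k : branching E).
Variables (V : R -> (E -> R) -> E -> R) (V_def : cumulant_semigroup k X V).
Variables (P : borel (fmeas E) -> probability (path_space E) R)
  (P_def : superprocess V P).
Implicit Types (f g : E -> R) (t s : R) (x : E).
Local Notation mean := (emean P).
Variables (h : E -> R) (lambda1 : R).
Hypotheses (bh : Bbplus h) (h_gt0 : forall x, 0 < h x) (l0 : lambda1 < 0).
Hypothesis mean_h : forall t x, 0 <= t -> mean t h x = expR (- lambda1 * t) * h x.
Variables (r : R) (r_range : 1 < r <= 2) (C1 : R) (C1_ge0 : 0 <= C1).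
Hypothesis H_moment : forall x,
  (\int[br_H k x]_(nu in @fmeas0 R E) ((\int[nu]_y h y) `^ r)%:E <= (C1 * h x)%:E)%E.
Variable mu : fmeas E.
Local Notation W := (Wh lambda1 h).
Local Notation N Y := ('N[P mu]_(r%:E)[EFin \o (Y : path_space E -> R)])%E.

Let r1 : 1 < r. Proof. by case/andP: r_range. Qed.
Let int_h0 (nu : fmeas E) : 0 <= \int[nu]_y h y.
Proof. by apply: Rintegral_ge0 => y _; exact: ltW. Qed.

Lemma integral_mass_h t : 0 <= t ->
  (\int[P mu]_w (1 + mass h t w)%:E = (1 + expR (- lambda1 * t) * \int[mu]_y h y)%:E)%E.
Proof.
move=> t0; under eq_integral do rewrite EFinD.
rewrite ge0_integralD//=; last 2 first.
- by move=> w _; rewrite lee_fin mass_ge0// => y; exact: ltW.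
- by apply/measurable_EFinP; exact: measurable_mass.
rewrite integral_cst// mul1e [X in (X + _)%E]probability_setT (mean_mass V_def P_def)//.
rewrite (_ : \int[mu]_x mean t h x = expR (- lambda1 * t) * \int[mu]_y h y)//.
rewrite -fmeas_RintegralZ; last exact: bh.1.
by apply: eq_Rintegral => y _; rewrite mean_h.
Qed.

(** Given [X_t = nu], [fluctuation_bound] applies at the fixed time [s]; the expectation of
    [1 + <h, X_t>] then grows at most like [expR (- lambda1 * t)]. *)
Lemma fluctuation_markov f c s : Bbplus f -> 0 <= c -> (forall y, f y <= c * h y) ->
  0 <= s -> exists2 C, 0 <= C & forall t, 0 <= t ->
  (\int[P mu]_w (`|mass f (t + s) w - mass (mean s f) t w| `^ r)%:E <=
   (C * expR (- lambda1 * t))%:E)%E.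
Proof.
move=> bf c0 fc s0.
have [C C0 hC] := fluctuation_bound V_def P_def bh h_gt0 l0 mean_h r_range C1_ge0 H_moment bf c0 fc s0.
exists (C * (1 + \int[mu]_y h y)); first by rewrite mulr_ge0// addr_ge0.
move=> t t0; have ts0 : 0 <= t + s by rewrite addr_ge0.
have bm := mean_Bbplus V_def P_def bf s0.
pose kap (w : path_space E) := image_measure (P (coordinate t w)) (measurable_coordinate (E := E) s0).
pose F (z : borel (fmeas E) * borel (fmeas E)) : \bar R :=
  (`|(\int[(z.2 : fmeas E)]_y f y) - (\int[(z.1 : fmeas E)]_y mean s f y)| `^ r)%:E.
have mF : measurable_fun setT F.
  apply: (@measurable_powR_norm _ _ _ r (fun z : borel (fmeas E) * borel (fmeas E) =>
    (\int[(z.2 : fmeas E)]_y f y) - (\int[(z.1 : fmeas E)]_y mean s f y))).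
  apply: measurable_funB.
    exact: (measurableT_comp (measurable_fmeas_Rintegral bf) measurable_snd).
  exact: (measurableT_comp (measurable_fmeas_Rintegral bm) measurable_fst).
have F0 z : (0 <= F z)%E by rewrite lee_fin powR_ge0.
have mC (B : set (borel (fmeas E))) u : 0 <= u -> measurable B ->
    measurable (coordinate u @^-1` B : set (path_space E)).
  by move=> u0 mB; rewrite -[X in measurable X]setTI; exact: measurable_coordinate.
have mkap U : measurable U -> measurable_fun setT (kap ^~ U).
  move=> mU; rewrite /kap.
  exact: (measurableT_comp (sp_measurable P_def (mC _ _ s0 mU)) (measurable_coordinate t0)).
have kfin w : (kap w setT < +oo)%E.
  by rewrite /kap image_measureE preimage_setT; exact: probability_ltry.
have := @ge0_integral_joint _ _ _ (path_space E) (borel (fmeas E)) (borel (fmeas E)) R (P mu)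
  (coordinate t) (coordinate (t + s)) kap (measurable_coordinate t0) (measurable_coordinate ts0).
move=> /(_ mkap kfin _ F F0 mF) J; rewrite [leLHS](_ : _ =
    \int[P mu]_w F (coordinate t w, coordinate (t + s) w))%E// J; last first.
  move=> A B mA mB; rewrite (sp_markov P_def)//.
  by apply: sub_sigma_algebra; exists t, A; split => //=; rewrite t0/=.
apply: (@le_trans _ _ (\int[P mu]_w (C%:E * (1 + mass h t w)%:E))%E).
  apply: ge0_le_integral => //.
  - by move=> w _; apply: integral_ge0.
  - apply: (@measurable_fun_integral_in _ _ (path_space E) (borel (fmeas E)) R kap setT _
      measurableT _ (fun z : path_space E * borel (fmeas E) => F (coordinate t z.1, z.2))) => //.
    apply: (measurableT_comp mF); apply: measurable_fun_pair; last exact: measurable_snd.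
    exact: (measurableT_comp (measurable_coordinate t0) measurable_fst).
  - apply: measurable_funeM; apply/measurable_EFinP; apply: measurable_funD => //.
    exact: measurable_mass.
  - move=> w _; rewrite /kap ge0_integral_image//; last first.
      exact: (measurableT_comp mF (measurable_fun_pair
        (@measurable_cst _ _ (borel (fmeas E)) (borel (fmeas E)) setT (coordinate t w))
        (@measurable_id _ (borel (fmeas E)) setT))).
    rewrite -EFinM; apply: (hC s (coordinate t w)); by rewrite s0 lexx.
rewrite ge0_integralZl//; last 2 first.
- by apply/measurable_EFinP; apply: measurable_funD => //; exact: measurable_mass.
- by move=> w _; rewrite lee_fin addr_ge0// mass_ge0// => y; exact: ltW.
rewrite integral_mass_h// -EFinM lee_fin -mulrA ler_wpM2l//.
have e1 : 1 <= expR (- lambda1 * t) by exact: expR_growth1.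
by rewrite mulrDl mul1r lerD// mulrC.
Qed.

Lemma measurable_W t : 0 <= t -> measurable_fun setT (W t : path_space E -> R).
Proof. by move=> t0; apply: measurable_funM => //; exact: measurable_mass. Qed.

Lemma W_ge0 t (w : path_space E) : 0 <= W t w.
Proof. by rewrite mulr_ge0 ?expR_ge0// mass_ge0// => y; exact: ltW. Qed.

Local Notation rate := (decay_rate r lambda1).

Lemma decay_rate_lt0 : rate < 0.
Proof. by rewrite /decay_rate pmulr_llt0 ?invr_gt0; [rewrite pmulr_rlt0// subr_gt0|have := r1; lra]. Qed.

Lemma scaled_fluctuation f c s : Bbplus f -> 0 <= c -> (forall y, f y <= c * h y) ->
  0 <= s -> exists2 K, 0 <= K & forall t, 0 <= t ->
  (N (fun w => expR (lambda1 * (t + s)) * (mass f (t + s) w - mass (mean s f) t w))%R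
   <= (K * expR (rate * t))%:E)%E.
Proof.
move=> bf c0 fc s0; have [C C0 hC] := fluctuation_markov bf c0 fc s0.
exists ((expR (lambda1 * s)) * C `^ r^-1).
  by rewrite mulr_ge0 ?expR_ge0 ?powR_ge0.
move=> t t0; have bm := mean_Bbplus V_def P_def bf s0.
have ts0 : 0 <= t + s by rewrite addr_ge0.
have := hC t t0 => /(Lnorm_root r1) h1.
have mY : measurable_fun setT (fun w : path_space E => mass f (t + s) w - mass (mean s f) t w).
  by apply: measurable_funB; exact: measurable_mass.
have q0 : 0 <= (C * expR (- lambda1 * t)) `^ r^-1 by exact: powR_ge0.
have r0 : r != 0 by rewrite gt_eqF//; have := r1; lra.
have := Lnorm_scale r1 (expR (lambda1 * (t + s))) mY q0 (h1 _).
rewrite ger0_norm ?expR_ge0// powRM ?expR_ge0// -expRM.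
move=> /(_ _)/le_trans; apply; rewrite ?mulr_ge0 ?expR_ge0//.
rewrite lee_fin le_eqVlt; apply/orP; left; apply/eqP.
rewrite mulrDr expRD [in RHS]/decay_rate.
have -> : expR ((r - 1) * lambda1 / r * t) = expR (lambda1 * t) * expR (- lambda1 * t * r^-1).
  by rewrite -expRD; congr expR; field.
ring.
Qed.

Lemma W_increment : exists2 K, 0 <= K & forall t, 0 <= t ->
  (N (fun w => W (t + 1) w - W t w)%R <= (K * expR (rate * t))%:E)%E.
Proof.
have hh1 y : h y <= 1 * h y by rewrite mul1r.
have [K K0 hK] := scaled_fluctuation bh ler01 hh1 ler01.
exists K => // t t0; apply: le_trans (hK t t0).
rewrite le_eqVlt; apply/orP; left; apply/eqP; congr (Lnorm _ _ _).
apply/funext => w; congr EFin; rewrite mulrBr; congr (_ - _).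
rewrite (_ : mean 1 h = fun y => expR (- lambda1 * 1) * h y).
  rewrite mass_scale; last exact: bh.1.
  by rewrite mulrA -expRD; congr (expR _ * _); ring.
by apply/funext => y; rewrite mean_h.
Qed.

Lemma W_telescope K t m : 0 <= K -> (forall t, 0 <= t ->
  (N (fun w => W (t + 1) w - W t w)%R <= (K * expR (rate * t))%:E)%E) -> 0 <= t ->
  (N (fun w => W (t + m%:R) w - W t w)%R <=
   (K * expR (rate * t) / (1 - expR rate))%:E)%E.
Proof.
move=> K0 hK t0.
have q1 : expR rate < 1 by rewrite expR_lt1 decay_rate_lt0.
have q0 : 0 < expR rate by exact: expR_gt0.
have : (N (fun w => W (t + m%:R) w - W t w)%R <=
    (K * expR (rate * t) * \sum_(0 <= i < m) expR rate ^+ i)%:E)%E.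
  elim: m => [|m IH].
    rewrite big_nil mulr0; apply/Lnorm_leP => //.
    rewrite powR0; last by rewrite gt_eqF//; have := r1; lra.
    rewrite integral0_eq// => w _; rewrite addr0 subrr normr0 powR0//.
    by rewrite gt_eqF//; have := r1; lra.
  have tm0 : 0 <= t + m%:R by rewrite addr_ge0.
  have tm1 : 0 <= t + m%:R + 1 by rewrite addr_ge0.
  have mW1 : measurable_fun setT (fun w : path_space E => W (t + m%:R + 1) w - W (t + m%:R) w).
    by apply: measurable_funB; exact: measurable_W.
  have mW2 : measurable_fun setT (fun w : path_space E => W (t + m%:R) w - W t w).
    by apply: measurable_funB; exact: measurable_W.
  have := Lnorm_add r1 mW1 mW2 (hK _ tm0) IH.
  rewrite (_ : (fun w => _) = fun w => W (t + m.+1%:R) w - W t w); last first.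
    by apply/funext => w; rewrite -natr1 (addrA t) subrKA.
  move=> q; apply: (le_trans q); rewrite lee_fin big_nat_recr//= [X in _ <= X]mulrDr [leLHS]addrC lerD2l.
  by rewrite mulrDr expRD mulrA expRM_natr.
move=> q; apply: (le_trans q); rewrite lee_fin ler_wpM2l// ?mulr_ge0 ?expR_ge0//.
apply: (le_trans (geometric_sum_lt1 0 m _)); first by rewrite q0.
by rewrite expr0 mul1r.
Qed.

(** The martingale property is kept in integrated form over events of the past, which is the form
    that [weak_maximal] consumes. *)
Lemma W_martingale s t (A : set (path_space E)) : 0 <= s -> 0 <= t ->
  sigma_of [set r | 0 <= r <= s] (@coordinate R E) A ->
  (\int[P mu]_(w in A) (W (s + t) w)%:E = \int[P mu]_(w in A) (W s w)%:E)%E.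
Proof.
move=> s0 t0 sA; have mA := sigma_of_measurable sA.
have st0 : 0 <= s + t by rewrite addr_ge0.
pose G (nu : borel (fmeas E)) : \bar R := (\int[nu : fmeas E]_y h y)%:E.
have G0 nu : (0 <= G nu)%E by rewrite lee_fin; exact: int_h0.
have mG : measurable_fun setT G by apply/measurable_EFinP; exact: measurable_fmeas_Rintegral.
have mmass u : 0 <= u -> measurable_fun A (fun w : path_space E => (mass h u w)%:E).
  by move=> u0; apply/measurable_EFinP; apply: measurable_funTS; exact: measurable_mass.
have m0 u (w : path_space E) : (0 <= (mass h u w)%:E)%E.
  by rewrite lee_fin mass_ge0// => y; exact: ltW.
have IZ u a : 0 <= u -> 0 <= a -> (\int[P mu]_(w in A) (a%:E * (mass h u w)%:E) =
    a%:E * \int[P mu]_(w in A) (mass h u w)%:E)%E.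
  by move=> u0 a0; apply: ge0_integralZl; [exact: mA|exact: mmass|move=> w _; exact: m0|].
have e : (\int[P mu]_(w in A) (mass h (s + t) w)%:E =
    \int[P mu]_(w in A) \int[P (coordinate s w)]_u (mass h t u)%:E)%E.
  exact: (@markov _ _ _ _ P_def mu s t A G s0 t0 sA G0 mG).
have IW u : 0 <= u -> (\int[P mu]_(w in A) (W u w)%:E =
    (expR (lambda1 * u))%:E * \int[P mu]_(w in A) (mass h u w)%:E)%E.
  by move=> u0; rewrite -(IZ _ _ u0 (expR_ge0 _)).
rewrite (IW _ st0) (IW _ s0) e (_ : (\int[P mu]_(w in A) _)%E =
    ((expR (- lambda1 * t))%:E * \int[P mu]_(w in A) (mass h s w)%:E)%E).
  by rewrite muleA -EFinM -expRD; congr (_%:E * _)%E; congr expR; ring.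
rewrite -(IZ _ _ s0 (expR_ge0 _)); apply: eq_integral => w _; rewrite -EFinM.
rewrite (mean_mass V_def P_def)//; congr EFin.
rewrite -fmeas_RintegralZ; last exact: bh.1.
by apply: eq_Rintegral => y _; rewrite mean_h.
Qed.

Lemma W_integrable t : 0 <= t -> (P mu).-integrable setT (EFin \o (W t : path_space E -> R)).
Proof.
by move=> t0; exact: (integrableZl measurableT (expR (lambda1 * t)) (mass_integrable V_def P_def mu bh t0)).
Qed.

(** The sign [c] will be 1 or -1, so that the one-sided maximal inequality covers the absolute
    value. *)
Definition grid n K (c : R) j (w : path_space E) : R := c * (W (n%:R + j%:R * dyad K) w - W n%:R w).

Let time_ge0 (n j K : nat) : 0 <= n%:R + j%:R * dyad K :> R.
Proof. by rewrite addr_ge0// mulr_ge0// ltW// dyad_gt0. Qed.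

Lemma measurable_grid n K c j : measurable_fun setT (grid n K c j).
Proof.
by apply: measurable_funM => //; apply: measurable_funB; apply: measurable_W => //.
Qed.

Lemma grid_passage n K e c : 0 < e -> `|c| = 1 ->
  (e%:E * P mu (passage (grid n K c) (2 ^ K) e) <=
   \int[P mu]_w (`|W (n%:R + 1) w - W n%:R w|)%:E)%E.
Proof.
move=> e0 c1; pose M := (2 ^ K)%N.
have ME : M%:R * dyad K = 1 :> R.
  by rewrite /M natrX /dyad mulfV// gt_eqF// exprn_gt0.
rewrite (_ : (\int[P mu]_w _)%E = (\int[P mu]_w (`|grid n K c M w|)%:E)%E); last first.
  by apply: eq_integral => w _; rewrite /grid normrM c1 mul1r ME.
apply: weak_maximal => //; first by move=> j; exact: measurable_grid.
move=> j jM; set A := first_passage _ _ _.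
pose s : R := n%:R + j%:R * dyad K.
have sA : sigma_of [set r | 0 <= r <= s] (@coordinate R E) A.
  (* First passage at index [j] looks at grid times up to [s] only, so the generic measurability
     proof can be run with [past E s] as the underlying space. *)
  have mp : @measurable _ (past E s) (first_passage (grid n K c) e j); last exact: mp.
  apply: measurable_first_passage => i ij.
  have mc u : 0 <= u -> u <= s -> measurable_fun setT (fun w : past E s => W u w).
    move=> u0 us; apply: measurable_funM => //.
    apply: (@measurableT_comp _ _ _ _ _ _ (fun nu : borel (fmeas E) => \int[(nu : fmeas E)]_y h y) _
      (fun w : past E s => coordinate u w)); first exact: measurable_fmeas_Rintegral.
    by move=> _ B mB; rewrite setTI; apply: sub_sigma_algebra; exists u, B; split => //=; rewrite u0.
  apply: measurable_funM => //; apply: measurable_funB.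
    by apply: mc => //; rewrite lerD2l ler_wpM2r ?ler_nat// ltW// dyad_gt0.
  by apply: mc => //; rewrite lerDl mulr_ge0// ltW// dyad_gt0.
have mA := sigma_of_measurable sA.
have iW u : 0 <= u -> (P mu).-integrable A (EFin \o (W u : path_space E -> R)).
  by move=> u0; apply: integrableS (W_integrable u0).
have eqI u : 0 <= u -> (\int[P mu]_(w in A) (c * (W u w - W n%:R w))%:E = c%:E *
   (\int[P mu]_(w in A) (W u w)%:E - \int[P mu]_(w in A) (W n%:R w)%:E))%E.
  move=> u0; have iB := integrableB mA (iW _ u0) (iW _ (ler0n _ n)).
  under eq_integral do rewrite EFinM.
  by rewrite integralZl// integralB_EFin//; exact: iW.
have e2 : (\int[P mu]_(w in A) (grid n K c j w)%:E = \int[P mu]_(w in A) (grid n K c M w)%:E)%E.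
  rewrite /grid (eqI _ (time_ge0 n j K)) (eqI _ (time_ge0 n M K)); congr (_ * (_ - _))%E; rewrite -/s.
  have sM : s <= n%:R + M%:R * dyad K by rewrite lerD2l ler_wpM2r ?ler_nat// ltW// dyad_gt0.
  have d0 : 0 <= n%:R + M%:R * dyad K - s by rewrite subr_ge0.
  have e3 : s + (n%:R + M%:R * dyad K - s) = n%:R + M%:R * dyad K by rewrite addrC subrK.
  by rewrite -(W_martingale (time_ge0 n j K) d0 sA) e3.
rewrite e2; apply: le_integral; first exact: mA.
- have iB := integrableB mA (iW _ (time_ge0 n M K)) (iW _ (ler0n _ n)).
  exact: (integrableZl mA c iB).
- have iB := integrableB mA (iW _ (time_ge0 n M K)) (iW _ (ler0n _ n)).
  exact: (integrable_abse (integrableZl mA c iB)).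
- by move=> w _; rewrite lee_fin ler_norm.
Qed.
End limit_theorem.

Section L1_bound.
Context d (T : measurableType d) (R : realType) (Q : probability T R).
Variable r : R.
Hypothesis r1 : 1 < r.

(** Integrates z <= 1 + z^r at z = |Y| / c. With [c] of the size of the norm, the bound keeps the
    same order. *)
Lemma Lnorm_integral (Y : T -> R) K c : measurable_fun setT Y -> 0 < c -> 0 <= K ->
  ('N[Q]_(r%:E)[EFin \o Y] <= (K * c)%:E)%E ->
  (\int[Q]_w (`|Y w|)%:E <= (c * (1 + K `^ r))%:E)%E.
Proof.
move=> mY c0 K0 hY.
have Kc0 : 0 <= K * c by rewrite mulr_ge0// ltW.
have := Lnorm_scale r1 c^-1 mY Kc0 hY.
rewrite gtr0_norm ?invr_gt0// mulrCA mulVf ?gt_eqF// mulr1 => /(Lnorm_leP Q r1 _ K0) h.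
have mc : measurable_fun setT (fun w => c^-1 * Y w) by exact: measurable_funM.
have mp := measurable_powR_norm r mc.
apply: (@le_trans _ _ (\int[Q]_w (c%:E * (1 + (`|c^-1 * Y w| `^ r)%:E)))%E).
  apply: ge0_le_integral => //.
  - by apply/measurable_EFinP; exact: measurableT_comp.
  - by apply: measurable_funeM; exact: emeasurable_funD.
  - move=> w _; rewrite -EFinD -EFinM lee_fin -ler_pdivrMl//.
    rewrite -{1}(gtr0_norm (_ : 0 < c^-1)) ?invr_gt0// -normrM.
    set z := `|_|; have [z1|/ltW z1] := leP z 1; first by apply: (le_trans z1); rewrite lerDl powR_ge0.
    apply: (@le_trans _ _ (z `^ r)); last by rewrite lerDr.
    by rewrite -{1}(powRr1 (normr_ge0 _ : 0 <= z)); apply: ler_powR => //; exact: ltW.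
have g0 w : (0 <= (`|c^-1 * Y w| `^ r)%:E)%E by rewrite lee_fin powR_ge0.
rewrite ge0_integralZl//; last 3 first.
- exact: emeasurable_funD.
- by move=> w _; rewrite adde_ge0.
- by rewrite lee_fin ltW.
rewrite [leRHS]EFinM; apply: lee_wpmul2l; first by rewrite lee_fin ltW.
rewrite ge0_integralD// integral_cst// mul1e [X in (X + _)%E]probability_setT EFinD.
by rewrite leeD2l.
Qed.
End L1_bound.

(** * Almost sure convergence of the martingale *)

Section almost_sure_limit.
Context (R : realType) (E : pmetricType R) (dO : measure_display)
  (O : measurableType dO) (X : hunt_process E O) (k : branching E).
Variables (V : R -> (E -> R) -> E -> R) (V_def : cumulant_semigroup k X V).
Variables (P : borel (fmeas E) -> probability (path_space E) R)
  (P_def : superprocess V P).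
Implicit Types (f g : E -> R) (t s : R) (x : E).
Local Notation mean := (emean P).
Variables (h : E -> R) (lambda1 : R).
Hypotheses (bh : Bbplus h) (h_gt0 : forall x, 0 < h x) (l0 : lambda1 < 0).
Hypothesis h_continuous : continuous h.
Hypothesis mean_h : forall t x, 0 <= t -> mean t h x = expR (- lambda1 * t) * h x.
Variables (r : R) (r_range : 1 < r <= 2) (C1 : R) (C1_ge0 : 0 <= C1).
Hypothesis H_moment : forall x,
  (\int[br_H k x]_(nu in @fmeas0 R E) ((\int[nu]_y h y) `^ r)%:E <= (C1 * h x)%:E)%E.
Variable mu : fmeas E.
Local Notation W := (Wh lambda1 h).
Local Notation rate := (decay_rate r lambda1).
Local Notation N Y := ('N[P mu]_(r%:E)[EFin \o (Y : path_space E -> R)])%E.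

Let r1 : 1 < r. Proof. by case/andP: r_range. Qed.
Let rate_lt0 : rate < 0. Proof. exact: decay_rate_lt0. Qed.
(** Half of the decay rate: increments are of order [rho ^+ n * rho ^+ n], so with threshold
    [rho ^+ n] both the threshold and the probability of exceeding it are summable. *)
Let rho := expR (rate / 2).

Let rho01 : 0 < rho < 1.
Proof. by rewrite expR_gt0 expR_lt1 pmulr_llt0. Qed.

Let rhoX n : expR (rate * n%:R) = rho ^+ n * rho ^+ n.
Proof.
by rewrite -exprMn -expRD -expRM_natr; congr expR; rewrite -splitr.
Qed.

Definition oscillation n K := [set w : path_space E |
  exists2 j, (j <= 2 ^ K)%N & rho ^+ n < `|W (n%:R + j%:R * dyad K) w - W n%:R w|].

Lemma oscillationE n K : oscillation n K =
  passage (grid h lambda1 n K 1) (2 ^ K) (rho ^+ n) `|`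
  passage (grid h lambda1 n K (-1)) (2 ^ K) (rho ^+ n).
Proof.
apply/seteqP; split => w.
  move=> [j jK]; rewrite ltr_normr => /orP[ej|ej].
    by left; exists j => //; rewrite /grid mul1r.
  by right; exists j => //; rewrite /grid mulN1r.
case=> -[j jK]; rewrite /grid ?mul1r ?mulN1r => o; exists j => //.
  by rewrite ltr_normr o.
by rewrite ltr_normr o orbT.
Qed.

Lemma measurable_oscillation n K : measurable (oscillation n K).
Proof.
by rewrite oscillationE; apply: measurableU; apply: measurable_passage => j; exact: measurable_grid.
Qed.

(* Doob's weak inequality, the L^1 norm of the increment over [n, n + 1] being
   of order [rho ^+ (2 * n)]. *)
Lemma oscillation_bound : exists2 C, 0 <= C & forall n K,
  (P mu (oscillation n K) <= (C * rho ^+ n)%:E)%E.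
Proof.
have [K0 K00 hK0] := W_increment V_def P_def bh h_gt0 l0 mean_h r_range C1_ge0 H_moment mu.
exists (2 * (1 + K0 `^ r)); first by rewrite mulr_ge0// addr_ge0// powR_ge0.
move=> n K; have e0 : 0 < rho ^+ n by rewrite exprn_gt0//; case/andP: rho01.
have L1 : (\int[P mu]_w (`|W (n%:R + 1) w - W n%:R w|)%:E <=
    (rho ^+ n * rho ^+ n * (1 + K0 `^ r))%:E)%E.
  rewrite -rhoX; apply: (Lnorm_integral r1) => //; [|exact: expR_gt0|exact: hK0].
  by apply: measurable_funB; apply: measurable_W => //; rewrite addr_ge0.
have one c : `|c| = 1 -> (P mu (passage (grid h lambda1 n K c) (2 ^ K) (rho ^+ n)) <=
    (rho ^+ n * (1 + K0 `^ r))%:E)%E.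
  move=> c1; have := grid_passage V_def P_def bh h_gt0 mean_h mu n K e0 c1.
  move=> /le_trans /(_ L1); rewrite -mulrA EFinM.
  by rewrite lee_pmul2l// lte_fin.
have mp c : measurable (passage (grid h lambda1 n K c) (2 ^ K) (rho ^+ n)).
  by apply: measurable_passage => j; exact: measurable_grid.
rewrite oscillationE; apply: (le_trans (measureU2 (P mu) (mp 1) (mp (-1)))).
apply: (le_trans (leeD (one 1 (normr1 _)) (one (-1) (normrN1 _)))).
by rewrite -EFinD lee_fin; lra.
Qed.

Lemma oscillation_nondecreasing n : nondecreasing_seq (oscillation n).
Proof.
apply/nondecreasing_seqP => K; apply/subsetPset => w [j jK o]; exists (2 * j)%N.
  by rewrite expnS leq_mul2l.
rewrite (_ : (2 * j)%:R * dyad K.+1 = j%:R * dyad K)//.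
rewrite /dyad natrM exprS invfM; field.
by rewrite expf_neq0.
Qed.

Lemma dyadic_cauchy_ae : \forall w \ae P mu, dyadic_cauchy (fun t => W t w).
Proof.
have [C C0 hC] := oscillation_bound.
pose B n := \bigcup_K oscillation n K.
have mB n : measurable (B n) by apply: bigcup_measurable => K _; exact: measurable_oscillation.
have PB n : (P mu (B n) <= (C * rho ^+ n)%:E)%E.
  have cv := nondecreasing_cvg_mu (mu := P mu) (fun K => @measurable_oscillation n K) (mB n)
    (@oscillation_nondecreasing n).
  by apply: (cvge_le _ cv); apply: nearW => K; exact: hC.
have sum_fin : (\sum_(n <oo) P mu (B n) < +oo)%E.
  apply: (@le_lt_trans _ _ (C / (1 - rho))%:E); last exact: ltry.
  apply: lime_le; first by apply: is_cvg_nneseries => n _ _; exact: measure_ge0.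
  apply: nearW => n; apply: (@le_trans _ _ (\sum_(0 <= i < n) (C * rho ^+ i)%:E)%E).
    by apply: lee_sum => i _; exact: PB.
  rewrite sumEFin lee_fin -mulr_sumr ler_wpM2l//.
  by apply: (le_trans (geometric_sum_lt1 0 n rho01)); rewrite expr0 mul1r.
have := lim_sup_set_cvg0 mB sum_fin => h0.
exists (lim_sup_set B); split => //.
  by apply: bigcap_measurableType => n _; apply: bigcup_measurable => j _; exact: mB.
move=> w /= nc; apply: contrapT => nB; apply: nc.
apply: (dyadic_cauchy_geometric rho01).
move: nB; rewrite /lim_sup_set => /existsNP[N] /not_implyP[_ nB].
exists N => n j K Nn jK; rewrite leNgt; apply/negP => o; apply: nB.
by exists n => //; exists K => //; exists j.
Qed.

(** Paths are right continuous for the weak topology, which tests bounded continuous functions: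
    continuity of [h] transfers it to the mass. *)
Lemma W_right_continuous (w : path_space E) t : 0 <= t -> W s w @[s --> t^'+] --> W t w.
Proof.
move=> t0; have bhf : bounded_fun h by exact: bh.1.2.
pose hC : Cb E := exist _ h (conj h_continuous bhf).
have cm : mass h s w @[s --> t^'+] --> mass h t w.
  exact: (cvg_comp _ _ (path_right_continuous t0) (@pairing_continuous R E hC (path_fun w t))).
apply: cvgM => //; apply: cvg_at_right_filter.
apply: continuous_comp; last exact: continuous_expR.
exact: mulrl_continuous.
Qed.

Lemma Wh_infty_cvg (w : path_space E) : dyadic_cauchy (fun t => W t w) ->
  W t w @[t --> +oo] --> Wh_infty lambda1 h w.
Proof. by move=> /(dyadic_cauchy_cvg (@W_right_continuous w)). Qed.

Lemma Wh_infty_ae : \forall w \ae P mu, W t w @[t --> +oo] --> Wh_infty lambda1 h w.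
Proof.
apply: (@filterS _ _ (ae_filter_ringOfSetsType (P mu)) _ _ _ dyadic_cauchy_ae) => w.
exact: Wh_infty_cvg.
Qed.

Definition convergence_set := [set w : path_space E | dyadic_cauchy (fun t => W t w)].

Lemma measurable_convergence_set : measurable convergence_set.
Proof.
pose A l n j K j' K' := [set w : path_space E |
  n%:R <= j%:R * dyad K :> R -> n%:R <= j'%:R * dyad K' :> R ->
  `|W (j%:R * dyad K) w - W (j'%:R * dyad K') w| <= l.+1%:R^-1].
rewrite (_ : convergence_set = \bigcap_l \bigcup_n \bigcap_j \bigcap_K \bigcap_j' \bigcap_K' A l n j K j' K').
  apply: bigcap_measurableType => l _; apply: bigcup_measurable => n _.
  apply: bigcap_measurableType => j _; apply: bigcap_measurableType => K _.
  apply: bigcap_measurableType => j' _; apply: bigcap_measurableType => K' _.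
  have m0 (i L : nat) : 0 <= i%:R * dyad L :> R by rewrite mulr_ge0// ltW// dyad_gt0.
  have mb : measurable [set w : path_space E | `|W (j%:R * dyad K) w - W (j'%:R * dyad K') w| <= l.+1%:R^-1].
    have mf : measurable_fun setT (fun w : path_space E => `|W (j%:R * dyad K) w - W (j'%:R * dyad K') w|).
      by apply: measurableT_comp => //; apply: measurable_funB; exact: measurable_W.
    rewrite (_ : [set w | _] = (fun w => `|W (j%:R * dyad K) w - W (j'%:R * dyad K') w|) @^-1` `]-oo, l.+1%:R^-1]%classic).
      by rewrite -[X in measurable X]setTI; exact: mf.
    by apply/seteqP; split => w; rewrite /= in_itv.
  have [h1|h1] := pselect (n%:R <= j%:R * dyad K :> R); last first.
    rewrite (_ : A _ _ _ _ _ _ = setT); first exact: measurableT.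
    by apply/seteqP; split => // w _ /h1.
  have [h2|h2] := pselect (n%:R <= j'%:R * dyad K' :> R); last first.
    rewrite (_ : A _ _ _ _ _ _ = setT); first exact: measurableT.
    by apply/seteqP; split => // w _ _ /h2.
  rewrite (_ : A _ _ _ _ _ _ = [set w : path_space E | `|W (j%:R * dyad K) w - W (j'%:R * dyad K') w| <= l.+1%:R^-1])//.
  by apply/seteqP; split => w /=; [exact|move=> + _ _].
apply/seteqP; split => w.
  by move=> c l _; have [n hn] := c l; exists n => // j _ K _ j' _ K' _; exact: hn.
by move=> c l; have [n _ hn] := c l I; exists n => j K j' K'; exact: (hn j I K I j' I K' I).
Qed.

(** A limit over real times is not visibly measurable, but it equals everywhere the limit along
    integers of [W] times the indicator of [convergence_set]. *)
Lemma measurable_Wh_infty : measurable_fun setT (Wh_infty lambda1 h : path_space E -> R).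
Proof.
apply: (@measurable_fun_cvg _ (path_space E) R setT (fun n w => \1_convergence_set w * W n%:R w)).
  move=> n; apply: measurable_funM; last exact: measurable_W.
  by apply: measurable_indic; exact: measurable_convergence_set.
move=> w _; rewrite indicE; have [/set_mem wc|wc] := boolP (w \in convergence_set).
  under eq_fun do rewrite mul1r.
  exact: (cvg_comp _ _ cvgr_idn (Wh_infty_cvg wc)).
(* Off [convergence_set] the operator [lim] takes its default value 0, in agreement with the
   indicator. *)
have -> : Wh_infty lambda1 h w = 0.
  apply: dvgP => cv; move/negP: wc; apply; apply/mem_set.
  exact/(dyadic_cauchy_cvg (@W_right_continuous w)).
under eq_fun do rewrite mul0r; exact: cvg_cst.
Qed.
End almost_sure_limit.

(** * Convergence in L^r *)

Section weak_law.
Context (R : realType) (E : pmetricType R) (dO : measure_display)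
  (O : measurableType dO) (X : hunt_process E O) (k : branching E).
Variables (V : R -> (E -> R) -> E -> R) (V_def : cumulant_semigroup k X V).
Variables (P : borel (fmeas E) -> probability (path_space E) R)
  (P_def : superprocess V P).
Implicit Types (f g : E -> R) (t s : R) (x : E).
Local Notation mean := (emean P).
Variables (h : E -> R) (lambda1 : R).
Hypotheses (bh : Bbplus h) (h_gt0 : forall x, 0 < h x) (l0 : lambda1 < 0).
Hypothesis h_continuous : continuous h.
Hypothesis mean_h : forall t x, 0 <= t -> mean t h x = expR (- lambda1 * t) * h x.
Variables (r : R) (r_range : 1 < r <= 2) (C1 : R) (C1_ge0 : 0 <= C1).
Hypothesis H_moment : forall x,
  (\int[br_H k x]_(nu in @fmeas0 R E) ((\int[nu]_y h y) `^ r)%:E <= (C1 * h x)%:E)%E.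
Variable mu : fmeas E.
Local Notation W := (Wh lambda1 h).
Local Notation W_oo := (Wh_infty lambda1 h).
Local Notation rate := (decay_rate r lambda1).
Local Notation N Y := ('N[P mu]_(r%:E)[EFin \o (Y : path_space E -> R)])%E.

Let r1 : 1 < r. Proof. by case/andP: r_range. Qed.
Let rate_lt0 : rate < 0. Proof. exact: decay_rate_lt0. Qed.
Let mW_oo : measurable_fun setT (W_oo : path_space E -> R).
Proof. exact: (measurable_Wh_infty lambda1 bh h_continuous). Qed.

Lemma expR_rate_small D e : 0 <= D -> 0 < e -> exists2 T, 0 <= T &
  forall t, T <= t -> D * expR (rate * t) <= e.
Proof.
move=> D0 e0; exists (D / (e * - rate)).
  by rewrite divr_ge0// mulr_ge0 ?oppr_ge0// ltW.
move=> t; have er : 0 < e * - rate by rewrite mulr_gt0// oppr_gt0.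
rewrite ler_pdivrMr// => h1.
have h2 := expR_ge1Dx (- (rate * t)); have h3 := expR_gt0 (rate * t).
have h4 : expR (- (rate * t)) * expR (rate * t) = 1 by rewrite -expRD addNr expR0.
have h5 : D <= e * expR (- (rate * t)).
  apply: (@le_trans _ _ (e * (1 - rate * t))); last by rewrite ler_wpM2l// ltW.
  by apply: (le_trans h1); lra.
by rewrite -[leRHS]mulr1 -h4 mulrA ler_wpM2r// ltW.
Qed.

Lemma mass_Lr f c t : Bbplus f -> 0 <= c -> (forall y, f y <= c * h y) -> 0 <= t ->
  exists2 K, 0 <= K & (N (mass f t) <= K%:E)%E.
Proof.
move=> bf c0 fc t0.
have [C C0 hC] := fluctuation_bound V_def P_def bh h_gt0 l0 mean_h r_range C1_ge0 H_moment bf c0 fc t0.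
have tt : 0 <= t <= t by rewrite t0 lexx.
set a := \int[mu]_y mean t f y in hC.
have h0 : 0 <= \int[mu]_y h y by apply: Rintegral_ge0 => y _; exact: ltW.
have D0 : 0 <= C * (1 + \int[mu]_y h y) by rewrite mulr_ge0// addr_ge0.
have n1 := Lnorm_root r1 D0 (hC t mu tt).
have n2 : (N (fun=> a) <= `|a|%:E)%E.
  apply/Lnorm_leP => //; rewrite integral_cst// [X in (_ * X)%E]probability_setT mule1//.
have m1 : measurable_fun setT (fun w : path_space E => mass f t w - a).
  by apply: measurable_funB => //; exact: measurable_mass.
have := Lnorm_add r1 m1 (measurable_cst _) n1 n2.
rewrite (_ : (fun w => _) = mass f t); last by apply/funext => w; rewrite subrK.
move=> n3; eexists; last exact: n3.
by rewrite addr_ge0// powR_ge0.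
Qed.

(** Telescoping bounds [W (t + n) - W t] uniformly in [n], and Fatou's lemma passes to the almost
    sure limit. *)
Lemma W_infty_rate : exists2 K, 0 <= K & forall t, 0 <= t ->
  (N (fun w => W t w - W_oo w)%R <= (K * expR (rate * t))%:E)%E.
Proof.
have [K K0 hK] := W_increment V_def P_def bh h_gt0 l0 mean_h r_range C1_ge0 H_moment mu.
have q1 : 0 < 1 - expR rate by rewrite subr_gt0 expR_lt1.
exists (K / (1 - expR rate)); first by rewrite divr_ge0// ltW.
move=> t t0.
have mWt : measurable_fun setT (W t : path_space E -> R) by exact: measurable_W.
have B0 : 0 <= K * expR (rate * t) / (1 - expR rate).
  by rewrite divr_ge0 ?mulr_ge0 ?expR_ge0// ltW.
have n1 : (N (fun w => W_oo w - W t w)%R <= (K * expR (rate * t) / (1 - expR rate))%:E)%E.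
  apply: (Lnorm_Fatou r1 B0 (Y_ := fun n w => W (t + n%:R) w - W t w)).
  - by move=> n; apply: measurable_funB => //; apply: measurable_W => //; rewrite addr_ge0.
  - exact: measurable_funB.
  - have ae := Wh_infty_ae V_def P_def bh h_gt0 l0 h_continuous mean_h r_range C1_ge0 H_moment mu.
    apply: (@filterS _ _ (ae_filter_ringOfSetsType (P mu)) _ _ _ ae) => w cv.
    apply: cvgB; last exact: cvg_cst.
    apply: (cvg_comp _ _ _ cv).
    by apply: (cvg_comp _ _ (@cvgr_idn R)); apply: cvg_addrl.
  - by move=> n; exact: (W_telescope bh l0 r_range).
have := n1; rewrite mulrAC; apply: le_trans.
apply: le_Lnorm => //; [exact: measurable_funB|exact: measurable_funB|].
by move=> w; rewrite distrC.
Qed.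

Lemma W_Lr_bound : exists2 K, 0 <= K & forall t, 0 <= t -> (N (W t) <= K%:E)%E.
Proof.
have [K K0 hK] := W_infty_rate.
have hh1 y : h y <= 1 * h y by rewrite mul1r.
have [L L0 hL] := mass_Lr bh ler01 hh1 (lexx 0).
have hW0 : (N (W 0) <= L%:E)%E.
  rewrite (_ : W 0 = mass h 0)//.
  by apply/funext => w; rewrite /Wh mulr0 expR0 mul1r.
have mW t : 0 <= t -> measurable_fun setT (W t : path_space E -> R) by exact: measurable_W.
exists (K + (K + L)); first by rewrite !addr_ge0.
move=> t t0.
have mB s : 0 <= s -> measurable_fun setT (fun w : path_space E => W s w - W_oo w).
  by move=> s0; apply: measurable_funB => //; exact: mW.
have mB' s : 0 <= s -> measurable_fun setT (fun w : path_space E => W_oo w - W s w).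
  by move=> s0; apply: measurable_funB => //; exact: mW.
have ub s : 0 <= s -> (N (fun w => W s w - W_oo w)%R <= K%:E)%E.
  move=> s0; apply: (le_trans (hK s s0)); rewrite lee_fin ler_piMr//.
  by rewrite expR_le1 nmulr_rle0.
have ub0 : (N (fun w => W_oo w - W 0 w)%R <= K%:E)%E.
  apply: le_trans (ub 0 (lexx 0)); apply: le_Lnorm => //; [exact: mB'|exact: mB|].
  by move=> w; rewrite distrC.
have n2 := Lnorm_add r1 (mB' 0 (lexx 0)) (mW 0 (lexx 0)) ub0 hW0.
have mB0 : measurable_fun setT (fun w : path_space E => W_oo w - W 0 w + W 0 w).
  by apply: measurable_funD; [exact: mB'|exact: mW].
have := Lnorm_add r1 (mB t t0) mB0 (ub t t0) n2.
rewrite (_ : (fun w => _) = W t)//; apply/funext => w; ring.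
Qed.

Lemma W_infty_Lr : exists2 K, 0 <= K & (N W_oo <= K%:E)%E.
Proof.
have [K K0 hK] := W_infty_rate; have [L L0 hL] := W_Lr_bound.
have mW0 : measurable_fun setT (W 0 : path_space E -> R) by exact: measurable_W.
have ub0 : (N (fun w => W_oo w - W 0 w)%R <= K%:E)%E.
  apply: (@le_trans _ _ (N (fun w => W 0 w - W_oo w)%R)).
    apply: le_Lnorm => //; [exact: measurable_funB|exact: measurable_funB|].
    by move=> w; rewrite distrC.
  by have := hK 0 (lexx 0); rewrite mulr0 expR0 mulr1.
exists (K + L); first by rewrite addr_ge0.
have mB : measurable_fun setT (fun w : path_space E => W_oo w - W 0 w) by exact: measurable_funB.
have := Lnorm_add r1 mB mW0 ub0 (hL 0 (lexx 0)).
by rewrite (_ : (fun w => _) = W_oo)//; apply/funext => w; rewrite subrK.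
Qed.

(** Ergodicity is used at a single time [s] for each tolerance [e]; the Markov property carries the
    estimate to all later times. *)
Lemma mass_Lp_cvg f c b : Bbplus f -> 0 <= c -> (forall y, f y <= c * h y) -> 0 <= b ->
  (forall e, 0 < e -> exists2 s, 0 < s & forall y,
    `|expR (lambda1 * s) * mean s f y - h y * b| <= e * h y * b) ->
  Lp_cvg (P mu) r (fun t w => expR (lambda1 * t) * mass f t w) (fun w => b * W_oo w).
Proof.
move=> bf c0 fc b0 erg.
have mY t : 0 <= t -> measurable_fun setT (fun w : path_space E => expR (lambda1 * t) * mass f t w).
  by move=> t0; apply: measurable_funM => //; exact: measurable_mass.
have mb : measurable_fun setT (fun w : path_space E => b * W_oo w) by exact: measurable_funM.
have inL (Y : path_space E -> R) K : measurable_fun setT Y -> (N Y <= K%:E)%E -> Y \in Lfun (P mu) r%:E.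
  move=> m hY; rewrite inE; apply/andP; split; rewrite inE//=.
  by apply: (le_lt_trans hY); exact: ltry.
split.
- move=> t t0; have [K K0 hK] := mass_Lr bf c0 fc t0.
  exact: (inL _ _ (mY t t0) (Lnorm_scale r1 _ (measurable_mass bf t0) K0 hK)).
- have [K K0 hK] := W_infty_Lr; exact: (inL _ _ mb (Lnorm_scale r1 _ mW_oo K0 hK)).
have [K K0 hK] := W_infty_rate; have [L L0 hL] := W_Lr_bound.
have main d : 0 < d -> exists T, forall t, T <= t ->
    (N (fun w => expR (lambda1 * t) * mass f t w - b * W_oo w)%R <= d%:E)%E.
  move=> d0; have d30 : 0 < d / 3 by rewrite divr_gt0.
  have bL0 : 0 < b * L + 1 by rewrite ltr_wpDl// mulr_ge0.
  have e0 : 0 < d / 3 / (b * L + 1) by rewrite divr_gt0.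
  (* [e] is fixed first, from the uniform bound [L] on the norm of [W], then the delay [s], and only
     then the threshold on time, whose constants depend on [s]. *)
  set e := d / 3 / (b * L + 1) in e0.
  have [s s0 hs] := erg _ e0; have s0' := ltW s0.
  have [A A0 hA] := scaled_fluctuation V_def P_def bh h_gt0 l0 mean_h r_range C1_ge0 H_moment mu bf c0 fc s0'.
  have [T1 T10 hT1] := expR_rate_small A0 d30.
  have [T2 T20 hT2] := expR_rate_small (mulr_ge0 b0 K0) d30.
  exists (s + (T1 + T2)) => t' t'T.
  pose t := t' - s; have t0 : 0 <= t by rewrite /t; lra.
  have t'E : t' = t + s by rewrite /t subrK.
  have ts0 : 0 <= t + s by rewrite addr_ge0.
  have bm := mean_Bbplus V_def P_def bf s0'.
  have mms : measurable_fun setT (fun w : path_space E => mass (mean s f) t w) by exact: measurable_mass.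
  have mmf : measurable_fun setT (fun w : path_space E => mass f (t + s) w) by exact: measurable_mass.
  have mWt : measurable_fun setT (W t : path_space E -> R) by exact: measurable_W.
  (* [Y1] is the fluctuation over the last [s] units of time, small for large [t]; [Y2] is the
     ergodic error, small for every [t] by the choice of [s]; [Y3] is the distance of the martingale
     from its limit. *)
  pose Y1 (w : path_space E) := expR (lambda1 * (t + s)) * (mass f (t + s) w - mass (mean s f) t w).
  pose Y2 (w : path_space E) := expR (lambda1 * (t + s)) * mass (mean s f) t w - b * W t w.
  pose Y3 (w : path_space E) := b * (W t w - W_oo w).
  have m1 : measurable_fun setT Y1 by apply: measurable_funM => //; exact: measurable_funB.
  have m2 : measurable_fun setT Y2 by apply: measurable_funB; exact: measurable_funM.
  have mWW : measurable_fun setT (fun w : path_space E => W t w - W_oo w) by exact: measurable_funB.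
  have m3 : measurable_fun setT Y3 by exact: measurable_funM.
  have n1 : (N Y1 <= (d / 3)%:E)%E.
    by apply: (le_trans (hA t t0)); rewrite lee_fin hT1// /t; lra.
  have n3 : (N Y3 <= (d / 3)%:E)%E.
    have Ke : 0 <= K * expR (rate * t) by rewrite mulr_ge0// expR_ge0.
    apply: (le_trans (Lnorm_scale r1 b mWW Ke (hK t t0))).
    by rewrite lee_fin ger0_norm// mulrA hT2// /t; lra.
  have n2 : (N Y2 <= (d / 3)%:E)%E.
    have meW : measurable_fun setT (fun w : path_space E => (e * b) * W t w) by exact: measurable_funM.
    apply: (@le_trans _ _ (N (fun w => (e * b) * W t w)%R)).
      apply: le_Lnorm => // w; rewrite [leRHS]ger0_norm; last first.
        by rewrite mulr_ge0 ?W_ge0// mulr_ge0// ltW.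
      have bEm : Bb (fun y => expR (lambda1 * s) * mean s f y) by exact: (BbplusM (expR_ge0 _) bm).1.
      have bhb : Bb (fun y => b * h y) by exact: (BbplusM b0 bh).1.
      (* The ergodic estimate is pointwise in [y], so it can be integrated path by path against the
         random measure [X_t]. *)
      rewrite (_ : Y2 w = expR (lambda1 * t) *
          \int[path_fun w t]_y (expR (lambda1 * s) * mean s f y - b * h y)); last first.
        rewrite fmeas_RintegralB// fmeas_RintegralZ ?fmeas_RintegralZ; [|exact: bh.1|exact: bm.1].
        by rewrite /Y2 mulrDr expRD /Wh /mass; ring.
      rewrite normrM ger0_norm ?expR_ge0// /Wh mulrCA ler_wpM2l ?expR_ge0//.
      have bB : Bb (fun y => expR (lambda1 * s) * mean s f y - b * h y).
        have [C2 C20 hC2] := BbP bEm; have [C3 C30 hC3] := BbP bhb.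
        apply: (@BbI _ _ _ (C2 + C3)); first by apply: measurable_funB; [exact: bEm.1|exact: bhb.1].
        by move=> y; apply: (le_trans (ler_normB _ _)); rewrite lerD.
      apply: (le_trans (le_normr_Rintegral measurableT (fmeas_integrable _ bB))).
      rewrite /mass -fmeas_RintegralZ; last exact: bh.1.
      apply: le_Rintegral => //.
      - exact: (integrable_abse (fmeas_integrable _ bB)).
      - by apply: fmeas_integrable; apply: (BbplusM _ bh).1; rewrite mulr_ge0// ltW.
      - by move=> y _; have := hs y; rewrite [h y * b]mulrC mulrAC.
    have ebL : 0 <= e * b by rewrite mulr_ge0// ltW.
    apply: (le_trans (Lnorm_scale r1 (e * b) mWt L0 (hL t t0))).
    rewrite lee_fin ger0_norm// -mulrA /e mulrAC ler_pdivrMr// ler_wpM2l ?(ltW d30)//.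
    by lra.
  have := Lnorm_add r1 m1 (measurable_funD m2 m3) n1 (Lnorm_add r1 m2 m3 n2 n3).
  rewrite (_ : (fun w => _) = fun w => expR (lambda1 * t') * mass f t' w - b * W_oo w).
    by rewrite (_ : d / 3 + (d / 3 + d / 3) = d)//; field.
  by apply/funext => w; rewrite t'E /Y1 /Y2 /Y3 /=; ring.
apply/fine_cvgP; split.
  have [T hT] := main 1 ltr01; exists T; split => [|t /ltW /hT h1]; first exact: num_real.
  by rewrite ge0_fin_numE ?Lnorm_ge0//; apply: (le_lt_trans h1); exact: ltry.
apply/cvgrPdist_le => d d0; have [T hT] := main d d0; exists T; split => [|t /ltW /hT h1]; first exact: num_real.
rewrite sub0r normrN /=; have f1 : 'N[P mu]_(r%:E)[EFin \o
    ((fun w => expR (lambda1 * t) * mass f t w) \- (fun w => b * W_oo w))%R]%E \is a fin_num.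
  by rewrite ge0_fin_numE ?Lnorm_ge0//; apply: (le_lt_trans h1); exact: ltry.
by rewrite ger0_norm ?fine_ge0 ?Lnorm_ge0// -lee_fin fineK.
Qed.
End weak_law.

Theorem theorem3p3 (R : realType) (E : pmetricType R)
  (E_lc : locally_compact [set: E]) (E_sep : separable_space E)
  (m : {sigma_finite_measure set (borel E) -> \bar R})
  (m_full : forall U : set E, open U -> U !=set0 -> (0 < m U)%E)
  (dO : measure_display) (O : measurableType dO) (X : hunt_process E O)
  (X_sym : symmetric_process m X)
  (F : set (E -> R)) (Q : (E -> R) -> (E -> R) -> R)
  (Q_dirichlet : dirichlet_form m F Q) (Q_regular : regular_form m F Q)
  (Q_X : associated_form m F Q X)
  (p : R -> E -> E -> R)
  (p_density : transition_density m (semigroup X) p)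
  (p_sym : forall t x y, 0 < t -> p t x y = p t y x)
  (k : branching E)
  (V : R -> (E -> R) -> E -> R) (V_def : cumulant_semigroup k X V)
  (P : borel (fmeas E) -> probability (path_space E) R)
  (P_def : superprocess V P)
  (M : R -> (E -> R) -> E -> R) (M_def : mean_semigroup k X M)
  (q : R -> E -> E -> R) (q_density : transition_density m M q)
  (gamma_kato : kato_class X m p (gamma_m k m))
  (a_L2 : L2 m (br_a k))
  (gamma_L2 : L2 m (gamma_int k (cst 1)))
  (lambda1 : R) (h hh : E -> R)
  (lambda1_lt0 : lambda1 < 0)
  (h_F : F h) (hh_F : F hh)
  (h_gt0 : forall x, 0 < h x) (hh_gt0 : forall x, 0 < hh x)
  (h_bounded : bounded_fun h) (h_continuous : continuous h)
  (h_norm : ('N[m]_2%:E[EFin \o h] = 1)%E) (h_hh : ip m h hh = 1)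
  (h_eigen : forall v, F v -> quasi_continuous m F Q v ->
     mean_form m k Q h v = lambda1 * ip m h v)
  (hh_eigen : forall v, F v -> quasi_continuous m F Q v ->
     mean_form m k Q v hh = lambda1 * ip m v hh)
  (psi_fine : forall f, Cxib X f -> (forall x, 0 <= f x) -> Cxib X (psi k f))
  (gamma_fine : forall f, Cxib X f ->
     Cxib X (fun x => gamma_int k f x - br_a k x * f x))
  (r : R) (r_range : 1 < r <= 2)
  (H_moment : (ereal_sup [set ((h x)^-1)%:E *
       \int[br_H k x]_(nu in @fmeas0 _ E) ((\int[nu]_y h y) `^ r)%R%:E
       | x in [set: E]] < +oo)%E)
  (q_ergodic : ereal_sup [set ess_sup m
       (fun y => `|expR (lambda1 * t) / (h x * hh y) * q t x y - 1|%:E)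
       | x in [set: E]] @[t --> +oo] --> 0%E) :
  forall mu : fmeas E,
    (\forall w \ae P mu,
       Wh lambda1 h t w @[t --> +oo] --> Wh_infty lambda1 h w) /\
    forall f, Bplus f -> bounded_fun (fun x => f x / h x) ->
      Lp_cvg (P mu) r (fun t w => expR (lambda1 * t) * mass f t w)
        (fun w => ip m f hh * Wh_infty lambda1 h w).
Proof.
have mh : Borel_fun h by exact: borel_continuous_measurable.
have bh : Bbplus h by split; split => // x; exact: ltW.
have mhh : Borel_fun hh.
  by have := df_L2 Q_dirichlet hh_F; rewrite /L2 inE => /andP[]; rewrite inE.
have mean_h : forall t x, 0 <= t -> emean P t h x = expR (- lambda1 * t) * h x.
  by move=> t x t0; exact: (mean_eigenfunction V_def P_def M_def q_density bh mhh h_gt0 hh_gt0 h_hh q_ergodic).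
have [C1 C10 HC1] : exists2 C1, 0 <= C1 & forall x,
    (\int[br_H k x]_(nu in @fmeas0 R E) ((\int[nu]_y h y) `^ r)%:E <= (C1 * h x)%:E)%E.
  move: H_moment; set S := ereal_sup _ => Soo.
  have ub x : (((h x)^-1)%:E * \int[br_H k x]_(nu in @fmeas0 R E) ((\int[nu]_y h y) `^ r)%:E <= S)%E.
    by apply: ereal_sup_ubound; exists x.
  have S0 : (0 <= S)%E.
    apply: le_trans (ub point); rewrite mule_ge0 ?lee_fin ?invr_ge0 ?(ltW (h_gt0 _))//.
    by apply: integral_ge0 => nu _; rewrite lee_fin powR_ge0.
  have Sf : S \is a fin_num by rewrite ge0_fin_numE.
  exists (fine S); first exact: fine_ge0.
  move=> x; rewrite mulrC EFinM fineK//.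
  have -> : (\int[br_H k x]_(nu in @fmeas0 R E) ((\int[nu]_y h y) `^ r)%:E)%E =
      ((h x)%:E * (((h x)^-1)%:E * \int[br_H k x]_(nu in @fmeas0 R E) ((\int[nu]_y h y) `^ r)%:E))%E.
    by rewrite muleA -EFinM divff ?mul1e// gt_eqF.
  by apply: lee_wpmul2l => //; rewrite lee_fin ltW.
move=> mu; split.
  exact: (Wh_infty_ae V_def P_def bh h_gt0 lambda1_lt0 h_continuous mean_h r_range C10 HC1).
move=> f [mf f0] bfh.
have [c c0 fc] : exists2 c, 0 <= c & forall y, f y <= c * h y.
  have [A [_ hA]] := bfh.
  (* Boundedness speaks only of constants strictly above [A], and [c] must be nonnegative. *)
  exists (`|A| + 1); first by rewrite addr_ge0.
  move=> y; rewrite -ler_pdivrMr//.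
  have A1 : A < `|A| + 1 by have := ler_norm A; lra.
  exact: le_trans (ler_norm _) (hA _ A1 y I).
have [H H0 hH] := BbplusP bh.
have bf : Bbplus f.
  apply: (@BbplusI _ _ _ (c * H)) => // y; rewrite f0/=.
  by apply: (le_trans (fc y)); rewrite ler_wpM2l//; case/andP: (hH y).
have b0 : 0 <= ip m f hh.
  by apply: Rintegral_ge0 => y _; rewrite mulr_ge0// ltW.
apply: (mass_Lp_cvg V_def P_def bh h_gt0 lambda1_lt0 h_continuous mean_h r_range C10 HC1 mu bf c0 fc b0).
move=> e e0.
have [T T0 hT] := ergodic_mean V_def P_def M_def q_density bh mhh h_gt0 hh_gt0 h_hh q_ergodic e0.
by exists T => // y; exact: (hT T f c y (lexx T) bf fc).
Qed.
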